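(* Let $d\ge3$. For $\beta>0$ sufficiently small, there exists a constant $c>0$ such that for all $y\in\mathbb{Z}^d$ $$Q\left(Z_0^{y,t}<e^{-u}\right)<c\,e^{-u^2/c},\qquad\forall\,t,u>0.$$
   Context: Let $d\ge 3$. Let $\eta$ be the continuous-time simple symmetric random walk on $\mathbb{Z}^d$: its jump times form a rate-1 Poisson point process and at each jump it moves to one of the $2d$ nearest neighbours with equal probability. $\mathbf{P}_{x,s}$, $\mathbf{E}_{x,s}$ denote law and expectation when $\eta_s=x$; for $t>s$, $\mathbf{E}_{x,s}^{y,t}$ is expectation under $\mathbf{P}_{x,s}$ conditioned on $\{\eta_t=y\}$. Put $p_t^z=\mathbf{P}_{0,0}(\eta_t=z)$. Environment: $\Omega$ is the set of functions $\omega:\mathbb{Z}^d\times\mathbb{R}\to\mathbb{R}$ such that for each $x$, $t\mapsto\omega(x,t)$ is continuous with $\omega(x,0)=0$; $(\Omega,\mathcal{F},Q)$ is the completed canonical probability space under which $W^x_t(\omega)=\omega(x,t)$, $x\in\mathbb{Z}^d$, are independent two-sided standard Wiener processes. For a walk path on $[s,t)$ with $n$ jumps at times $s<s_1<\dots<s_n<t$ and successive sites $\gamma_0,\dots,\gamma_n$, put $s_0=s$, $s_{n+1}=t$, and define the action $\mathcal{A}_s^t(\eta,\omega)=\sum_{j=0}^{n}(\omega(\gamma_j,s_{j+1})-\omega(\gamma_j,s_j))$. For $\beta>0$ and $s<t$ define $$Z_{x,s}^{y,t}(\omega)=e^{-\frac{\beta^2}{2}(t-s)}\,p_{t-s}^{y-x}\,\mathbf{E}_{x,s}^{y,t}e^{\beta\mathcal{A}_s^t(\cdot,\omega)},\qquad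 Z_s^{y,t}=\sum_{x\in\mathbb{Z}^d}Z_{x,s}^{y,t}.$$ Thus $Z_0^{y,t}$ is $Z_s^{y,t}$ with $s=0$. *)

(* Defs.v *)
From HB Require Import structures.
From mathcomp Require Import all_boot all_order all_algebra finmap.
From mathcomp Require Import all_classical all_reals all_analysis.

Set Implicit Arguments.
Unset Strict Implicit.
Unset Printing Implicit Defensive.

Import Order.TTheory GRing.Theory Num.Theory.
Import numFieldNormedType.Exports.

Local Open Scope classical_set_scope.
Local Open Scope ring_scope.

Notation lattice d := 'rV[int]_d.

Definition neighbours d (x y : lattice d) : bool :=
  (\sum_(i < d) `|(x ord0 i - y ord0 i)%R|)%N == 1%N.

(* The product rule over finite subfamilies, for classes of events [F i]. *)
Definition mutually_independent dT (T : measurableType dT) (R : realType)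
    (P : probability T R) (I : choiceType) (F : I -> set (set T)) : Prop :=
  forall (s : seq I) (A : I -> set T), uniq s ->
    (forall i, i \in s -> F i (A i)) ->
    P (\bigcap_(i in [set` s]) A i) = (\prod_(i <- s) P (A i))%E.

Definition sigma_of (T I : Type) (R : realType) (X : I -> T -> R)
    : set (set T) :=
  <<s \bigcup_i preimage_set_system setT (X i) measurable >>.

Record environment (R : realType) (d : nat) := Environment {
  env_fun :> lattice d -> R -> R ;
  env_continuous : forall x, continuous (env_fun x) ;
  env_origin : forall x, env_fun x 0 = 0
}.

Definition env0 (R : realType) d : environment R d :=
  @Environment R d (fun _ _ => 0) (fun _ => @cst_continuous R R 0)
    (fun _ => erefl).

HB.instance Definition _ R d := gen_eqMixin (environment R d).
HB.instance Definition _ R d := gen_choiceMixin (environment R d).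
HB.instance Definition _ R d := isPointed.Build (environment R d) (env0 R d).

Definition env_cylinder (R : realType) d : set (set (environment R d)) :=
  \bigcup_(x in [set: lattice d]) \bigcup_(t in [set: R])
    preimage_set_system setT (fun w : environment R d => w x t) measurable.

Definition env_space (R : realType) d :=
  g_sigma_algebraType (@env_cylinder R d).

Definition two_sided_wiener dT (T : measurableType dT) (R : realType)
    (P : probability T R) (W : R -> T -> R) : Prop :=
  [/\ forall t, measurable_fun setT (W t),
      forall w, W 0 w = 0 /\ continuous (W ^~ w),
      (* [normal_prob m s] has standard deviation [s] *)
      forall s t, s < t -> forall B, measurable B ->
        P [set w | B (W t w - W s w)] = normal_prob 0 (Num.sqrt (t - s)) B
    & forall t : nat -> R, {homo t : i j / (i < j)%N >-> i < j} ->
        mutually_independent P (fun i : nat =>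
          preimage_set_system setT (fun w => W (t i.+1) w - W (t i) w)
            measurable) ].

Definition wiener_environment (R : realType) d
    (Q : probability (env_space R d) R) : Prop :=
  (forall x : lattice d,
     two_sided_wiener Q (fun t (w : env_space R d) => env_fun w x t)) /\
  mutually_independent Q (fun x : lattice d =>
    sigma_of (fun t (w : env_space R d) => env_fun w x t)).

(* A trajectory on [s, +oo[ : it sits at [site n] between its [n]-th and its
   [n.+1]-st jump, the latter happening at time [jump n]. *)
Record walk (R : realType) (d : nat) (s : R) := Walk {
  jump : nat -> R ;
  site : nat -> lattice d ;
  jump_start : s < jump 0 ;
  jump_increasing : forall k, jump k < jump k.+1 ;
  jump_unbounded : forall r, exists k, r < jump k
}.

Lemma walk0_subproof (R : realType) (s : R) :
  [/\ s < s + 1%:R, forall k : nat, s + k.+1%:R < s + k.+2%:R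
    & forall r, exists k : nat, r < s + k.+1%:R].
Proof.
split=> [|k|r]; first by rewrite ltrDl ltr01.
- by rewrite ltrD2l ltr_nat.
- exists (Num.bound `|r - s|); rewrite -ltrBlDl.
  apply: le_lt_trans (ler_norm _) _.
  apply: lt_le_trans (archi_boundP (normr_ge0 _)) _.
  by rewrite ler_nat leqnSn.
Qed.

Definition walk0 (R : realType) d (s : R) : walk d s :=
  let: And3 h1 h2 h3 := walk0_subproof s in
  @Walk R d s (fun k => s + k.+1%:R) (fun=> 0) h1 h2 h3.

HB.instance Definition _ R d s := gen_eqMixin (@walk R d s).
HB.instance Definition _ R d s := gen_choiceMixin (@walk R d s).
HB.instance Definition _ R d s := isPointed.Build (@walk R d s) (walk0 d s).

Definition walk_cylinder (R : realType) d (s : R) : set (set (walk d s)) :=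
  \bigcup_k (preimage_set_system setT (fun p : walk d s => jump p k) measurable
    `|` preimage_set_system setT (fun p : walk d s => site p k) setT).

Definition walk_space (R : realType) d (s : R) :=
  g_sigma_algebraType (@walk_cylinder R d s).

Definition eta (R : realType) d (s : R) (p : walk d s) (r : R) : lattice d :=
  site p #|` fset_set [set k | jump p k <= r]|%fset.

(* The points [tau 0 < tau 1 < ...] form a Poisson point process on ]s, +oo[
   with the Lebesgue measure as intensity. *)
Definition rate1_poisson_process dT (T : measurableType dT) (R : realType)
    (P : probability T R) (s : R) (tau : nat -> T -> R) : Prop :=
  let count (B : set R) k := [set w | ([set i | B (tau i w)] #= `I_k)%card] in
  (forall B : set R, measurable B -> B `<=` `]s, +oo[ -> (lebesgue_measure B < +oo)%E ->
    forall k, let m := fine (lebesgue_measure B) in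
      P (count B k) = (expR (- m) * m ^+ k / k`!%:R)%:E) /\
  (forall B : nat -> set R, (forall i, measurable (B i)) ->
    (forall i, B i `<=` `]s, +oo[) -> trivIset setT B ->
    mutually_independent P (fun i : nat => range (count (B i)))).

(* [P] is the law P_{x,s}: the jump chain starts at [x], moves to each of the
   [2d] neighbours with equal probability, and is independent of the clock. *)
Definition srw_law (R : realType) d (s : R) (x : lattice d)
    (P : probability (walk_space d s) R) : Prop :=
  rate1_poisson_process P s (fun k (p : walk_space d s) => jump p k) /\
  forall A, sigma_of (fun k (p : walk_space d s) => jump p k) A ->
    forall (n : nat) (g : nat -> lattice d),
      P (A `&` [set p | forall j, (j <= n)%N -> site p j = g j]) =
      (P A * ((g 0%N == x)%:R * \prod_(j < n)
         ((neighbours (g j) (g j.+1))%:R / (2 * d)%:R))%:E)%E.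

Section partition_function.
Context (R : realType) (d : nat).
Variable P : forall s : R, lattice d -> probability (walk_space d s) R.
Variable beta : R.

Definition transition (t : R) (z : lattice d) : R :=
  fine (P 0 0 [set p | eta p t = z]).

Definition action (s t : R) (p : walk d s) (w : environment R d) : R :=
  let n := #|` fset_set [set k | jump p k < t]|%fset in
  let time j := if j is j'.+1 then if (j' < n)%N then jump p j' else t else s in
  \sum_(j < n.+1) (w (site p j) (time j.+1) - w (site p j) (time j)).

(* Expectation of [f >= 0] under P_{x,s} given [eta t = y]. *)
Definition bridge_expectation (s : R) (x : lattice d) (t : R) (y : lattice d)
    (f : walk_space d s -> \bar R) : \bar R :=
  let E := [set p : walk_space d s | eta p t = y] in
  ((fine (P s x E))^-1%:E * \int[P s x]_(p in E) f p)%E.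

(* Extended-real valued: for exceptional environments growing fast at spatial
   infinity these can be +oo. *)
Definition Zpp (s : R) (x : lattice d) (t : R) (y : lattice d)
    (w : environment R d) : \bar R :=
  ((expR (- (beta ^+ 2 / 2 * (t - s))))%:E * (transition (t - s) (y - x))%:E *
   @bridge_expectation s x t y (fun p => (expR (beta * action t p w))%:E))%E.

Definition Zlp (s t : R) (y : lattice d) (w : environment R d) : \bar R :=
  (\esum_(x in [set: lattice d]) Zpp s x t y w)%E.

End partition_function.

(* Main.v *)
From HB Require Import structures.
Require Import Defs.
From mathcomp Require Import all_boot all_order all_algebra finmap.
From mathcomp Require Import all_classical all_reals all_analysis.
From mathcomp Require Import measurable_realfun.
From mathcomp Require Import ring lra zify.

Set Implicit Arguments.
Unset Strict Implicit.
Unset Printing Implicit Defensive.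

Import Order.TTheory GRing.Theory Num.Theory.
Import numFieldNormedType.Exports.
Local Open Scope classical_set_scope.
Local Open Scope ring_scope.

(** For small beta and d >= 3 the partition function is bounded in L2: the second
moment of a mean of Gaussian exponentials is the mean, over two independent
walks, of the exponential of beta^2 times the time they spend together, and
two transient walks meet too little to make this large, whatever t is.
A Gaussian exponential mean Z with bounded second moment has a Gaussian lower
tail, because log Z is convex, and its squared gradient at an environment is
the mean overlap of two replicas drawn from the Gibbs measure of that
environment. As the mean of Z is at least 1/2, bounds on the second moments of
Z and of its gradient show that, with a probability bounded below, Z is not
small and the gradient of log Z is not large ([good_prob]). The tangents of log Z at such points lie below log Z
everywhere ([tangent_le]); a finite maximum F of them is a Lipschitz function,
exceeds -2 with a probability bounded below, and concentrates
([affine_max_concentration]). Hence F is below -u with probability at most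
C exp(- u^2 / C), and so is log Z, which dominates F ([polymer_lower_tail]).
Concentration is obtained by rotating two independent Gaussian vectors into one another through
many small angles, the law of the pair being preserved by each rotation.

These arguments live in finite dimension. To get there, the sum over starting
points is cut to a finite set, and the walks to those that are tame: at most N
jumps up to time t, all sites in a finite box. This lowers Z ([Zlp_ge]) but,
for suitable cut-offs, keeps total mass at least 1/2 ([tame_mass]). The walk is
then observed at the M+1 multiples of h = t/(M+1) before t: the sampled action
converges to the action as M grows ([sampled_cvg]), so that an environment with
Z < exp(-u) also has a sampled partition function below exp(-u) for all large M
([discrete_eventually_small]). The event in question is thus contained in the
lower limit of measurable events whose probabilities are bounded uniformly in
M ([eventually_prob_le]), which controls its outer measure. The sampled
partition function is a finite combination of exponentials of linear forms in
the increments of the environment over slots of length h, and these increments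
are independent centred Gaussians of variance h ([increments_law]).

The second moment is computed along the reversed walk, which leaves y. By the
Markov property ([markov_samples]) a sampled path has mass at most a product of
heat kernels ([mass_le]), and the overlap of two paths is beta^2 h times the
number of slots at which they agree ([overlap_meetings]). Every meeting thus
costs a factor 1 + a = exp(2 beta^2 h). The function (A + |x|^2)^(-1/4) is
superharmonic in dimension d >= 3, strictly so at the origin ([green_pole]):
one step of the heat kernel lowers psi(x, y) = 1 + green(x - y) by at least a
multiple of h on the diagonal. For small beta this gain covers the factor paid
for the meeting, and induction on the number of slots bounds the second moment by psi,
hence by 2 ([second_moment_meetings], [second_moment]). *)

(** * The Gaussian law on the line *)

Section gauss1d.
Context {R : realType}.
Local Notation mu := (@lebesgue_measure R).
Local Open Scope ereal_scope.

(** The normal law is given as a set function. The density reappears as its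
    Radon-Nikodym derivative, up to a negligible set. *)
Lemma ge0_integral_normal_prob (s : R) (f : R -> \bar R) :
  measurable_fun setT f -> (forall x, 0 <= f x) ->
  \int[normal_prob 0%R s]_x f x = \int[mu]_x (f x * (normal_pdf 0%R s x)%:E).
Proof.
move=> mf f0.
have dom := normal_prob_dominates (0 : R) s.
have mpdf : measurable_fun setT (fun x : R => (normal_pdf 0%R s x)%:E).
  by apply/measurable_EFinP; exact: measurable_normal_pdf.
have iRN := Radon_Nikodym_SigmaFinite.f_integrable dom.
have RN0 := Radon_Nikodym_SigmaFinite.f_ge0 dom.
rewrite -(Radon_Nikodym_SigmaFinite.change_of_variables dom)//.
have H : ae_eq mu setT (Radon_Nikodym_SigmaFinite.f (normal_prob 0%R s) mu)
    (fun x => (normal_pdf 0%R s x)%:E).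
  apply: integral_ae_eq => // E _ mE.
  by rewrite -(Radon_Nikodym_SigmaFinite.f_integral dom).
apply: ge0_ae_eq_integral => //.
- by apply: emeasurable_funM => //; exact: (measurable_int mu).
- exact: emeasurable_funM.
- by move=> x _; rewrite mule_ge0.
- by move=> x _; rewrite mule_ge0// lee_fin normal_pdf_ge0.
- by move: H; apply: filterS => x /= H Tx; rewrite H.
Qed.

Lemma ge0_integral_shift (a : R) (f : R -> \bar R) :
  measurable_fun setT f -> (forall x, 0 <= f x) ->
  \int[mu]_x f (x + a)%R = \int[mu]_x f x.
Proof.
move=> mf f0.
pose sh : R -> measurableTypeR R := fun x => (x + a)%R.
have msh : measurable_fun setT sh by exact: measurable_funD.
have E : forall A, measurable A -> pushforward mu sh A = mu A.
  move=> A mA; apply/esym/lebesgue_measure_unique => //= _ [[c d]] _ <-.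
  rewrite /pushforward/=.
  have -> : sh @^-1` `]c, d] = `](c - a)%R, (d - a)%R]%classic.
    by apply/seteqP; split => x /=; rewrite !in_itv/= ltrBlDr lerBrDr.
  by rewrite !lebesgue_measure_itv/= !lte_fin ltrD2r; case: ifP => // _;
    rewrite -!EFinB; congr EFin; ring.
transitivity (\int[pushforward mu sh]_x f x).
  rewrite ge0_integral_pushforward//; by move=> y _; exact: f0.
by apply: eq_measure_integral => A mA _; exact: E.
Qed.

(** A rotation of the plane is a product of three shears, and a shear preserves
    Lebesgue measure by translation invariance on each line. *)
Lemma shear1 (t : R) (f : R * R -> \bar R) :
  measurable_fun setT f -> (forall x, 0 <= f x) ->
  \int[mu]_a \int[mu]_b f (a + t * b, b)%R = \int[mu]_a \int[mu]_b f (a, b).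
Proof.
move=> mf f0.
have mg : measurable_fun setT (fun z : R * R => f (z.1 + t * z.2, z.2)%R).
  apply: (measurableT_comp mf); apply/measurable_fun_pair => //=.
  by apply: measurable_funD => //; apply: measurable_funM.
transitivity (\int[mu]_b \int[mu]_a f (a + t * b, b)%R).
  by apply: (@fubini_tonelli _ _ _ _ R mu mu _ mg).
rewrite [RHS](@fubini_tonelli _ _ _ _ R mu mu _ mf f0); apply: eq_integral => b _ /=.
apply: (ge0_integral_shift (t * b) (f := fun a => f (a, b))) => //.
by apply: measurableT_comp => //; exact: measurable_fun_pair.
Qed.

Lemma shear2 (t : R) (f : R * R -> \bar R) :
  measurable_fun setT f -> (forall x, 0 <= f x) ->
  \int[mu]_a \int[mu]_b f (a, b + t * a)%R = \int[mu]_a \int[mu]_b f (a, b).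
Proof.
move=> mf f0; apply: eq_integral => a _.
apply: (ge0_integral_shift (t * a) (f := fun b => f (a, b))) => //.
by apply: measurableT_comp => //; exact: measurable_fun_pair.
Qed.

(** For an angle theta the middle shear has slope - sin theta and the outer ones
    slope tan (theta / 2) = (1 - cos theta) / sin theta, whence [s != 0]. *)
Lemma lebesgue_rotation (c s : R) (f : R * R -> \bar R) :
  (s != 0)%R -> (c ^+ 2 + s ^+ 2 = 1)%R ->
  measurable_fun setT f -> (forall x, 0 <= f x) ->
  \int[mu]_a \int[mu]_b f (c * a + s * b, - s * a + c * b)%R
  = \int[mu]_a \int[mu]_b f (a, b).
Proof.
move=> s0 cs mf f0; pose t : R := ((1 - c) / s)%R.
have mshear1 (h : R * R -> \bar R) : measurable_fun setT h ->
    measurable_fun setT (fun z : R * R => h (z.1 + t * z.2, z.2)%R).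
  move=> mh; apply: (measurableT_comp mh); apply/measurable_fun_pair => //=.
  by apply: measurable_funD => //; apply: measurable_funM.
have mshear2 (h : R * R -> \bar R) : measurable_fun setT h ->
    measurable_fun setT (fun z : R * R => h (z.1, z.2 + (- s) * z.1)%R).
  move=> mh; apply: (measurableT_comp mh); apply/measurable_fun_pair => //=.
  by apply: measurable_funD => //; apply: measurable_funM.
apply: etrans (shear1 t mf f0).
apply: etrans (shear2 (- s) (mshear1 _ mf) (fun _ => f0 _)).
apply: etrans (shear1 t (mshear2 _ (mshear1 _ mf)) (fun _ => f0 _)).
apply: eq_integral => a _; apply: eq_integral => b _ /=.
have ts : (t * s = 1 - c)%R by rewrite /t divfK.
have tc : (t * (1 + c) = s)%R.
  rewrite /t mulrAC -subr_sqr expr1n -cs addrAC subrr add0r expr2 mulrK//.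
  by rewrite unitfE.
congr (f (_, _)); last first.
  have -> : (b + - s * (a + t * b) = - s * a + (1 - t * s) * b)%R by ring.
  by rewrite ts; ring.
have -> : (a + t * b + t * (b + - s * (a + t * b)) =
  (1 - t * s) * a + (t * (1 + (1 - t * s))) * b)%R by ring.
rewrite ts; have -> : (1 - (1 - c) = c)%R by ring.
by rewrite tc.
Qed.

(** The density of the pair depends on [a ^+ 2 + b ^+ 2] only. *)
Lemma normal_rotation (sg c s : R) (f : R * R -> \bar R) :
  (sg != 0)%R -> (s != 0)%R -> (c ^+ 2 + s ^+ 2 = 1)%R ->
  measurable_fun setT f -> (forall x, 0 <= f x) ->
  \int[normal_prob 0%R sg]_a \int[normal_prob 0%R sg]_b
     f (c * a + s * b, - s * a + c * b)%R
  = \int[normal_prob 0%R sg]_a \int[normal_prob 0%R sg]_b f (a, b).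
Proof.
move=> sg0 s0 cs mf f0.
pose w (z : R * R) := (normal_pdf 0%R sg z.1 * normal_pdf 0%R sg z.2)%R.
have w0 z : (0 <= w z)%R by rewrite mulr_ge0// normal_pdf_ge0.
have mw : measurable_fun setT (fun z => (w z)%:E).
  apply/measurable_EFinP; apply: measurable_funM;
  by apply: (measurableT_comp (measurable_normal_pdf _ _)).
have key (h : R * R -> \bar R) : measurable_fun setT h -> (forall x, 0 <= h x) ->
   \int[normal_prob 0%R sg]_a \int[normal_prob 0%R sg]_b h (a, b) =
   \int[mu]_a \int[mu]_b (h (a, b) * (w (a, b))%:E).
  move=> mh h0.
  rewrite ge0_integral_normal_prob; last 2 first.
  - exact: (measurable_fun_fubini_tonelli_F (m2 := normal_prob 0%R sg)).
  - by move=> x; apply: integral_ge0.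
  apply: eq_integral => a _.
  have mha : measurable_fun setT (fun b => h (a, b)).
    by apply: measurableT_comp => //; exact: measurable_fun_pair.
  rewrite ge0_integral_normal_prob//.
  rewrite -ge0_integralZr//.
  - apply: eq_integral => b _; rewrite /w/= EFinM muleA [in RHS]muleAC.
    by rewrite -!muleA; congr (_ * _); exact: muleC.
  - apply: emeasurable_funM => //; apply/measurable_EFinP.
    exact: measurable_normal_pdf.
  - by move=> b _; rewrite mule_ge0// lee_fin normal_pdf_ge0.
  - by rewrite lee_fin normal_pdf_ge0.
have mrot : measurable_fun setT (fun z : R * R => (c * z.1 + s * z.2, - s * z.1 + c * z.2)%R).
  by apply/measurable_fun_pair => /=; apply: measurable_funD; apply: measurable_funM.
apply: etrans (key _ (measurableT_comp mf mrot) (fun _ => f0 _)) _.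
apply: etrans (esym (key f mf f0)).
apply: etrans (lebesgue_rotation s0 cs (f := fun z => f z * (w z)%:E) _ _).
- apply: eq_integral => a _; apply: eq_integral => b _ /=; congr (_ * _%:E).
  rewrite /w/= /normal_pdf (negbTE sg0) /normal_fun !subr0.
  rewrite mulrACA [RHS]mulrACA -!expRD; congr (_ * expR _)%R.
  rewrite -!mulrDl; congr (_ / _)%R.
  have -> : (- (c * a + s * b) ^+ 2 - (- s * a + c * b) ^+ 2 =
    - (c ^+ 2 + s ^+ 2) * (a ^+ 2 + b ^+ 2))%R by ring.
  by rewrite cs; ring.
- exact: emeasurable_funM.
- by move=> z; rewrite mule_ge0// lee_fin.
Qed.

(** Completing the square: tilting by [expR (a * x)] shifts the mean to
    [a * sg ^+ 2]. *)
Lemma normal_laplace (sg a : R) : (sg != 0)%R ->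
  \int[normal_prob 0%R sg]_x (expR (a * x))%:E = (expR (a ^+ 2 * sg ^+ 2 / 2))%:E.
Proof.
move=> sg0.
have mexp : measurable_fun setT (fun x : R => (expR (a * x))%:E).
  by apply/measurable_EFinP; apply: measurableT_comp => //; apply: measurable_funM.
rewrite ge0_integral_normal_prob//.
have K := @integral_normal_pdf R (a * sg ^+ 2)%R sg.
rewrite -[RHS]mule1 -K.
have mpdf : measurable_fun setT (fun x => (normal_pdf (a * sg ^+ 2) sg x)%:E).
  by apply/measurable_EFinP; exact: measurable_normal_pdf.
have pdf0 x : setT x -> 0 <= (normal_pdf (a * sg ^+ 2) sg x)%:E.
  by move=> _; rewrite lee_fin normal_pdf_ge0.
have e0 : 0 <= (expR (a ^+ 2 * sg ^+ 2 / 2))%:E by rewrite lee_fin expR_ge0.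
apply: etrans (@ge0_integralZl _ _ _ mu _ measurableT _ mpdf _ pdf0 e0).
apply: eq_integral => x _; rewrite -!EFinM; congr EFin.
rewrite !normal_pdfE// mulrCA [RHS]mulrCA; congr (_ * _)%R.
rewrite /normal_fun -!expRD; congr expR; field.
by rewrite sg0.
Qed.

End gauss1d.

Section gauss.
Context {R : realType}.

Definition toR (x : measurableTypeR R) : R := x.

Lemma measurable_toR : measurable_fun setT toR.
Proof. by move=> _ A mA; rewrite setTI. Qed.

HB.instance Definition _ := isMeasurableFun.Build _ _ _ _ toR measurable_toR.

(** The normal laws live on a copy of [R] with its own measurable structure;
    transporting them to [R] makes products and tuples of them available. *)
Definition gauss (s : R) : probability R R :=
  distribution (normal_prob 0 s : probability (measurableTypeR R) R) toR.

Lemma gaussE s A : gauss s A = normal_prob 0 s A.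
Proof. by []. Qed.

Lemma ge0_integral_gauss s (f : R -> \bar R) :
  measurable_fun setT f -> (forall x, 0 <= f x)%E ->
  (\int[gauss s]_x f x = \int[normal_prob 0%R s]_x f x)%E.
Proof. by move=> mf f0; rewrite ge0_integral_distribution. Qed.

Lemma gauss_laplace (sg a : R) : sg != 0 ->
  (\int[gauss sg]_x (expR (a * x))%:E = (expR (a ^+ 2 * sg ^+ 2 / 2))%:E)%E.
Proof.
move=> sg0; rewrite ge0_integral_gauss ?normal_laplace//.
by apply/measurable_EFinP; apply: measurableT_comp => //; apply: measurable_funM.
Qed.

Lemma gauss_rotation (sg c s : R) (f : R * R -> \bar R) :
  sg != 0 -> s != 0 -> c ^+ 2 + s ^+ 2 = 1 ->
  measurable_fun setT f -> (forall x, 0 <= f x)%E ->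
  (\int[gauss sg]_a \int[gauss sg]_b f (c * a + s * b, - s * a + c * b)%R
  = \int[gauss sg]_a \int[gauss sg]_b f (a, b))%E.
Proof.
move=> sg0 s0 cs mf f0.
have key (h : R * R -> \bar R) : measurable_fun setT h -> (forall x, 0 <= h x)%E ->
  (\int[gauss sg]_a \int[gauss sg]_b h (a, b) =
   \int[normal_prob 0%R sg]_a \int[normal_prob 0%R sg]_b h (a, b))%E.
  move=> mh h0; rewrite ge0_integral_gauss; last 2 first.
  - exact: (measurable_fun_fubini_tonelli_F (m2 := gauss sg)).
  - by move=> x; apply: integral_ge0.
  apply: eq_integral => a _; rewrite ge0_integral_gauss//.
  by apply: (measurableT_comp mh); exact/measurable_fun_pair.
have mrot : measurable_fun setT (fun z : R * R => (c * z.1 + s * z.2, - s * z.1 + c * z.2)%R).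
  by apply/measurable_fun_pair => /=; apply: measurable_funD; apply: measurable_funM.
apply: etrans (key _ (measurableT_comp mf mrot) (fun _ => f0 _)) _.
exact: etrans (normal_rotation sg0 s0 cs mf f0) (esym (key f mf f0)).
Qed.

End gauss.

(** * Tuples of independent Gaussian variables *)

Section tuple_product.
Context d (T : measurableType d) (R : realType).
Variable P : probability T R.

Definition tcons n (z : T * n.-tuple T) : n.+1.-tuple T := [tuple of z.1 :: z.2].

Lemma measurable_tcons n : measurable_fun setT (@tcons n).
Proof. exact: (measurable_cons (f := fst) (g := snd)). Qed.

HB.instance Definition _ n := isMeasurableFun.Build _ _ _ _ _ (@measurable_tcons n).

Fixpoint iid n : probability (n.-tuple T) R :=
  match n with
  | 0 => dirac [tuple]
  | m.+1 => distribution (P \x iid m)%E (@tcons m)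
  end.

Lemma ge0_integral_iidS n (f : n.+1.-tuple T -> \bar R) :
  measurable_fun setT f -> (forall x, 0 <= f x)%E ->
  (\int[iid n.+1]_v f v = \int[P]_x \int[iid n]_v f (tcons (x, v)))%E.
Proof.
move=> mf f0.
rewrite /= ge0_integral_distribution//.
apply: (fubini_tonelli1 (f \o @tcons n)) => //.
  by apply: measurableT_comp => //; exact: measurable_tcons.
by move=> x; exact: f0.
Qed.

Lemma measurable_tuple_rect n (B : 'I_n -> set T) : (forall i, measurable (B i)) ->
  measurable [set v : n.-tuple T | forall i, B i (tnth v i)].
Proof.
move=> mB.
rewrite (_ : [set _ | _] = \big[setI/setT]_(i < n) (fun v => tnth v i) @^-1` B i).
  apply: bigsetI_measurable => i _.
  by rewrite -[X in measurable X]setTI; exact: measurable_tnth.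
rewrite -bigcap_seq; apply/seteqP; split => v /= H i; first by move=> _; exact: H.
by apply: H => /=; rewrite mem_index_enum.
Qed.

Lemma iidX n (B : 'I_n -> set T) : (forall i, measurable (B i)) ->
  iid n [set v | forall i, B i (tnth v i)] = (\prod_(i < n) P (B i))%E.
Proof.
elim: n B => [|n IH] B mB.
  rewrite big_ord0 /= diracE mem_set//= => -[]//.
rewrite big_ord_recl /= /distribution /pushforward.
have -> : @tcons n @^-1` [set v | forall i, B i (tnth v i)] =
    B ord0 `*` [set v | forall i : 'I_n, B (lift ord0 i) (tnth v i)].
  apply/seteqP; split => -[x v] /= H.
    split; first exact: (H ord0).
    by move=> i; have := H (lift ord0 i); rewrite tnthS.
  move=> i; case: H => H0 H1; case: (unliftP ord0 i) => [j ->|->//].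
  by rewrite tnthS; exact: H1.
rewrite product_measure1E//; last exact: (@measurable_tuple_rect n (fun i => B (lift ord0 i))).
by congr (_ * _)%E; exact: (IH (fun i => B (lift ord0 i))).
Qed.

(** Boxes are stable under intersection and generate the measurable sets of
    tuples. *)
Lemma iid_unique n (m : probability (n.-tuple T) R) :
  (forall B : 'I_n -> set T, (forall i, measurable (B i)) ->
    m [set v | forall i, B i (tnth v i)] = (\prod_(i < n) P (B i))%E) ->
  forall A, measurable A -> m A = iid n A.
Proof.
move=> mE; pose G : set (set (n.-tuple T)) :=
  [set A | exists2 B : 'I_n -> set T, (forall i, measurable (B i)) &
     A = [set v | forall i, B i (tnth v i)]].
have GT : G setT by exists (fun=> setT) => //; apply/seteqP; split.
apply: (@measure_unique _ _ _ G (fun=> setT)) => //.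
- apply/seteqP; split; apply: smallest_sub => //; try exact: smallest_sigma_algebra.
  + rewrite -bigcup_seq; apply: bigcup_sub => i _ _ [B mB <-].
    apply: sub_sigma_algebra; exists (fun j => if j == i then B else setT).
      by move=> j; case: ifP.
    rewrite setTI; apply/seteqP; split => v /= H; last by have := H i; rewrite eqxx.
    by move=> j; case: eqP => // ->.
  + by move=> _ [B mB ->]; exact: measurable_tuple_rect.
- move=> _ _ [B mB ->] [C mC ->]; exists (fun i => B i `&` C i).
    by move=> i; exact: measurableI.
  apply/seteqP; split => v /= => [[H1 H2] i|H]; first by split.
  by split => i; have [] := H i.
- by rewrite bigcup_const.
- by move=> _ [B mB ->]; exact: etrans (mE _ mB) (esym (iidX mB)).
- by move=> _; apply: (le_lt_trans (probability_le1 m measurableT)); rewrite ltry.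
Qed.

End tuple_product.

Section gaussian_vector.
Context (R : realType) (sg : R).
Hypothesis sg0 : sg != 0.
Let g : probability R R := gauss sg.
Local Notation N n := (iid g n).

Definition dot n (a : 'I_n -> R) (v : n.-tuple R) : R := \sum_(i < n) a i * tnth v i.

Lemma measurable_dot n (a : 'I_n -> R) : measurable_fun setT (dot a).
Proof.
apply: measurable_sum => i; apply: measurable_funM => //; exact: measurable_tnth.
Qed.

Lemma laplace_iid n (a : 'I_n -> R) :
  (\int[N n]_v (expR (dot a v))%:E = (expR (\sum_(i < n) a i ^+ 2 * sg ^+ 2 / 2))%:E)%E.
Proof.
have mexp m (b : 'I_m -> R) : measurable_fun setT (fun v => (expR (dot b v))%:E).
  by apply/measurable_EFinP; apply: measurableT_comp => //; exact: measurable_dot.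
elim: n a => [|n IH] a.
  rewrite (eq_integral (cst 1%E)); last first.
    by move=> v _; rewrite /dot !big_ord0 expR0.
  by rewrite integral_cst// mul1e big_ord0 expR0; exact: probability_setT.
rewrite ge0_integral_iidS//.
transitivity (\int[g]_x ((expR (a ord0 * x))%:E *
   (expR (\sum_(i < n) a (lift ord0 i) ^+ 2 * sg ^+ 2 / 2))%:E))%E.
  apply: eq_integral => x _.
  rewrite -IH -ge0_integralZl//.
    apply: eq_integral => v _; rewrite /dot big_ord_recl/= expRD EFinM.
    by congr (_ * (expR _)%:E)%E; apply: eq_bigr => i _; rewrite tnthS.
  exact: mexp.
rewrite ge0_integralZr//; last first.
  by apply/measurable_EFinP; apply: measurableT_comp => //; apply: measurable_funM.
by rewrite gauss_laplace// -EFinM -expRD big_ord_recl.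
Qed.

(** The rotation of the plane acting coordinate by coordinate on a pair of
    vectors. *)
Definition rot (c s : R) n (x y : n.-tuple R) : n.-tuple R * n.-tuple R :=
  ([tuple c * tnth x i + s * tnth y i | i < n],
   [tuple - s * tnth x i + c * tnth y i | i < n]).

Lemma measurable_rot (c s : R) n :
  measurable_fun setT (fun z : n.-tuple R * n.-tuple R => rot c s z.1 z.2).
Proof.
have mt (j : 'I_n) : measurable_fun setT (fun v : n.-tuple R => tnth v j) by exact: measurable_tnth.
apply/measurable_fun_pair => /=; apply/measurable_fun_tnthP => i /=.
- rewrite (_ : _ \o _ = fun z => c * tnth z.1 i + s * tnth z.2 i).
    apply: measurable_funD; apply: measurable_funM => //;
    by apply: (measurableT_comp (mt i)).
  by apply/funext => z /=; rewrite tnth_mktuple.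
- rewrite (_ : _ \o _ = fun z => - s * tnth z.1 i + c * tnth z.2 i).
    apply: measurable_funD; apply: measurable_funM => //;
    by apply: (measurableT_comp (mt i)).
  by apply/funext => z /=; rewrite tnth_mktuple.
Qed.

(** Coordinates of the pair are independent and each is rotation invariant;
    the induction peels off the first coordinate of both vectors. *)
Lemma iid_rotation (c s : R) n (f : n.-tuple R * n.-tuple R -> \bar R) :
  s != 0 -> c ^+ 2 + s ^+ 2 = 1 ->
  measurable_fun setT f -> (forall x, 0 <= f x)%E ->
  (\int[N n]_x \int[N n]_y f (rot c s x y) = \int[N n]_x \int[N n]_y f (x, y))%E.
Proof.
move=> s0 cs; elim: n f => [|n IH] f mf f0.
  apply: eq_integral => x _; apply: eq_integral => y _; congr f.
  by rewrite [rot _ _ _ _]surjective_pairing; congr pair; rewrite tuple0 [RHS]tuple0.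
pose F (h : n.+1.-tuple R * n.+1.-tuple R -> \bar R) (ab : R * R) :=
  (\int[N n]_x \int[N n]_y h (tcons (ab.1, x), tcons (ab.2, y)))%E.
have mF h : measurable_fun setT h -> (forall x, 0 <= h x)%E -> measurable_fun setT (F h).
  move=> mh h0.
  have mh3 : measurable_fun setT (fun z : (R * R) * n.-tuple R * n.-tuple R =>
    h (tcons (z.1.1.1, z.1.2), tcons (z.1.1.2, z.2))).
    apply: (measurableT_comp mh); apply/measurable_fun_pair => /=.
      apply: (measurableT_comp (@measurable_tcons _ _ _)).
      by apply/measurable_fun_pair => /=; [do 2 apply: measurableT_comp => // |apply: measurableT_comp].
    apply: (measurableT_comp (@measurable_tcons _ _ _)).
    by apply/measurable_fun_pair => //=; do 2 apply: measurableT_comp => //.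
  have := measurable_fun_fubini_tonelli_F (m2 := N n) _ mh3 (fun _ => h0 _).
  move=> mh2.
  apply: (measurable_fun_fubini_tonelli_F (m2 := N n) _ mh2) => z.
  by apply: integral_ge0 => y _; exact: h0.
have F0 h ab : (forall x, 0 <= h x)%E -> (0 <= F h ab)%E.
  by move=> h0; apply: integral_ge0 => x _; apply: integral_ge0.
have key h : measurable_fun setT h -> (forall x, 0 <= h x)%E ->
    (\int[N n.+1]_x \int[N n.+1]_y h (x, y) = \int[g]_a \int[g]_b F h (a, b))%E.
  move=> mh h0.
  rewrite ge0_integral_iidS; last 2 first.
  - exact: (measurable_fun_fubini_tonelli_F (m2 := N n.+1)).
  - by move=> x; apply: integral_ge0.
  apply: eq_integral => a _; rewrite /F/=.
  transitivity (\int[N n]_x \int[g]_b \int[N n]_y h (tcons (a, x), tcons (b, y)))%E.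
    apply: eq_integral => x _; rewrite ge0_integral_iidS//.
    by apply: (measurableT_comp mh); exact/measurable_fun_pair.
  have mh3 : measurable_fun setT (fun z : n.-tuple R * R * n.-tuple R =>
    h (tcons (a, z.1.1), tcons (z.1.2, z.2))).
    apply: (measurableT_comp mh); apply/measurable_fun_pair => /=.
      apply: (measurableT_comp (@measurable_tcons _ _ _)).
      by apply/measurable_fun_pair => //=; apply: measurableT_comp.
    apply: (measurableT_comp (@measurable_tcons _ _ _)).
    by apply/measurable_fun_pair => //=; apply: measurableT_comp.
  have mh2 := measurable_fun_fubini_tonelli_F (m2 := N n) _ mh3 (fun _ => h0 _).
  apply: (@fubini_tonelli _ _ _ _ R (N n) g _ mh2) => z.
  by apply: integral_ge0 => y _; exact: h0.
have mrot := measurable_rot (n := n.+1) c s.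
apply: etrans (key _ (measurableT_comp mf mrot) (fun _ => f0 _)) _.
apply: etrans _ (esym (key f mf f0)).
apply: etrans (gauss_rotation sg0 s0 cs (mF _ mf f0) (fun z => F0 _ z f0)).
apply: eq_integral => a _; apply: eq_integral => b _; rewrite {1}/F /=.
pose a' : R := c * a + s * b; pose b' : R := - s * a + c * b.
have mh : measurable_fun setT (fun z : n.-tuple R * n.-tuple R => f (tcons (a', z.1), tcons (b', z.2))).
  apply: (measurableT_comp mf); apply/measurable_fun_pair => /=;
  apply: (measurableT_comp (@measurable_tcons _ _ _)); exact/measurable_fun_pair.
apply: etrans (IH _ mh (fun z => f0 _)).
apply: eq_integral => x _; apply: eq_integral => y _; congr f.
rewrite [rot _ _ _ _]surjective_pairing; congr pair; apply: eq_from_tnth => i;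
 rewrite tnth_mktuple; case: (unliftP ord0 i) => [j ->|->]; rewrite ?tnthS ?tnth_mktuple //.
Qed.

End gaussian_vector.

(** * Gaussian concentration for maxima of affine functions *)

Section elementary.
Context {R : realType}.

Lemma sin_le (x : R) : 0 <= x -> sin x <= x.
Proof.
rewrite le_eqVlt => /orP[/eqP <-|x0]; first by rewrite sin0.
have [c _] := @MVT R sin cos 0 x x0 (fun y _ => is_derive_sin y)
  (continuous_subspaceT (@continuous_sin R)).
rewrite sin0 !subr0 => ->; rewrite ler_piMl ?cos_le1//; exact: ltW.
Qed.

(** Convexity of the exponential, as a tangent line: the form in which all
    Jensen-type inequalities below are derived. *)
Lemma expR_tangent (m z : R) : expR m * (1 + (z - m)) <= expR z.
Proof.
rewrite -[leRHS](_ : expR (m + (z - m)) = _); last by congr expR; ring.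
by rewrite expRD ler_wpM2l ?expR_ge0//; exact: expR_ge1Dx.
Qed.

Lemma expR_convex (e d : R) : 0 <= e <= 1 -> expR (e * d) <= 1 + e * expR d.
Proof.
move=> /andP[e0 e1].
set m := e * d.
have := expR_tangent m 0; rewrite sub0r expR0 => H1.
have H2 := expR_tangent m d.
have -> : expR m = (1 - e) * (expR m * (1 - m)) + e * (expR m * (1 + (d - m))).
  have -> : (1 - e) * (expR m * (1 - m)) + e * (expR m * (1 + (d - m))) =
    expR m * (1 - m + e * d) by ring.
  by rewrite subrK mulr1.
apply: lerD; last by rewrite ler_wpM2l.
rewrite (le_trans (ler_wpM2l _ H1)) ?subr_ge0// mulr1; lra.
Qed.

Lemma expR_jensen N (z : nat -> R) :
  expR ((\sum_(i < N.+1) z i) / N.+1%:R) <= (\sum_(i < N.+1) expR (z i)) / N.+1%:R.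
Proof.
set m := _ / _; rewrite ler_pdivlMr ?ltr0n//.
have H : \sum_(i < N.+1) expR m * (1 + (z i - m)) <= \sum_(i < N.+1) expR (z i).
  by apply: ler_sum => i _; exact: expR_tangent.
apply: le_trans H.
rewrite -mulr_sumr big_split/= sumr_const card_ord sumrB sumr_const card_ord.
rewrite -[m *+ _]mulr_natr /m divfK ?pnatr_eq0// subrr addr0.
by rewrite ler_wpM2l ?expR_ge0.
Qed.

End elementary.

Section concentration.
Context (R : realType) (sg : R).
Hypothesis sg0 : sg != 0.
Variables (n k : nat) (alpha : 'I_k.+1 -> R) (a : 'I_k.+1 -> 'I_n -> R) (L : R).
Hypothesis aL : forall j, \sum_(i < n) a j i ^+ 2 * sg ^+ 2 <= L.
Local Notation N := (iid (gauss sg) n).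

(** The default value of the iterated maximum is one of the affine functions, so
    that it never contributes. *)
Definition affine_max (v : n.-tuple R) : R :=
  \big[Num.max/(alpha ord0 + dot (a ord0) v)]_(j < k.+1) (alpha j + dot (a j) v).
Local Notation F := affine_max.

Lemma affine_max_ge j v : alpha j + dot (a j) v <= F v.
Proof. exact: (le_bigmax _ (fun j => alpha j + dot (a j) v)). Qed.

Lemma affine_max_eq v : exists j, F v = alpha j + dot (a j) v.
Proof.
rewrite /affine_max; elim: (index_enum _) => [|i r [j IH]].
  by exists ord0; rewrite big_nil.
rewrite big_cons IH maxEle; case: ifP => _; [by exists j|by exists i].
Qed.

Lemma measurable_affine_max : measurable_fun setT F.
Proof.
have mj j : measurable_fun setT (fun v => alpha j + dot (a j) v).
  by apply: measurable_funD => //; exact: measurable_dot.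
rewrite /affine_max; elim: (index_enum _) => [|j r IH].
  by rewrite [X in measurable_fun _ X](_ : _ = fun v => alpha ord0 + dot (a ord0) v)//;
    apply/funext => v; rewrite big_nil.
under eq_fun do rewrite big_cons.
exact: measurable_maxr.
Qed.

(** One rotation by a small angle. At [x] the convex function [F] has a
    subgradient [a j], so that the increment of [F] is at most
    [(1 - c) * dot (a j) x - s * dot (a j) y]. The second term is integrated
    exactly. The first has a small coefficient and only yields a factor close
    to 1, however crudely the random index [j] is summed over. *)
Lemma rotation_step (mu c s : R) : 0 <= mu -> 0 <= mu * (1 - c) <= 1 ->
  (\int[N]_x \int[N]_y (expR (mu * (F x - F (rot c s x y).1)))%:E <=
   ((1 + mu * (1 - c) * (k.+1%:R * expR (L / 2))) *
     expR ((mu * s) ^+ 2 * (L / 2)))%:E)%E.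
Proof.
move=> mu0 /andP[e0 e1]; set e := mu * (1 - c).
pose C := expR ((mu * s) ^+ 2 * (L / 2)).
have inner x : (\int[N]_y (expR (mu * (F x - F (rot c s x y).1)))%:E <=
   ((1 + e * \sum_(j < k.+1) expR (dot (a j) x)) * C)%:E)%E.
  have [j Fj] := affine_max_eq x.
  pose b i := - (mu * s * a j i).
  apply: (@le_trans _ _ (\int[N]_y ((expR (e * dot (a j) x))%:E * (expR (dot b y))%:E)))%E.
    apply: ge0_le_integral => //.
    - apply/measurable_EFinP; apply: measurableT_comp => //.
      apply: measurable_funM => //; apply: measurable_funB => //.
      apply: (measurableT_comp measurable_affine_max).
      apply: (measurableT_comp measurable_fst).
      exact: (measurableT_comp (measurable_rot (n := n) c s) (pair1_measurable x)).
    - apply/measurable_EFinP; apply: measurable_funM => //.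
      by apply: measurableT_comp => //; exact: measurable_dot.
    - move=> y _; rewrite -EFinM lee_fin -expRD ler_expR.
      apply: (@le_trans _ _ (mu * (alpha j + dot (a j) x - (alpha j + dot (a j) (rot c s x y).1)))).
        by rewrite Fj ler_wpM2l// lerD2l lerN2 affine_max_ge.
      rewrite le_eqVlt; apply/orP; left; apply/eqP.
      have -> : dot (a j) (rot c s x y).1 = c * dot (a j) x + s * dot (a j) y.
        rewrite /dot !mulr_sumr -big_split/=; apply: eq_bigr => i _.
        by rewrite tnth_mktuple; ring.
      have -> : dot b y = - (mu * s * dot (a j) y).
        rewrite /dot mulr_sumr -sumrN; apply: eq_bigr => i _; rewrite /b; ring.
      by rewrite /e; ring.
  rewrite ge0_integralZl//; last first.
    by apply/measurable_EFinP; apply: measurableT_comp => //; exact: measurable_dot.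
  rewrite laplace_iid// -EFinM lee_fin; apply: ler_pM; rewrite ?expR_ge0//.
    apply: le_trans (expR_convex _ _) _; first by rewrite e0.
    rewrite lerD2l ler_wpM2l// (bigD1 j)//= lerDl.
    by apply: sumr_ge0 => i _; exact: expR_ge0.
  rewrite ler_expR.
  have -> : \sum_(i < n) b i ^+ 2 * sg ^+ 2 / 2 =
      (mu * s) ^+ 2 * ((\sum_(i < n) a j i ^+ 2 * sg ^+ 2) / 2).
    by rewrite mulr_suml mulr_sumr; apply: eq_bigr => i _; rewrite /b; ring.
  by rewrite ler_wpM2l ?sqr_ge0// ler_pM2r.
have mexpd j : measurable_fun setT (fun v => expR (dot (a j) v)).
  by apply: measurableT_comp => //; exact: measurable_dot.
have expd1 j : (\int[N]_v (expR (dot (a j) v))%:E <= (expR (L / 2))%:E)%E.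
  by rewrite laplace_iid// lee_fin ler_expR -mulr_suml ler_pM2r.
apply: (@le_trans _ _ (\int[N]_x ((1 + e * \sum_(j < k.+1) expR (dot (a j) x)) * C)%:E)%E).
  apply: ge0_le_integral => //.
  - by move=> x _; apply: integral_ge0.
  - apply: (measurable_fun_fubini_tonelli_F (m2 := N) (fun z => (expR (mu * (F z.1 - F (rot c s z.1 z.2).1)))%:E)) => //.
    apply/measurable_EFinP; apply: measurableT_comp => //.
    apply: measurable_funM => //; apply: measurable_funB.
      exact: (measurableT_comp measurable_affine_max).
    apply: (measurableT_comp measurable_affine_max).
    by apply: (measurableT_comp measurable_fst); exact: measurable_rot.
  - apply/measurable_EFinP; apply: measurable_funM => //.
    apply: measurable_funD => //; apply: measurable_funM => //.
    exact: measurable_sum.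
rewrite (eq_integral (fun x => (C%:E * (1%:E + e%:E * \sum_(j < k.+1) (expR (dot (a j) x))%:E))%E)); last first.
  by move=> x _; rewrite sumEFin mulrC.
have msum : measurable_fun setT (fun x => \sum_(j < k.+1) (expR (dot (a j) x))%:E)%E.
  by apply: emeasurable_sum => j; exact/measurable_EFinP.
have sum0 x : (0 <= \sum_(j < k.+1) (expR (dot (a j) x))%:E)%E.
  by apply: sume_ge0 => j _; rewrite lee_fin expR_ge0.
rewrite ge0_integralZl ?lee_fin ?expR_ge0//; last 2 first.
- by apply: emeasurable_funD => //; exact: emeasurable_funM.
- by move=> x _; rewrite adde_ge0// mule_ge0.
rewrite ge0_integralD//; last 2 first.
- by move=> x _; rewrite mule_ge0.
- exact: emeasurable_funM.
rewrite integral_cst// mul1e ge0_integralZl//.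
rewrite ge0_integral_sum//; last by move=> j; exact/measurable_EFinP.
rewrite (_ : (_ * expR _)%:E =
  (C%:E * (1%:E + e%:E * (k.+1%:R * expR (L / 2))%:E))%E); last by rewrite mulrC.
apply: lee_wpmul2l; first by rewrite lee_fin expR_ge0.
apply: leeD; first exact: probability_le1.
rewrite lee_wpmul2l//.
apply: (@le_trans _ _ (\sum_(j < k.+1) (expR (L / 2))%:E)%E); first exact: lee_sum.
by rewrite sumEFin sumr_const card_ord mulr_natl.
Qed.

Lemma measurable_rot_fst (c s : R) :
  measurable_fun setT (fun z : n.-tuple R * n.-tuple R => (rot c s z.1 z.2).1).
Proof. by apply: (measurableT_comp measurable_fst); exact: measurable_rot. Qed.

Lemma rot_rot (c s c' s' : R) (x y : n.-tuple R) :
  (rot c' s' (rot c s x y).1 (rot c s x y).2).1 =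
  (rot (c' * c - s' * s) (c' * s + s' * c) x y).1.
Proof.
by apply: eq_from_tnth => i; rewrite !tnth_mktuple; ring.
Qed.

(** Let [K] rotations of angle [pi / 2 / K] carry [x] to [y]. By convexity of
    the exponential, the left-hand side is at most the mean over the [K] steps
    of the exponential of [lam * K] times one increment, and by rotation
    invariance all steps have the same law. As [K] grows,
    [lam * K * sin (pi / 2 / K)] stays below [2 * lam] while the error factor
    of [rotation_step] tends to 1; [K] is taken so large that it is at most 2. *)
Lemma affine_max_concentration (lam : R) : 0 <= lam ->
  (\int[N]_x \int[N]_y (expR (lam * (F x - F y)))%:E <=
   (2 * expR (2 * lam ^+ 2 * L))%:E)%E.
Proof.
move=> lam0.
pose B := k.+1%:R * expR (L / 2).
have B0 : 0 <= B by rewrite mulr_ge0// expR_ge0.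
have L0 : 0 <= L.
  by apply: le_trans (aL ord0); apply: sumr_ge0 => i _; rewrite mulr_ge0 ?sqr_ge0.
pose M := Num.bound (2 * lam * (1 + B)).
have MB : 2 * lam * (1 + B) <= M.+1%:R.
  apply: le_trans (ltW (archi_boundP _)) _; last by rewrite ler_nat.
  by rewrite mulr_ge0// ?mulr_ge0// addr_ge0.
set K := M.+1 in MB; have K0 : (0 : R) < K%:R by rewrite ltr0n.
have /andP[pi0 pi2] : 0 <= (pi : R) / 2 <= 2.
  by have [] := pihalf_02_cos_pihalf R.
have pi4 : (pi / 2) ^+ 2 <= 4 :> R.
  have -> : 4 = 2 ^+ 2 :> R by ring.
  by rewrite ler_pXn2r ?nnegrE.
pose th : R := pi / 2 / K%:R.
have th0 : 0 <= th by rewrite divr_ge0.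
have Kth : K%:R * th = pi / 2 by rewrite /th mulrC divfK// gt_eqF.
have thpi : th <= pi / 2 by rewrite -Kth ler_peMl// ler1n.
have cos1 : 0 <= 1 - cos th <= th ^+ 2 / 2.
  have -> : th = (th / 2) *+ 2 by rewrite -mulr_natr divfK.
  rewrite cos_mulr2n; have := cos2Dsin2 (th / 2).
  have s0 : 0 <= sin (th / 2).
    by apply: sin_ge0_pi; apply/andP; split; lra.
  have s1 : sin (th / 2) <= th / 2 by apply: sin_le; rewrite divr_ge0.
  have : sin (th / 2) ^+ 2 <= (th / 2) ^+ 2 by rewrite ler_pXn2r// nnegrE divr_ge0.
  have := sqr_ge0 (sin (th / 2)).
  set S := sin _ ^+ 2; set C := cos _ ^+ 2; move=> S0 S1 CS.
  have -> : C = 1 - S by rewrite -CS addrK.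
  rewrite (mulr2n (1 - S)) (mulr2n (th / 2)); apply/andP; split; first lra.
  have -> : (th / 2 + th / 2) ^+ 2 / 2 = 2 * (th / 2) ^+ 2 by field.
  lra.
(* Jensen over K steps multiplies the exponent by K. *)
pose mu := lam * K%:R.
have mu0 : 0 <= mu by rewrite mulr_ge0// ltW.
have e0 : 0 <= mu * (1 - cos th) by case/andP : cos1 => *; rewrite mulr_ge0.
have eB : mu * (1 - cos th) * (1 + B) <= 1.
  have : mu * (1 - cos th) <= mu * (th ^+ 2 / 2) by case/andP : cos1 => *; rewrite ler_wpM2l.
  have -> : mu * (th ^+ 2 / 2) = lam * (pi / 2) ^+ 2 / 2 / K%:R.
    by rewrite /mu /th; field; rewrite gt_eqF.
  move=> H; apply: (@le_trans _ _ (2 * lam / K%:R * (1 + B))); last first.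
    by rewrite mulrAC ler_pdivrMr// mul1r.
  rewrite ler_wpM2r ?addr_ge0// (le_trans H)// ler_wpM2r ?invr_ge0 ?(ltW K0)//.
  by rewrite -mulrA [leRHS]mulrC ler_wpM2l//; lra.
pose X j (z : n.-tuple R * n.-tuple R) := (rot (cos (j%:R * th)) (sin (j%:R * th)) z.1 z.2).1.
have X0 z : X 0%N z = z.1.
  apply: eq_from_tnth => i; rewrite tnth_mktuple mul0r cos0 sin0; ring.
have XK z : X K z = z.2.
  apply: eq_from_tnth => i; rewrite tnth_mktuple Kth cos_pihalf sin_pihalf; ring.
pose G (z : n.-tuple R * n.-tuple R) := (expR (mu * (F z.1 - F (rot (cos th) (sin th) z.1 z.2).1)))%:E.
have mG : measurable_fun setT G.
  apply/measurable_EFinP; apply: measurableT_comp => //.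
  apply: measurable_funM => //; apply: measurable_funB.
    exact: (measurableT_comp measurable_affine_max).
  by apply: (measurableT_comp measurable_affine_max); exact: measurable_rot_fst.
have G0 z : (0 <= G z)%E by rewrite lee_fin expR_ge0.
pose D j z := (expR (mu * (F (X j z) - F (X j.+1 z))))%:E.
have DE j z : D j z = G (rot (cos (j%:R * th)) (sin (j%:R * th)) z.1 z.2).
  rewrite /D /G rot_rot; congr (expR (_ * (_ - F _)))%:E.
  by rewrite /X -natr1 mulrDl mul1r [_ + th]addrC cosD sinD [X in rot _ X]addrC [sin th * _]mulrC (mulrC (cos th) (sin _)) ; congr (rot _ _ _ _).1; ring.
have intD j : (j < K)%N -> (\int[N]_x \int[N]_y D j (x, y) = \int[N]_x \int[N]_y G (x, y))%E.
  case: j => [_|j jK].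
    apply: eq_integral => x _; apply: eq_integral => y _; rewrite DE; congr G => /=.
    rewrite mul0r cos0 sin0 [rot _ _ _ _]surjective_pairing; congr pair;
      apply: eq_from_tnth => i; rewrite tnth_mktuple; ring.
  apply: etrans (iid_rotation sg0 (c := cos (j.+1%:R * th)) (s := sin (j.+1%:R * th)) _ _ mG G0).
  - by apply: eq_integral => x _; apply: eq_integral => y _; rewrite DE.
  - rewrite gt_eqF// sin_gt0_pi// mulr_gt0 ?ltr0n//=; last by rewrite divr_gt0// divr_gt0// pi_gt0.
    apply: (@le_lt_trans _ _ (K%:R * th)); first by rewrite ler_wpM2r// ler_nat ltnW.
    by rewrite Kth; have := pi_gt0 R; lra.
  - exact: cos2Dsin2.
have mD j : measurable_fun setT (D j).
  by rewrite (_ : D j = fun z => G (rot (cos (j%:R * th)) (sin (j%:R * th)) z.1 z.2));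
    [apply: (measurableT_comp mG); exact: measurable_rot | apply/funext => z; exact: DE].
have D0 j z : (0 <= D j z)%E by rewrite lee_fin expR_ge0.
pose H (z : n.-tuple R * n.-tuple R) := (expR (lam * (F z.1 - F z.2)))%:E.
have HD z : (H z <= (K%:R^-1)%:E * \sum_(j < K) D j z)%E.
  rewrite sumEFin -EFinM lee_fin [leRHS]mulrC.
  apply: le_trans (expR_jensen M (fun j => mu * (F (X j z) - F (X j.+1 z)))).
  rewrite ler_expR -mulr_sumr -/K.
  have -> : \sum_(j < K) (F (X j z) - F (X j.+1 z)) = F z.1 - F z.2.
    rewrite -(X0 z) -(XK z) -[RHS]opprB -(telescope_sumr (fun j => F (X j z)))//.
    by rewrite big_mkord -sumrN; apply: eq_bigr => j _; rewrite opprB.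
  by rewrite le_eqVlt; apply/orP; left; apply/eqP; rewrite /mu; field; rewrite gt_eqF.
have mH : measurable_fun setT H.
  apply/measurable_EFinP; apply: measurableT_comp => //.
  by apply: measurable_funM => //; apply: measurable_funB;
    apply: (measurableT_comp measurable_affine_max).
have H0 z : (0 <= H z)%E by rewrite lee_fin expR_ge0.
have fub (f : n.-tuple R * n.-tuple R -> \bar R) : measurable_fun setT f -> (forall z, 0 <= f z)%E ->
    (\int[(N \x N)%E]_z f z = \int[N]_x \int[N]_y f (x, y))%E.
  by move=> mf f0; exact: fubini_tonelli1.
rewrite -(fub H mH H0).
apply: (@le_trans _ _ (\int[(N \x N)%E]_z ((K%:R^-1)%:E * \sum_(j < K) D j z))%E).
  apply: ge0_le_integral => //.
  by apply: emeasurable_funM => //; exact: emeasurable_sum.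
rewrite ge0_integralZl//; last 2 first.
- exact: emeasurable_sum.
- by move=> z _; apply: sume_ge0.
rewrite ge0_integral_sum//.
rewrite (eq_bigr (fun=> \int[N]_x \int[N]_y G (x, y))%E); last first.
  by move=> j _; rewrite -(intD j (ltn_ord j)); exact: fub (D j) (mD j) (D0 j).
have : (\int[N]_x \int[N]_y G (x, y) <= (2 * expR (2 * lam ^+ 2 * L))%:E)%E.
  apply: le_trans (rotation_step _ _ _) _ => //.
    rewrite e0/=; apply: le_trans eB; rewrite ler_peMr// lerDl//.
  rewrite lee_fin; apply: ler_pM; rewrite ?expR_ge0//.
  - by rewrite addr_ge0// mulr_ge0.
  - have : mu * (1 - cos th) * B <= 1 by apply: le_trans eB; rewrite ler_wpM2l// lerDr.
    rewrite /B; lra.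
  rewrite ler_expR.
  have -> : 2 * lam ^+ 2 * L = (lam * 2) ^+ 2 * (L / 2) by field.
  rewrite ler_wpM2r ?divr_ge0// ler_pXn2r ?nnegrE ?mulr_ge0//.
  2: by apply: sin_ge0_pi; rewrite th0/=; have := pi_ge0 R; lra.
  rewrite /mu -mulrA ler_wpM2l//; apply: le_trans pi2; rewrite -Kth.
  by rewrite ler_wpM2l ?(ltW K0)//; exact: sin_le.
have I0 : (0 <= \int[N]_x \int[N]_y G (x, y))%E.
  by apply: integral_ge0 => x _; apply: integral_ge0.
move: I0; case: (\int[N]_x _)%E => [r||]// r0.
rewrite !lee_fin => rle.
by rewrite sumEFin sumr_const card_ord -EFinM lee_fin -[r *+ _]mulr_natl mulrA mulVf ?gt_eqF// mul1r.
Qed.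
End concentration.

(** * Lower tail of Gaussian partition functions *)

Lemma cvg_sumr (R : realType) (I : Type) (r : seq I) (f : I -> nat -> R) (l : I -> R) :
  (forall i, f i k @[k --> \oo] --> l i) ->
  (\sum_(i <- r) f i k) @[k --> \oo] --> \sum_(i <- r) l i.
Proof.
move=> H; elim: r => [|i r IH].
  rewrite big_nil [X in X @ _ --> _](_ : _ = fun=> 0); first exact: cvg_cst.
  by apply/funext => k; rewrite big_nil.
rewrite big_cons [X in X @ _ --> _](_ : _ = fun k => f i k + \sum_(j <- r) f j k).
  exact: cvgD.
by apply/funext => k; rewrite big_cons.
Qed.

(** A countable dense family of vectors: the good set is covered by
    neighbourhoods of countably many of its points. *)
Definition grid_point (R : realType) n (q : nat * {ffun 'I_n -> int}) : n.-tuple R :=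
  [tuple (q.2 i)%:~R / q.1.+1%:R | i < n].

Lemma grid_point_cvg (R : realType) n (x : n.-tuple R) :
  exists z : nat -> {ffun 'I_n -> int}, forall i,
    tnth (grid_point R (k, z k)) i @[k --> \oo] --> tnth x i.
Proof.
exists (fun k => [ffun i => Num.floor (tnth x i * k.+1%:R)]) => i.
apply/cvgrPdist_le => e e0.
have /cvgrPdist_le/(_ e e0) := @cvg_harmonic R.
apply: filterS => k; rewrite /harmonic/= sub0r normrN ger0_norm ?invr_ge0// => ke.
apply: le_trans ke; rewrite tnth_mktuple ffunE.
have k0 : (0 : R) < k.+1%:R by rewrite ltr0n.
have /andP[f1 f2] := real_floor_itv (num_real (tnth x i * k.+1%:R)).
set f := Num.floor _ in f1 f2 *.
have -> : tnth x i - f%:~R / k.+1%:R = (tnth x i * k.+1%:R - f%:~R) / k.+1%:R.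
  by rewrite mulrBl mulfK// gt_eqF.
rewrite ger0_norm ?divr_ge0 ?subr_ge0// -[leRHS]mul1r ler_wpM2r ?invr_ge0//.
by rewrite lerBlDr addrC; move: f2; rewrite intrD => /ltW.
Qed.

Section gaussian_polymer.
Context (R : realType) (sg : R).
Hypothesis sg0 : sg != 0.
Variables (n : nat) (J : finType) (m : J -> R) (a : J -> 'I_n -> R) (K : R).
Hypothesis m0 : forall p, 0 <= m p.
Hypothesis m_half : 1 / 2 <= \sum_p m p.
Hypothesis a0 : forall p i, 0 <= a p i.
(** The covariance of two linear forms: for two walks, [beta ^+ 2] times the
    time they spend together. *)
Definition overlap p q : R := \sum_(i < n) a p i * a q i * sg ^+ 2.
Hypothesis mK : \sum_p \sum_q m p * m q * expR (2 * overlap p q) <= K.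
Local Notation N := (iid (gauss sg) n).

(** The exponential martingale, normalised to have mean 1. *)
Definition wick p (v : n.-tuple R) : R := expR (dot (a p) v - overlap p p / 2).
Definition gibbs_sum v : R := \sum_p m p * wick p v.
(** The partial derivatives of [gibbs_sum]. *)
Definition gibbs_grad i v : R := \sum_p m p * a p i * wick p v.
Definition grad_sqnorm v : R := \sum_(i < n) gibbs_grad i v ^+ 2 * sg ^+ 2.

Lemma wick_gt0 p v : 0 < wick p v.
Proof. exact: expR_gt0. Qed.

Lemma measurable_wick p : measurable_fun setT (wick p).
Proof.
apply: measurableT_comp => //; apply: measurable_funB => //; exact: measurable_dot.
Qed.

Lemma gibbs_sum_ge0 v : 0 <= gibbs_sum v.
Proof. by apply: sumr_ge0 => p _; rewrite mulr_ge0// ltW// wick_gt0. Qed.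

Lemma measurable_gibbs_sum : measurable_fun setT gibbs_sum.
Proof. by apply: measurable_sum => p; apply: measurable_funM => //; exact: measurable_wick. Qed.

Lemma measurable_grad_sqnorm : measurable_fun setT grad_sqnorm.
Proof.
apply: measurable_sum => i; apply: measurable_funM => //; apply: measurable_funX.
by apply: measurable_sum => p; apply: measurable_funM => //; exact: measurable_wick.
Qed.

Lemma integral_wick p : (\int[N]_v (wick p v)%:E = 1)%E.
Proof.
rewrite (eq_integral (fun v => ((expR (- (overlap p p / 2)))%:E * (expR (dot (a p) v))%:E)%E)); last first.
  by move=> v _; rewrite -EFinM -expRD addrC.
rewrite ge0_integralZl ?lee_fin ?expR_ge0//; last first.
  by apply/measurable_EFinP; apply: measurableT_comp => //; exact: measurable_dot.
rewrite laplace_iid// -EFinM -expRD /overlap mulr_suml -sumrN -big_split/= big1 ?expR0//.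
by move=> i _; rewrite expr2 addNr.
Qed.

Lemma integral_wick2 p q :
  (\int[N]_v (wick p v * wick q v)%:E = (expR (overlap p q))%:E)%E.
Proof.
rewrite (eq_integral (fun v => ((expR (- (overlap p p / 2) - overlap q q / 2))%:E *
   (expR (dot (fun i => a p i + a q i) v))%:E)%E)); last first.
  move=> v _; rewrite -!EFinM -!expRD; congr (expR _)%:E.
  rewrite /dot; under [in RHS]eq_bigr do rewrite mulrDl.
  by rewrite big_split/=; ring.
rewrite ge0_integralZl ?lee_fin ?expR_ge0//; last first.
  by apply/measurable_EFinP; apply: measurableT_comp => //; exact: measurable_dot.
rewrite laplace_iid// -EFinM -expRD /overlap !mulr_suml -!sumrN -!big_split/=.
by congr (expR _)%:E; apply: eq_bigr => i _; field.
Qed.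

Lemma overlap_ge0 p q : 0 <= overlap p q.
Proof. by apply: sumr_ge0 => i _; rewrite mulr_ge0 ?sqr_ge0// mulr_ge0. Qed.

Lemma integral_gibbs_sum : (\int[N]_v (gibbs_sum v)%:E = (\sum_p m p)%:E)%E.
Proof.
under eq_integral do rewrite -sumEFin.
rewrite ge0_integral_sum//; last 2 first.
- move=> p; apply/measurable_EFinP; apply: measurable_funM => //; exact: measurable_wick.
- by move=> p v _; rewrite lee_fin mulr_ge0// ltW// wick_gt0.
rewrite -sumEFin; apply: eq_bigr => p _.
under eq_integral do rewrite EFinM.
rewrite ge0_integralZl ?integral_wick ?mule1//.
- by apply/measurable_EFinP; exact: measurable_wick.
- by move=> v _; rewrite lee_fin ltW// wick_gt0.
- by rewrite lee_fin.
Qed.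

Lemma integral_double_sum (c : J -> J -> R) : (forall p q, 0 <= c p q) ->
  (\int[N]_v (\sum_p \sum_q c p q * (wick p v * wick q v))%:E =
   (\sum_p \sum_q c p q * expR (overlap p q))%:E)%E.
Proof.
move=> c0.
have mw p q : measurable_fun setT (fun v => wick p v * wick q v).
  by apply: measurable_funM; exact: measurable_wick.
have w0 p q v : 0 <= wick p v * wick q v by rewrite mulr_ge0// ltW// wick_gt0.
under eq_integral do rewrite -sumEFin.
rewrite ge0_integral_sum//; last 2 first.
- move=> p; apply/measurable_EFinP; apply: measurable_sum => q; exact: measurable_funM.
- by move=> p v _; rewrite lee_fin sumr_ge0// => q _; rewrite mulr_ge0.
rewrite -sumEFin; apply: eq_bigr => p _.
under eq_integral do rewrite -sumEFin.
rewrite ge0_integral_sum//; last 2 first.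
- move=> q; apply/measurable_EFinP; exact: measurable_funM.
- by move=> q v _; rewrite lee_fin mulr_ge0.
rewrite -sumEFin; apply: eq_bigr => q _.
under eq_integral do rewrite EFinM.
rewrite ge0_integralZl ?integral_wick2 ?lee_fin//.
- exact/measurable_EFinP.
- by move=> v _; rewrite lee_fin.
Qed.

Lemma integral_gibbs_sum_sq : (\int[N]_v (gibbs_sum v ^+ 2)%:E <= K%:E)%E.
Proof.
rewrite (eq_integral (fun v => (\sum_p \sum_q (m p * m q) * (wick p v * wick q v))%:E)); last first.
  move=> v _; congr EFin; rewrite expr2 /gibbs_sum mulr_suml; apply: eq_bigr => p _.
  by rewrite mulr_sumr; apply: eq_bigr => q _; ring.
rewrite integral_double_sum; last by move=> p q; rewrite mulr_ge0.
rewrite lee_fin; apply: le_trans mK; apply: ler_sum => p _; apply: ler_sum => q _.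
rewrite ler_wpM2l ?mulr_ge0// ler_expR ler_peMl ?overlap_ge0//; lra.
Qed.

(** The squared gradient is a double sum over replicas weighted by their
    overlap, and [o * expR o <= expR (2 * o)]. *)
Lemma integral_grad_sqnorm : (\int[N]_v (grad_sqnorm v)%:E <= K%:E)%E.
Proof.
rewrite (eq_integral (fun v => (\sum_p \sum_q (m p * m q * overlap p q) * (wick p v * wick q v))%:E)); last first.
  move=> v _; congr EFin; rewrite /grad_sqnorm.
  transitivity (\sum_(i < n) \sum_p \sum_q m p * m q * (a p i * a q i * sg ^+ 2) * (wick p v * wick q v)).
    apply: eq_bigr => i _; rewrite expr2 /gibbs_grad !mulr_suml; apply: eq_bigr => p _.
    by rewrite mulr_sumr mulr_suml; apply: eq_bigr => q _; ring.
  rewrite exchange_big/=; apply: eq_bigr => p _; rewrite exchange_big/=.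
  by apply: eq_bigr => q _; rewrite -mulr_suml -mulr_sumr.
rewrite integral_double_sum; last by move=> p q; rewrite !mulr_ge0// overlap_ge0.
rewrite lee_fin; apply: le_trans mK; apply: ler_sum => p _; apply: ler_sum => q _.
rewrite -mulrA ler_wpM2l ?mulr_ge0// mulrDl mul1r expRD ler_wpM2r ?expR_ge0//.
by apply: le_trans (expR_ge1Dx _); rewrite lerDr.
Qed.

Let C : R := 32 * K.

Lemma K_ge : 1 / 4 <= K.
Proof.
apply: le_trans mK; apply: (@le_trans _ _ ((\sum_p m p) ^+ 2)).
  by have := m_half; set x := \sum_p m p => hx; nra.
rewrite expr2 mulr_suml; apply: ler_sum => p _; rewrite mulr_sumr; apply: ler_sum => q _.
rewrite ler_peMr ?mulr_ge0// -expR0 ler_expR mulr_ge0// overlap_ge0//.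
Qed.

Lemma K_gt0 : 0 < K. Proof. by have := K_ge; lra. Qed.

(** Here [grad_sqnorm v / gibbs_sum v ^+ 2] is the squared gradient of the
    logarithm of [gibbs_sum], scaled by the variance [sg ^+ 2]. *)
Definition good : set (n.-tuple R) := [set v | 1 / 4 < gibbs_sum v /\ grad_sqnorm v < C * gibbs_sum v ^+ 2].

Lemma measurable_good : measurable good.
Proof.
apply: measurableI.
  rewrite [X in measurable X](_ : _ = gibbs_sum @^-1` `]1/4, +oo[); last first.
    by apply/seteqP; split => v /=; rewrite in_itv/= andbT.
  by rewrite -[X in measurable X]setTI; exact: measurable_gibbs_sum.
rewrite [X in measurable X](_ : _ = (fun v => C * gibbs_sum v ^+ 2 - grad_sqnorm v) @^-1` `]0, +oo[); last first.
  by apply/seteqP; split => v /=; rewrite in_itv/= andbT subr_gt0.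
rewrite -[X in measurable X]setTI.
have mf : measurable_fun setT (fun v => C * gibbs_sum v ^+ 2 - grad_sqnorm v).
  apply: measurable_funB; last exact: measurable_grad_sqnorm.
  by apply: measurable_funM => //; apply: measurable_funX; exact: measurable_gibbs_sum.
exact: mf.
Qed.

(** A second moment argument. Off the good set [Z] is at most 1/4 or at most
    [4 * Z ^+ 2 <= 4 / C * W], and on it at most [h * Z ^+ 2 + 1 / (4 * h)];
    integrating, a mean of at least 1/2 cannot be reached without a good set of
    substantial probability. *)
Lemma good_prob : ((64 * K)^-1%:E <= N good)%E.
Proof.
have K0 := K_gt0.
(* With this value h Z^2 contributes at most 1/16 to the mean of Z, and W at most
   4 K / C = 1/8: of 1/2, less 1/4, there remains 1/16 for the good set. *)
pose h := (16 * K)^-1.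
have h0 : 0 < h by rewrite invr_gt0 mulr_gt0.
have hV : h^-1 = 16 * K by rewrite invrK.
have pw v : gibbs_sum v <= 1 / 4 + h * gibbs_sum v ^+ 2 + h^-1 / 4 * \1_good v + 4 / C * grad_sqnorm v.
  have W0 : 0 <= grad_sqnorm v.
    by apply: sumr_ge0 => i _; rewrite mulr_ge0 ?sqr_ge0.
  have C0 : 0 < C by rewrite mulr_gt0.
  have hz : 0 <= h * gibbs_sum v ^+ 2 by rewrite mulr_ge0 ?sqr_ge0// ltW.
  have cw : 0 <= 4 / C * grad_sqnorm v by rewrite mulr_ge0// divr_ge0// ltW.
  have i0 : 0 <= h^-1 / 4 * \1_good v by rewrite mulr_ge0// divr_ge0// invr_ge0 ltW.
  have [Z1|Z1] := lerP (gibbs_sum v) (1 / 4); first lra.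
  have [W1|W1] := ltrP (grad_sqnorm v) (C * gibbs_sum v ^+ 2).
    rewrite indicE mem_set ?mulr1; last by split.
    have : 0 <= h * (gibbs_sum v - h^-1 / 2) ^+ 2 by rewrite mulr_ge0 ?sqr_ge0// ltW.
    have -> : h * (gibbs_sum v - h^-1 / 2) ^+ 2 = h * gibbs_sum v ^+ 2 - gibbs_sum v + h^-1 / 4.
      by field; rewrite gt_eqF.
    lra.
  have : 4 * gibbs_sum v ^+ 2 <= 4 / C * grad_sqnorm v.
    rewrite mulrAC ler_pdivlMr// -mulrA ler_pM2l//; first by rewrite mulrC.
  have : gibbs_sum v <= 4 * gibbs_sum v ^+ 2 by nra.
  lra.
have [mZ mW mG] := And3 measurable_gibbs_sum measurable_grad_sqnorm measurable_good.
have : (\int[N]_v (gibbs_sum v)%:E <= \int[N]_v ((1 / 4)%:E + h%:E * (gibbs_sum v ^+ 2)%:E +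
   (h^-1 / 4)%:E * (\1_good v)%:E + (4 / C)%:E * (grad_sqnorm v)%:E))%E.
  apply: ge0_le_integral => //.
  - by move=> v _; rewrite lee_fin gibbs_sum_ge0.
  - exact/measurable_EFinP.
  - apply/measurable_EFinP; apply: measurable_funD; [apply: measurable_funD; [apply: measurable_funD => //|]|];
      apply: measurable_funM => //; first exact: measurable_funX.
  - by move=> v _; rewrite -!EFinM -!EFinD lee_fin.
have W0 v : 0 <= grad_sqnorm v.
  by apply: sumr_ge0 => i _; rewrite mulr_ge0 ?sqr_ge0.
have C0 : 0 < C by rewrite mulr_gt0.
have t1 v : (0 <= h%:E * (gibbs_sum v ^+ 2)%:E)%E by rewrite -EFinM lee_fin mulr_ge0 ?sqr_ge0// ltW.
have t2 v : (0 <= (h^-1 / 4)%:E * (\1_good v)%:E)%E.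
  by rewrite -EFinM lee_fin mulr_ge0// divr_ge0// invr_ge0 ltW.
have t3 v : (0 <= (4 / C)%:E * (grad_sqnorm v)%:E)%E by rewrite -EFinM lee_fin mulr_ge0// divr_ge0// ltW.
have q0 : (0 <= ((1 / 4 : R))%:E)%E by rewrite lee_fin divr_ge0.
have m1 : measurable_fun setT (fun v => (h%:E * (gibbs_sum v ^+ 2)%:E)%E).
  by apply/measurable_EFinP; apply: measurable_funM => //; exact: measurable_funX.
have m2 : measurable_fun setT (fun v => ((h^-1 / 4)%:E * (\1_good v)%:E)%E).
  by apply/measurable_EFinP; apply: measurable_funM.
have m3 : measurable_fun setT (fun v => ((4 / C)%:E * (grad_sqnorm v)%:E)%E).
  by apply/measurable_EFinP; apply: measurable_funM.
have mZ2 : measurable_fun setT (fun v => (gibbs_sum v ^+ 2)%:E) by apply/measurable_EFinP; exact: measurable_funX.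
rewrite ge0_integralD//; [|by move=> v _; rewrite !adde_ge0|by do 2 apply: emeasurable_funD => //].
rewrite ge0_integralD//; [|by move=> v _; rewrite !adde_ge0|by apply: emeasurable_funD].
rewrite ge0_integralD//.
have h4 : 0 <= h^-1 / 4 by rewrite hV divr_ge0// mulr_ge0// ltW.
have e1 : (\int[N]_v (h%:E * (gibbs_sum v ^+ 2)%:E) <= (h * K)%:E)%E.
  rewrite ge0_integralZl ?lee_fin ?(ltW h0)//; last by move=> v _; rewrite lee_fin sqr_ge0.
  by rewrite EFinM lee_wpmul2l ?lee_fin ?(ltW h0)//; exact: integral_gibbs_sum_sq.
have e2 : (\int[N]_v ((h^-1 / 4)%:E * (\1_good v)%:E) = (h^-1 / 4)%:E * N good)%E.
  rewrite ge0_integralZl ?lee_fin//; last exact/measurable_EFinP.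
  by rewrite integral_indic// setIT.
have e3 : (\int[N]_v ((4 / C)%:E * (grad_sqnorm v)%:E) <= (4 / C * K)%:E)%E.
  rewrite ge0_integralZl ?lee_fin ?divr_ge0 ?(ltW C0)//; last 2 first.
  - exact/measurable_EFinP.
  - by move=> v _; rewrite lee_fin.
  by rewrite (EFinM (4 / C) K) lee_wpmul2l ?lee_fin ?divr_ge0 ?(ltW C0)//; exact: integral_grad_sqnorm.
have e0 : (\int[N]_v ((1 / 4)%:E) <= (1 / 4)%:E)%E.
  by rewrite integral_cst// -[leRHS]mule1 lee_wpmul2l//; exact: probability_le1.
rewrite integral_gibbs_sum e2; move: e0 e1 e3.
set I0 := integral _ _ _; set I1 := integral _ _ _; set I3 := integral _ _ _ => e0 e1 e3 H.
have : ((1 / 2)%:E <= (1 / 4)%:E + (h * K)%:E + (h^-1 / 4)%:E * N good + (4 / C * K)%:E)%E.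
  apply: (@le_trans _ _ (\sum_p m p)%:E); first by rewrite lee_fin.
  by apply: le_trans H _; do 3 (apply: leeD => //).
have : (N good <= 1)%E by exact: probability_le1 measurable_good.
have : (0 <= N good)%E by exact: measure_ge0.
case: (N good) => [r||]// _ _; rewrite -EFinM -!EFinD !lee_fin => H'.
have hK : h * K = 1 / 16 by rewrite /h; field; rewrite gt_eqF.
have CK : 4 / C * K = 1 / 8 by rewrite /C; field; rewrite gt_eqF.
move: H'; rewrite hK CK hV => H'.
rewrite -div1r ler_pdivrMr ?mulr_gt0//; lra.
Qed.

Definition slope (x : n.-tuple R) i : R := gibbs_grad i x / gibbs_sum x.
(** The affine function [offset x + dot (slope x) v] of [v] is the tangent at
    [x] to the logarithm of [gibbs_sum]. *)
Definition offset (x : n.-tuple R) : R := ln (gibbs_sum x) - dot (slope x) x.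

(** The logarithm of a combination of exponentials of affine functions is convex
    (Jensen for the Gibbs measure at [x]). *)
Lemma tangent_le x v : 0 < gibbs_sum x -> expR (offset x + dot (slope x) v) <= gibbs_sum v.
Proof.
move=> Zx.
have -> : offset x + dot (slope x) v = ln (gibbs_sum x) + \sum_(i < n) slope x i * (tnth v i - tnth x i).
  rewrite /offset -addrA; congr (_ + _); rewrite addrC /dot -sumrB.
  by apply: eq_bigr => i _; rewrite mulrBr.
rewrite expRD lnK//; set D := \sum_(i < n) _.
pose w p := m p * wick p x / gibbs_sum x.
have w0 p : 0 <= w p by rewrite divr_ge0 ?(ltW Zx)// mulr_ge0// ltW// wick_gt0.
have w1 : \sum_p w p = 1 by rewrite -mulr_suml divff// gt_eqF.
pose y p := \sum_(i < n) a p i * (tnth v i - tnth x i).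
have DE : D = \sum_p w p * y p.
  rewrite /D /slope /gibbs_grad /w /y.
  under eq_bigr do rewrite mulr_suml mulr_suml.
  rewrite exchange_big/=; apply: eq_bigr => p _; rewrite mulr_sumr.
  by apply: eq_bigr => i _; ring.
have -> : gibbs_sum v = gibbs_sum x * \sum_p w p * expR (y p).
  rewrite mulr_sumr; apply: eq_bigr => p _; rewrite /w mulrA mulrCA divff ?gt_eqF// mulr1.
  rewrite -mulrA; congr (_ * _); rewrite /wick -expRD; congr expR.
  rewrite /y; under eq_bigr do rewrite mulrBr.
  by rewrite sumrB -!/(dot _ _); ring.
rewrite ler_wpM2l ?(ltW Zx)//.
apply: (@le_trans _ _ (\sum_p w p * (expR D * (1 + (y p - D))))); last first.
  by apply: ler_sum => p _; rewrite ler_wpM2l//; exact: expR_tangent.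
have -> : \sum_p w p * (expR D * (1 + (y p - D))) = expR D * ((1 - D) * \sum_p w p + \sum_p w p * y p).
  rewrite mulrDr !mulr_sumr -big_split/=; apply: eq_bigr => p _; ring.
by rewrite w1 -DE mulr1 subrK mulr1.
Qed.

Lemma slope_bound x : good x -> \sum_(i < n) slope x i ^+ 2 * sg ^+ 2 <= C.
Proof.
case=> Z1 WC; have Z0 : 0 < gibbs_sum x by lra.
have -> : \sum_(i < n) slope x i ^+ 2 * sg ^+ 2 = grad_sqnorm x / gibbs_sum x ^+ 2.
  by rewrite /grad_sqnorm mulr_suml; apply: eq_bigr => i _; rewrite /slope exprMn exprVn; ring.
by rewrite ler_pdivrMr ?exprn_gt0// ltW.
Qed.

(** Goodness is an open condition and the tangent varies continuously with its
    base point; at [x] itself its value is [ln (gibbs_sum x)], which exceeds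
    [ln (1 / 4) > - 2]. *)
Lemma good_grid x : good x -> exists q, good (grid_point R q) /\
  - 2 < offset (grid_point R q) + dot (slope (grid_point R q)) x.
Proof.
move=> [Z1 WC]; have [z zx] := grid_point_cvg x.
pose g k := grid_point R (k, z k).
have cw p : wick p (g k) @[k --> \oo] --> wick p x.
  apply: (continuous_cvg _ (@continuous_expR R _)).
  apply: cvgB; last exact: cvg_cst.
  by apply: cvg_sumr => i; apply: cvgM; [exact: cvg_cst|exact: zx].
have cZ : gibbs_sum (g k) @[k --> \oo] --> gibbs_sum x.
  by apply: cvg_sumr => p; apply: cvgM; [exact: cvg_cst|exact: cw].
have cD i : gibbs_grad i (g k) @[k --> \oo] --> gibbs_grad i x.
  by apply: cvg_sumr => p; apply: cvgM; [exact: cvg_cst|exact: cw].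
have cW : grad_sqnorm (g k) @[k --> \oo] --> grad_sqnorm x.
  apply: cvg_sumr => i; apply: cvgM; [|exact: cvg_cst].
  by rewrite expr2; under eq_fun do rewrite expr2; apply: cvgM.
have Z0 : 0 < gibbs_sum x by lra.
have cT : offset (g k) + dot (slope (g k)) x @[k --> \oo] --> ln (gibbs_sum x).
  rewrite [X in X @ _ --> _](_ : _ = fun k => ln (gibbs_sum (g k)) +
     \sum_(i < n) slope (g k) i * (tnth x i - tnth (g k) i)); last first.
    apply/funext => k; rewrite /offset -addrA; congr (_ + _); rewrite addrC /dot -sumrB.
    by apply: eq_bigr => i _; rewrite mulrBr.
  rewrite -[X in _ --> X]addr0; apply: cvgD.
    by apply: continuous_cvg => //; exact: continuous_ln.
  rewrite [X in _ --> X](_ : 0 = \sum_(i < n) slope x i * (tnth x i - tnth x i)); last first.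
    by rewrite big1// => i _; rewrite subrr mulr0.
  apply: cvg_sumr => i; apply: cvgM; last by apply: cvgB; [exact: cvg_cst|exact: zx].
  by apply: cvgM => //; apply: cvgV => //; rewrite gt_eqF.
have cC : C * gibbs_sum (g k) ^+ 2 - grad_sqnorm (g k) @[k --> \oo] --> C * gibbs_sum x ^+ 2 - grad_sqnorm x.
  apply: cvgB => //; apply: cvgM; first exact: cvg_cst.
  by rewrite expr2; under eq_fun do rewrite expr2; apply: cvgM.
have ln2 : - 2 < ln (gibbs_sum x).
  rewrite -[X in X < _]expRK ltr_ln ?posrE ?expR_gt0//; apply: le_lt_trans Z1.
  rewrite expRN -div1r ler_pdivrMr ?expR_gt0// -ler_pdivrMl//.
  have -> : expR 2 = expR 1 ^+ 2 :> R by rewrite -expRM_natr mul1r.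
  by have := @expR_ge1Dx R 1; rewrite invf_div; nra.
near \oo => k.
exists (k, z k); split; last by near: k; exact: (cvgr_gt _ cT _ ln2).
split; first by near: k; exact: (cvgr_gt _ cZ _ Z1).
rewrite -subr_gt0; near: k; apply: (cvgr_gt _ cC); by rewrite subr_gt0.
Unshelve. all: by end_near.
Qed.

(** Grid points that are not good are replaced by one fixed good point, so that
    the tangents at all points of the sequence have controlled slope. *)
Lemma good_sequence : exists2 pt : nat -> n.-tuple R, (forall j, good (pt j)) &
  forall x, good x -> exists j, - 2 < offset (pt j) + dot (slope (pt j)) x.
Proof.
have [x0 gx0] : exists x, good x.
  apply: contrapT => /forallNP H.
  have : good = set0 by apply/seteqP; split => // x /H.
  move=> g0; have := good_prob; rewrite g0 measure0 lee_fin leNgt.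
  by rewrite invr_gt0 mulr_gt0// K_gt0.
pose pt j := if (choice.unpickle j : option (nat * {ffun 'I_n -> int})) is Some q
  then (if `[< good (grid_point R q) >] then grid_point R q else x0) else x0.
exists pt.
  by move=> j; rewrite /pt; case: choice.unpickle => // q; case: asboolP.
move=> x /good_grid[q [gq qx]]; exists (choice.pickle q).
by rewrite /pt choice.pickleK; case: asboolP.
Qed.

(** Let [F] be the maximum of finitely many tangents at good points, enough of
    them for [- 2 < F] to have probability more than half the bound of
    [good_prob]. If [Z y < expR (- u)] then [F y < - u], and for [- 2 < F x]
    this makes [F x - F y] exceed [u - 2]; the exponential Chebyshev inequality
    with the bound of [affine_max_concentration] concludes. *)
Lemma polymer_lower_tail (u : R) : 0 < u ->
  (N [set v | (gibbs_sum v < expR (- u))%R] <=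
   (256 * K * expR (C^-1) * expR (- (u ^+ 2 / (16 * C))))%:E)%E.
Proof.
move=> u0; have K0 := K_gt0; have C0 : 0 < C by rewrite mulr_gt0.
have [pt gpt ptP] := good_sequence.
pose F k := affine_max (fun j : 'I_k.+1 => offset (pt j)) (fun j : 'I_k.+1 => slope (pt j)).
have mF k : measurable_fun setT (F k) by exact: measurable_affine_max.
have Fle k v : expR (F k v) <= gibbs_sum v.
  rewrite /F; have [j ->] := affine_max_eq (fun j : 'I_k.+1 => offset (pt j)) (fun j : 'I_k.+1 => slope (pt j)) v.
  by apply: tangent_le; case: (gpt j) => + _; lra.
pose U k := [set v | - 2 < F k v].
have mU k : measurable (U k).
  rewrite [X in measurable X](_ : _ = F k @^-1` `]- 2, +oo[); last first.
    by apply/seteqP; split => v /=; rewrite in_itv/= andbT.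
  by rewrite -[X in measurable X]setTI; exact: mF.
have ndU : {homo U : i j / (i <= j)%N >-> (i <= j)%O}.
  move=> i j ij; apply/subsetPset => v /=; rewrite /U/= => /lt_le_trans; apply.
  rewrite /F; have [l ->] := affine_max_eq (fun j : 'I_i.+1 => offset (pt j)) (fun j : 'I_i.+1 => slope (pt j)) v.
  have lj : (l < j.+1)%N by apply: leq_trans (ltn_ord l) _; rewrite ltnS.
  exact: (affine_max_ge (fun j0 : 'I_j.+1 => offset (pt j0)) (fun j0 : 'I_j.+1 => slope (pt j0)) (Ordinal lj) v).
have [k Uk] : exists k, ((128 * K)^-1%:E < N (U k))%E.
  have cU := nondecreasing_cvg_mu mU (bigcupT_measurable U mU) ndU (mu := N).
  have : ((128 * K)^-1%:E < N (\bigcup_k U k))%E.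
    apply: (@lt_le_trans _ _ (64 * K)^-1%:E).
      by rewrite lte_fin ltf_pV2 ?posrE ?mulr_gt0// ltr_pM2r//; lra.
    apply: le_trans good_prob _; apply: le_measure; rewrite ?inE.
    - exact: measurable_good.
    - exact: (bigcupT_measurable U mU).
    - move=> x /ptP[j jx]; exists j => //; rewrite /U/=; apply: lt_le_trans jx _.
      exact: (affine_max_ge (fun j0 : 'I_j.+1 => offset (pt j0)) (fun j0 : 'I_j.+1 => slope (pt j0)) ord_max x).
  move=> H; have := cU _ (open_nbhs_nbhs (conj (@open_ereal_gt_ereal _ _) H)).
  by case=> i _ Hi; exists i; apply: (Hi i) => /=.
(* The minimiser of 2 C lam^2 - lam u. *)
pose lam := u / (4 * C).
have lam0 : 0 < lam by rewrite divr_gt0// mulr_gt0.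
have conc := affine_max_concentration sg0 (fun j : 'I_k.+1 => offset (pt j)) (fun j => slope_bound (gpt j)) (ltW lam0).
rewrite -/(F k) in conc.
pose V := [set v | F k v < - u].
have mV : measurable V.
  rewrite [X in measurable X](_ : _ = F k @^-1` `]-oo, - u[); last first.
    by apply/seteqP; split => v /=; rewrite in_itv/=.
  by rewrite -[X in measurable X]setTI; exact: mF.
have ZV : (N [set v | (gibbs_sum v < expR (- u))%R] <= N V)%E.
  apply: le_measure; rewrite ?inE//.
    rewrite [X in measurable X](_ : _ = gibbs_sum @^-1` `]-oo, expR (- u)[); last first.
      by apply/seteqP; split => v /=; rewrite in_itv/=.
    by rewrite -[X in measurable X]setTI; exact: measurable_gibbs_sum.
  by move=> v /=; rewrite /V/= => Zv; rewrite -ltr_expR; apply: le_lt_trans Zv.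
apply: le_trans ZV _.
pose w := expR (- (2 * lam)) * expR (lam * u).
have w0 : 0 < w by rewrite mulr_gt0// expR_gt0.
have low : (w%:E * N (U k) * N V <= \int[N]_x \int[N]_y (expR (lam * (F k x - F k y)))%:E)%E.
  have inn x : (\int[N]_y ((w * \1_(U k) x)%:E * (\1_V y)%:E) = (w * \1_(U k) x)%:E * N V)%E.
    rewrite ge0_integralZl ?lee_fin ?mulr_ge0 ?(ltW w0)//; last exact/measurable_EFinP.
    by rewrite integral_indic// setIT.
  have -> : (w%:E * N (U k) * N V = \int[N]_x \int[N]_y ((w * \1_(U k) x)%:E * (\1_V y)%:E))%E.
    under eq_integral do rewrite inn.
    rewrite ge0_integralZr//; last 2 first.
    - by apply/measurable_EFinP; apply: measurable_funM.
    - by move=> x _; rewrite lee_fin mulr_ge0// ltW.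
    congr (_ * _)%E; under eq_integral do rewrite EFinM.
    rewrite ge0_integralZl ?lee_fin ?(ltW w0)//; last exact/measurable_EFinP.
    by rewrite integral_indic// setIT.
  have mdiff : measurable_fun setT (fun z : n.-tuple R * n.-tuple R => (expR (lam * (F k z.1 - F k z.2)))%:E).
    apply/measurable_EFinP; apply: measurableT_comp => //.
    by apply: measurable_funM => //; apply: measurable_funB; apply: (measurableT_comp (mF k)).
  apply: ge0_le_integral => //.
  - by move=> x _; apply: integral_ge0 => y _; rewrite -EFinM lee_fin mulr_ge0// mulr_ge0// ltW.
  - under eq_fun do rewrite inn.
    by apply: emeasurable_funM => //; apply/measurable_EFinP; apply: measurable_funM.
  - exact: (measurable_fun_fubini_tonelli_F (m2 := N) _ mdiff (fun _ => ltW (expR_gt0 _))).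
  move=> x _; apply: ge0_le_integral => //.
  - by move=> y _; rewrite -EFinM lee_fin mulr_ge0// mulr_ge0// ltW.
  - by apply/measurable_EFinP; apply: measurable_funM.
  - exact: (measurableT_comp mdiff (pair1_measurable x)).
  move=> y _; rewrite -EFinM lee_fin !indicE.
  case: (boolP (x \in U k)) => [/set_mem xU|_]; last by rewrite mulr0 mul0r expR_ge0.
  case: (boolP (y \in V)) => [/set_mem yV|_]; last by rewrite mulr0 expR_ge0.
  rewrite /= !mulr1 /w -expRD ler_expR.
  have : lam * (- 2 - F k x) <= 0 by rewrite pmulr_rle0// subr_le0 ltW.
  have : lam * (F k y + u) <= 0 by rewrite pmulr_rle0// -lerBrDr sub0r ltW.
  lra.
have := le_trans low conc; move: Uk.
have : (N V <= 1)%E by exact: probability_le1.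
have : (0 <= N V)%E by exact: measure_ge0.
have : (N (U k) <= 1)%E by exact: probability_le1.
have : (0 <= N (U k))%E by exact: measure_ge0.
case: (N (U k)) => [p||]// _ _; case: (N V) => [v||]//.
rewrite !lee_fin lte_fin => v0 _ Kp H.
have {H} : w * p * v <= 2 * expR (2 * lam ^+ 2 * C) := H.
have K128 : 0 < (128 * K)^-1 by rewrite invr_gt0 mulr_gt0.
move=> H; have {}H : w * (128 * K)^-1 * v <= 2 * expR (2 * lam ^+ 2 * C).
  by apply: le_trans H; rewrite ler_wpM2r// ler_wpM2l// ltW.
have wE : w^-1 = expR (2 * lam - lam * u).
  by rewrite /w -expRD -expRN; congr expR; ring.
have {}H : v <= 256 * K * (expR (2 * lam ^+ 2 * C) * w^-1).
  have -> : v = (w * (128 * K)^-1 * v) * (128 * K * w^-1) by field; rewrite !gt_eqF.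
  apply: le_trans (ler_wpM2r _ H) _; first by rewrite !mulr_ge0 ?invr_ge0 ?ltW.
  by rewrite le_eqVlt; apply/orP; left; apply/eqP; ring.
apply: le_trans H _; rewrite -[leRHS]mulrA ler_wpM2l ?mulr_ge0 ?(ltW K0)// wE -!expRD ler_expR.
rewrite -subr_ge0.
have -> : C^-1 + - (u ^+ 2 / (16 * C)) - (2 * lam ^+ 2 * C + (2 * lam - lam * u)) = (u / 4 - 1) ^+ 2 / C.
  by rewrite /lam; field; rewrite gt_eqF.
by rewrite divr_ge0 ?sqr_ge0// ltW.
Qed.

End gaussian_polymer.

(** * The lattice walk and a superharmonic function *)

(** A unit step cannot divide the shifted squared radius by more than 16, which
    keeps the ratio within the range of [taylor_bound]. *)
Lemma radius_ratio (R : realFieldType) (A r a : R) : 5000 <= A -> a ^+ 2 <= r - A -> r / 16 <= r + 1 + 2 * a.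
Proof.
move=> hA ha; have : 0 <= (a + 2) ^+ 2 by exact: sqr_ge0.
have -> : (a + 2) ^+ 2 = a ^+ 2 + 4 * a + 4 by ring.
have := sqr_ge0 a; move: ha; move: (a ^+ 2) => b; lra.
Qed.

Section lattice_walk.
Context (R : realType) (d : nat).
Local Notation lat := (lattice d).

Definition move (s : bool * 'I_d) : lat := (if s.1 then 1 else -1) *: delta_mx 0 s.2.

Lemma moveE s i : move s ord0 i = if i == s.2 then (if s.1 then 1 else -1) else 0.
Proof. by rewrite !mxE eqxx /= ; case: eqP => _; rewrite ?mulr1 ?mulr0. Qed.

Lemma move_inj : injective move.
Proof.
move=> [b i] [c j] /matrixP/(_ ord0) H.
have := H i; rewrite !moveE/= eqxx {H}; case: eqVneq => [->|_]; last by case: b.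
by case: b; case: c.
Qed.

Lemma neighboursP (x z : lat) : reflect (exists s, x + move s = z) (neighbours x z).
Proof.
apply: (iffP idP).
  move=> /sum_nat_eq1 [i [_ Fi Fj]].
  have xi : (x ord0 i - z ord0 i = 1) \/ (x ord0 i - z ord0 i = -1) by lia.
  exists (x ord0 i - z ord0 i == -1, i); apply/rowP => j.
  suff : (x + move (x ord0 i - z ord0 i == -1, i)) ord0 j = z ord0 j by [].
  rewrite mxE moveE/=.
  case: eqVneq => [->|ji]; first by case: xi => e; rewrite e /=; move: e; lia.
  have := Fj j ji isT; lia.
case=> s <-; apply/sum_nat_eq1; exists s.2; split => //.
  by rewrite mxE moveE eqxx; case: (s.1) => /=; lia.
by move=> j js _; rewrite mxE moveE (negbTE js) addr0 subrr.
Qed.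

Definition nbr_average (f : lat -> R) (x : lat) : R :=
  (\sum_s f (x + move s)) / (2 * d)%:R.

(** The [n]-step transition probabilities of the jump chain. *)
Fixpoint nstep (n : nat) (x z : lat) : R :=
  if n is n'.+1 then nbr_average (fun y => nstep n' y z) x else (x == z)%:R.

Lemma moveN s : - move s = move (~~ s.1, s.2).
Proof. by rewrite /move/=; case: s.1; rewrite /= -scaleNr ?opprK. Qed.

Lemma nstep_ge0 n x z : 0 <= nstep n x z.
Proof.
elim: n x => [|n IH] x /=; first exact: ler0n.
by rewrite divr_ge0// sumr_ge0.
Qed.

Lemma nstep_trans n x z u : nstep n (x + u) (z + u) = nstep n x z.
Proof.
elim: n x => [|n IH] x /=; first by rewrite (inj_eq (addIr u)).
by congr (_ / _); apply: eq_bigr => s _; rewrite addrAC IH.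
Qed.

Lemma nstep_opp n x z : nstep n (- x) (- z) = nstep n x z.
Proof.
elim: n x => [|n IH] x /=; first by rewrite (inj_eq oppr_inj).
congr (_ / _); rewrite (reindex_inj (h := fun s => (~~ s.1, s.2))) /=.
  by apply: eq_bigr => s _; rewrite -moveN -opprD IH.
by move=> [a i] [b j] [/negb_inj -> ->].
Qed.

Lemma nstep_sym n x z : nstep n x z = nstep n z x.
Proof.
rewrite -nstep_opp -(nstep_trans n (- x) (- z) (x + z)).
by rewrite addKr [x + z]addrC addKr.
Qed.

Lemma nbr_average_le f g : (forall y, f y <= g y) -> forall x, nbr_average f x <= nbr_average g x.
Proof. by move=> fg x; rewrite ler_wpM2r ?invr_ge0// ler_sum. Qed.

Lemma nstep_sum_le n (psi : lat -> R) (r : seq lat) x : uniq r -> (forall y, 0 <= psi y) ->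
  \sum_(z <- r) nstep n x z * psi z <= iter n nbr_average psi x.
Proof.
move=> ur p0; elim: n x => [|n IH] x.
  rewrite /=; case: (boolP (x \in r)) => xr.
    rewrite (bigD1_seq x)//= eqxx mul1r big1 ?addr0// => z zx.
    by rewrite eq_sym (negbTE zx) mul0r.
  rewrite big_seq big1// => z zr; case: eqP => [xz|_]; last by rewrite mul0r.
  by rewrite xz zr in xr.
rewrite iterS; apply: le_trans (nbr_average_le IH x).
rewrite /= /nbr_average exchange_big/= mulr_suml; apply: ler_sum => z _.
by rewrite mulrAC ler_wpM2r ?invr_ge0// mulr_suml.
Qed.

Lemma neighbours_sum (x z : lat) :
  (neighbours x z)%:R = \sum_s (x + move s == z)%:R :> R.
Proof.
case: neighboursP => [[s <-]|H].
  rewrite (bigD1 s)//= eqxx big1 ?addr0// => t ts.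
  by rewrite (inj_eq (addrI x)) (inj_eq move_inj) (negbTE ts).
rewrite big1// => s _; case: eqP => // e; by exfalso; apply: H; exists s.
Qed.

Definition sqnorm (x : lat) : R := \sum_(i < d) (x ord0 i)%:~R ^+ 2.
Variable A : R.
Hypothesis A5 : 5000 <= A.
Let A0 : 0 <= A. Proof. exact: le_trans (ler0n _ _) A5. Qed.
Definition rad (x : lat) : R := A + sqnorm x.
(** The function (A + |x|^2)^(-1/4). Its exponent is below that of the Green
    function for every d >= 3, which leaves room for superharmonicity; the
    constant A smooths it near the origin, and 5000 is large enough for the
    error terms 411 / r^2 of the Taylor expansion to be at most 1 / (12 r) when
    r >= A. *)
Definition green (x : lat) : R := (Num.sqrt (Num.sqrt (rad x)))^-1.

Lemma sqnorm_ge0 x : 0 <= sqnorm x.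
Proof. by apply: sumr_ge0 => i _; exact: sqr_ge0. Qed.

Lemma rad_ge x : 5000 <= rad x.
Proof. by apply: le_trans A5 _; rewrite lerDl sqnorm_ge0. Qed.

Lemma sqnorm_coord (x : lat) i : (x ord0 i)%:~R ^+ 2 <= sqnorm x.
Proof. by rewrite /sqnorm (bigD1 i)//= lerDl sumr_ge0// => j _; exact: sqr_ge0. Qed.

Definition dirsgn (b : bool) : R := if b then 1 else -1.

Lemma rad_move (x : lat) s : rad (x + move s) = rad x + 1 + 2 * (dirsgn s.1 * (x ord0 s.2)%:~R).
Proof.
rewrite /rad /sqnorm -!addrA; congr (_ + _).
rewrite (bigD1 s.2)//= [in RHS](bigD1 s.2)//= -addrA addrC [RHS]addrC -!addrA.
congr (_ + _).
  by apply: eq_bigr => i ne; rewrite !mxE (negbTE ne) mulr0 addr0.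
by rewrite !mxE !eqxx mulr1 intrD /dirsgn; case: s.1; rewrite ?rmorphN1/=; ring.
Qed.

(** The third order expansion of (1 + v)^(-1/4) at 0, with a fourth order term
    large enough to make it an upper bound on the range of interest. *)
Definition taylor (v : R) : R := 1 - v / 4 + 5 / 32 * v ^+ 2 - 15 / 128 * v ^+ 3 + 5 * v ^+ 4.

(** In the variable y = (1 + v)^(1/4) the inequality becomes polynomial after
    multiplication by y, and the difference of both sides is divisible by
    (y - 1)^4. *)
Lemma taylor_bound (y : R) : 1 / 2 <= y -> y^-1 <= taylor (y ^+ 4 - 1).
Proof.
move=> y2; have y0 : 0 < y by lra.
rewrite -[leLHS]mul1r ler_pdivrMr// -subr_ge0.
have -> : taylor (y ^+ 4 - 1) * y - 1 = (y - 1) ^+ 4 *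
   (640 * (y + 4 * y ^+ 2 + 10 * y ^+ 3 + 20 * y ^+ 4 + 31 * y ^+ 5 + 40 * y ^+ 6 + 44 * y ^+ 7
     + 40 * y ^+ 8 + 31 * y ^+ 9 + 20 * y ^+ 10 + 10 * y ^+ 11 + 4 * y ^+ 12 + y ^+ 13)
   - (128 + 317 * y + 500 * y ^+ 2 + 610 * y ^+ 3 + 580 * y ^+ 4 + 460 * y ^+ 5 + 300 * y ^+ 6
     + 150 * y ^+ 7 + 60 * y ^+ 8 + 15 * y ^+ 9)) / 128.
  by rewrite /taylor; field.
apply: divr_ge0; last exact: ler0n.
apply: mulr_ge0; first exact: exprn_even_ge0.
have p n : 0 <= y ^+ n by rewrite exprn_ge0// ltW.
have := (p 2%N, p 3%N, p 4%N, p 5%N, p 6%N, p 7%N, p 8%N, p 9%N).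
have := (p 10%N, p 11%N, p 12%N, p 13%N).
move=> [[[]]] ? ? ? ? [[[[[[[]]]]]]] ? ? ? ? ? ? ? ?.
lra.
Qed.

Lemma green_move (x : lat) s : green (x + move s) <=
  green x * taylor ((1 + 2 * (dirsgn s.1 * (x ord0 s.2)%:~R)) / rad x).
Proof.
set a := dirsgn s.1 * (x ord0 s.2)%:~R.
have r0 := rad_ge x; have r0' : 0 < rad x by lra.
have ra : a ^+ 2 <= rad x - A.
  have -> : a ^+ 2 = (x ord0 s.2)%:~R ^+ 2.
    by rewrite /a exprMn /dirsgn; case: s.1; rewrite ?sqrrN expr1n mul1r.
  by rewrite /rad addrAC subrr add0r sqnorm_coord.
have rs := rad_move x s; rewrite -/a in rs.
have rs0 : rad x / 16 <= rad (x + move s) by rewrite rs; exact: radius_ratio A5 ra.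
have rs1 := rad_ge (x + move s).
pose g (t : R) := Num.sqrt (Num.sqrt t).
have g4 t : 0 <= t -> g t ^+ 4 = t.
  by move=> t0; rewrite (exprM _ 2 2) !sqr_sqrtr// sqrtr_ge0.
have g0 t : 0 < t -> 0 < g t by move=> t0; rewrite !sqrtr_gt0.
rewrite /green -/(g _) -/(g (rad x)).
have gx := g0 _ r0'; have gs : 0 < g (rad (x + move s)) by apply: g0; lra.
(* With v the relative variation of the shifted squared radius,
   y^4 = 1 + v. *)
pose y := g (rad (x + move s)) / g (rad x).
have y0 : 0 < y by rewrite divr_gt0.
have y4 : y ^+ 4 = rad (x + move s) / rad x.
  by rewrite exprMn exprVn g4 ?g4 ?(ltW r0')//; lra.
have y2 : 1 / 2 <= y.
  rewrite leNgt; apply/negP => yl.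
  have : y ^+ 4 < (1 / 2) ^+ 4 by rewrite ltr_pXn2r// nnegrE; lra.
  rewrite y4 ltr_pdivrMr//; lra.
have -> : (g (rad (x + move s)))^-1 = (g (rad x))^-1 * y^-1.
  by rewrite /y invfM invrK mulrCA mulVf ?mulr1// gt_eqF.
rewrite ler_wpM2l ?invr_ge0 ?(ltW gx)//.
have -> : (1 + 2 * a) / rad x = y ^+ 4 - 1.
  by rewrite y4 rs; field; rewrite gt_eqF.
exact: taylor_bound.
Qed.

(** Opposite steps: the terms odd in [a] cancel. The gain 1 / (2 r) comes from the
    Laplacian of the squared radius, the loss in [a ^+ 2] from its squared
    gradient. *)
Lemma taylor_pair (a r : R) : 5000 <= r -> a ^+ 2 <= r ->
  taylor ((1 + 2 * a) / r) + taylor ((1 - 2 * a) / r) <=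
  2 - 1 / (2 * r) + 411 / r ^+ 2 + 5 / 4 * (a ^+ 2 / r ^+ 2).
Proof.
move=> r5 ar; have r0 : 0 < r by lra.
rewrite -subr_ge0.
have -> : 2 - 1 / (2 * r) + 411 / r ^+ 2 + 5 / 4 * (a ^+ 2 / r ^+ 2) -
   (taylor ((1 + 2 * a) / r) + taylor ((1 - 2 * a) / r)) =
   ((411 - 5 / 16) * r ^+ 2 + 15 / 128 * (2 + 24 * a ^+ 2) * r
     - 10 * (1 + 24 * a ^+ 2 + 16 * (a ^+ 2) ^+ 2)) / r ^+ 4.
  by rewrite /taylor; field; rewrite gt_eqF.
have a2 := sqr_ge0 a; set b := a ^+ 2 in a2 ar *.
apply: divr_ge0; last by rewrite exprn_ge0// ltW.
nra.
Qed.

(** Summing [taylor_pair] over the axes, the gain is d / (2 r), and the loss at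
    most 5 / (4 r) + d / (12 r), which is no more as soon as d >= 3. *)
Lemma green_superharmonic x : (3 <= d)%N -> nbr_average green x <= green x.
Proof.
move=> d3; have d0 : 0 < (2 * d)%:R :> R by rewrite ltr0n muln_gt0/=; lia.
have r5 := rad_ge x; have r0 : 0 < rad x by lra.
have g0 : 0 <= green x by rewrite invr_ge0 sqrtr_ge0.
rewrite /nbr_average ler_pdivrMr//.
pose a i : R := (x ord0 i)%:~R.
apply: (@le_trans _ _ (green x * \sum_(i < d) (taylor ((1 + 2 * a i) / rad x) + taylor ((1 - 2 * a i) / rad x)))).
  rewrite (eq_bigr (fun s => (fun b i => green (x + move (b, i))) s.1 s.2)); last by case.
  rewrite -(pair_bigA _ (fun b i => green (x + move (b, i))))/= big_bool/= -big_split/=.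
  rewrite mulr_sumr; apply: ler_sum => i _; rewrite mulrDr.
  apply: lerD; first by have := green_move x (true, i); rewrite /dirsgn mul1r.
  by have := green_move x (false, i); rewrite /dirsgn/= mulN1r mulrN.
rewrite ler_wpM2l//.
apply: (@le_trans _ _ (\sum_(i < d) (2 - 1 / (2 * rad x) + 411 / rad x ^+ 2 + 5 / 4 * (a i ^+ 2 / rad x ^+ 2)))).
  apply: ler_sum => i _; apply: taylor_pair => //.
  by apply: le_trans (sqnorm_coord x i) _; rewrite lerDr.
rewrite big_split/= sumr_const card_ord -mulr_sumr -mulr_suml -/(sqnorm x).
have sr : sqnorm x / rad x ^+ 2 <= 1 / rad x.
  have -> : 1 / rad x = rad x / rad x ^+ 2 by field; rewrite gt_eqF.
  by rewrite ler_wpM2r ?invr_ge0 ?sqr_ge0// /rad lerDr.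
have d3' : 3 <= d%:R :> R by rewrite ler_nat.
rewrite -[_ *+ d]mulr_natr natrM.
have h : 411 / rad x ^+ 2 <= 1 / (12 * rad x).
  rewrite ler_pdivrMr ?exprn_gt0// mulrAC ler_pdivlMr; last lra.
  nra.
have i0 : 0 < 1 / rad x by rewrite divr_gt0.
have e1 : 1 / (2 * rad x) = 1 / rad x / 2 by field; rewrite gt_eqF.
have e2 : 1 / (12 * rad x) = 1 / rad x / 12 by field; rewrite gt_eqF.
rewrite e1; rewrite e2 in h.
move: sr h i0 d3'; move: (1 / rad x) (411 / rad x ^+ 2) (sqnorm x / rad x ^+ 2) (d%:R : R).
move=> q w t D tq wq q0 D3.
have h1 : w * D <= q / 12 * D by rewrite ler_wpM2r//; lra.
have h2 : q * 3 <= q * D by rewrite ler_wpM2l// ltW.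
lra.
Qed.

Lemma green_gt0 x : 0 < green x.
Proof. by rewrite invr_gt0 !sqrtr_gt0; apply: lt_le_trans (rad_ge x); rewrite ltr0n. Qed.

Lemma green_le1 x : green x <= 1.
Proof.
have r1 : 1 <= rad x by apply: le_trans (rad_ge x); rewrite ler1n.
rewrite invf_le1 ?sqrtr_gt0 ?sqrtr_gt0; last by apply: lt_le_trans r1.
by rewrite -[leLHS]sqrtr1 ler_sqrt ?sqrtr_ge0// -[leLHS]sqrtr1 ler_sqrt// (le_trans _ r1).
Qed.

Lemma greenN x : green (- x) = green x.
Proof.
rewrite /green /rad; congr (Num.sqrt (Num.sqrt (_ + _)))^-1.
by apply: eq_bigr => i _; rewrite mxE rmorphN sqrrN.
Qed.

(** At the origin every neighbour is strictly farther away, so that the average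
    is strictly smaller. *)
Lemma green_pole : (3 <= d)%N -> exists2 c : R, 0 < c &
  forall x, nbr_average green x <= green x - c * (x == 0)%:R.
Proof.
move=> d3; have d0 : 0 < (2 * d)%:R :> R by rewrite ltr0n muln_gt0/=; lia.
(* The defect of harmonicity at the origin. *)
exists (green 0 - nbr_average green 0); last first.
  move=> x; case: eqVneq => [->|_]; first by rewrite mulr1 subKr.
  by rewrite mulr0 subr0 green_superharmonic.
rewrite subr_gt0 /nbr_average ltr_pdivrMr//.
apply: (@lt_le_trans _ _ (\sum_(s : bool * 'I_d) green 0)); last first.
  by rewrite sumr_const card_prod card_bool card_ord mulr_natr.
have lt s : green (0 + move s) < green 0.
  have r0 : 0 < rad 0 by apply: lt_le_trans (rad_ge 0); rewrite ltr0n.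
  have h : rad 0 < rad (0 + move s) by rewrite rad_move mxE mulr0z !mulr0 addr0 ltrDl.
  have h' := lt_trans r0 h.
  by rewrite ltf_pV2 ?posrE ?sqrtr_gt0 ?sqrtr_gt0// ltr_sqrt ?sqrtr_gt0// ltr_sqrt.
have i0 : 'I_d by exists 0%N; lia.
rewrite (bigD1 (true, i0))//= [ltRHS](bigD1 (true, i0))//=.
by apply: ltr_leD => //; apply: ler_sum => s _; exact: ltW.
Qed.

End lattice_walk.

(** * The heat kernel and the meetings of two paths *)

Section kernel.
Context (R : realType) (d : nat).
Local Notation lat := (lattice d).
Local Open Scope ereal_scope.

Lemma poisson_pmf_total (h : R) : (0 < h)%R -> \sum_(n <oo) (poisson_pmf h n)%:E = 1.
Proof.
move=> h0; rewrite nneseries_esumT; last by move=> n; rewrite lee_fin poisson_pmf_ge0.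
by have := probability_setT (poisson_prob h 0); rewrite /= /poisson_prob h0.
Qed.

(** The transition probabilities of the walk in continuous time: a Poisson number
    of steps of the jump chain. *)
Definition heat_series (h : R) (x z : lat) : \bar R :=
  \sum_(n <oo) (poisson_pmf h n * nstep R n x z)%:E.

Lemma heat_series_ge0 h x z : 0 <= heat_series h x z.
Proof. by apply: nneseries_ge0 => n _ _; rewrite lee_fin mulr_ge0 ?poisson_pmf_ge0 ?nstep_ge0. Qed.

Lemma heat_series_sym h x z : heat_series h x z = heat_series h z x.
Proof. by apply: eq_eseriesr => n _; rewrite nstep_sym. Qed.

Lemma heat_series_trans h x z u : heat_series h (x + u)%R (z + u)%R = heat_series h x z.
Proof. by apply: eq_eseriesr => n _; rewrite nstep_trans. Qed.

Lemma nstep_le1 n (x z : lat) : (nstep R n x z <= 1)%R.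
Proof.
elim: n x => [|n IH] x /=; first by rewrite lern1 leq_b1.
apply: le_trans (nbr_average_le (g := fun=> 1%R) (fun y => IH y) x) _.
rewrite /nbr_average sumr_const card_prod card_bool card_ord.
by case: (eqVneq d 0%N) => [->|d0]; rewrite ?muln0 ?mul0r// divff// pnatr_eq0 muln_eq0.
Qed.

Lemma heat_series_le1 h x z : (0 < h)%R -> heat_series h x z <= 1.
Proof.
move=> h0; rewrite -(poisson_pmf_total h0); apply: lee_nneseries => [n _ _|n _].
  by rewrite lee_fin mulr_ge0 ?poisson_pmf_ge0 ?nstep_ge0.
by rewrite lee_fin ler_piMr ?poisson_pmf_ge0 ?nstep_le1.
Qed.

Definition heat_kernel (h : R) (x z : lat) : R := fine (heat_series h x z).

Lemma heat_kernelE h x z : (0 < h)%R -> (heat_kernel h x z)%:E = heat_series h x z.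
Proof.
move=> h0; rewrite fineK// ge0_fin_numE ?heat_series_ge0//.
exact: le_lt_trans (heat_series_le1 x z h0) (ltry 1).
Qed.

Lemma heat_kernel_ge0 h x z : (0 <= heat_kernel h x z)%R.
Proof. by rewrite fine_ge0// heat_series_ge0. Qed.

Lemma heat_kernel_sym h x z : heat_kernel h x z = heat_kernel h z x.
Proof. by rewrite /heat_kernel heat_series_sym. Qed.

Lemma heat_kernel_trans h x z u : heat_kernel h (x + u)%R (z + u)%R = heat_kernel h x z.
Proof. by rewrite /heat_kernel heat_series_trans. Qed.

(** A walk that makes no step keeps the value of [psi], while any positive number
    of steps loses at least [c] at the pole; a step occurs with probability
    [1 - expR (- h)]. *)
Lemma heat_series_superharmonic (h : R) (psi : lat -> R) (c : R) (y x : lat) (r : seq lat) :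
  (0 < h)%R -> uniq r -> (forall z, 0 <= psi z)%R -> (0 <= c)%R ->
  (forall x, nbr_average psi x <= psi x - c * (x == y)%:R)%R ->
  \sum_(z <- r) heat_series h x z * (psi z)%:E <=
    (psi x - c * (1 - expR (- h)) * (x == y)%:R)%:E.
Proof.
move=> h0 ur p0 c0 sup.
have it n : (iter n.+1 (@nbr_average R d) psi x <= psi x - c * (x == y)%:R)%R.
  have {}it : forall m w, (iter m (@nbr_average R d) psi w <= psi w)%R.
    elim=> [//|m IH] w; rewrite iterS; apply: le_trans (nbr_average_le IH w) _.
    by apply: le_trans (sup w) _; rewrite gerBl mulr_ge0.
  by rewrite iterS; apply: le_trans (nbr_average_le (it n) x) (sup x).
set e := (c * (x == y)%:R)%R in it.
have e0 : (0 <= e)%R by rewrite mulr_ge0.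
have pe : (0 <= psi x - e)%R.
  by apply: le_trans (sup x); rewrite divr_ge0// sumr_ge0.
pose b n : R := (poisson_pmf h n * (psi x - e) + (n == 0)%:R * (poisson_pmf h 0 * e))%R.
apply: (@le_trans _ _ (\sum_(n <oo) (b n)%:E)).
  have -> : \sum_(z <- r) heat_series h x z * (psi z)%:E =
      \sum_(n <oo) \sum_(z <- r) (poisson_pmf h n * nstep R n x z * psi z)%:E.
    rewrite nneseries_sum; last first.
      by move=> z n _; rewrite lee_fin !mulr_ge0 ?poisson_pmf_ge0 ?nstep_ge0.
    apply: eq_bigr => z _; rewrite /heat_series muleC -nneseriesZl; last first.
      by move=> n _; rewrite lee_fin mulr_ge0 ?poisson_pmf_ge0 ?nstep_ge0.
    by apply: eq_eseriesr => n _; rewrite -EFinM mulrC.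
  apply: lee_nneseries => [n _ _|n _].
    by apply: sume_ge0 => z _; rewrite lee_fin !mulr_ge0 ?poisson_pmf_ge0 ?nstep_ge0.
  rewrite sumEFin lee_fin; under eq_bigr do rewrite -mulrA.
  rewrite -mulr_sumr.
  apply: le_trans (ler_wpM2l (poisson_pmf_ge0 _ _) (nstep_sum_le n x ur p0)) _.
  rewrite /b; case: n => [|n]; first by rewrite /= mul1r -mulrDr subrK.
  by rewrite mul0r addr0 ler_wpM2l ?poisson_pmf_ge0.
rewrite le_eqVlt; apply/orP; left; apply/eqP.
rewrite /b; under eq_eseriesr do rewrite EFinD.
rewrite nneseriesD; last 2 first.
- by move=> n _ _; rewrite lee_fin mulr_ge0// poisson_pmf_ge0.
- by move=> n _ _; rewrite lee_fin !mulr_ge0// poisson_pmf_ge0.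
under eq_eseriesr do rewrite mulrC EFinM.
rewrite nneseriesZl; last by move=> n _; rewrite lee_fin poisson_pmf_ge0.
rewrite poisson_pmf_total// mule1.
rewrite (@nneseriesD1 _ _ 0)//; last first.
  by move=> n _; rewrite lee_fin !mulr_ge0// poisson_pmf_ge0.
rewrite eseries0; last by move=> n _ /= /negbTE ->; rewrite mul0r.
rewrite adde0 eqxx mul1r -EFinD; congr EFin.
by rewrite /poisson_pmf h0 /e fact0 invr1 expr0 !mul1r; ring.
Qed.

End kernel.

Section box_paths.
Context (R : realType) (d : nat).
Local Notation lat := (lattice d).
Variable Box : seq lat.

(** Paths are listed from the most recent site to the oldest one, so that
    recursion on the list removes slots in the order of the reversed walk. *)
Fixpoint boxpaths (M : nat) : seq (seq lat) :=
  if M is M'.+1 then [seq x :: q | x <- Box, q <- boxpaths M'] else [:: [::]].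

Fixpoint meetings (q q' : seq lat) : nat :=
  if (q, q') is (x :: s, x' :: s') then ((x == x') + meetings s s')%N else 0%N.

Variable p : lat -> lat -> R.

Fixpoint pweight (z : lat) (q : seq lat) : R :=
  if q is x :: s then p z x * pweight x s else 1.

Variables (psi : lat -> lat -> R) (ch a B : R).
Hypothesis p0 : forall x y, 0 <= p x y.
Hypothesis psi_sym : forall x y, psi x y = psi y x.
Hypothesis psi1 : forall x y, 1 <= psi x y.
Hypothesis psiB : forall x y, psi x y <= B.
Hypothesis a0 : 0 <= a.
Hypothesis ch0 : 0 <= ch.
Hypothesis aB : a * B <= ch.
Hypothesis psi_super : forall x y,
  \sum_(z <- Box) p x z * psi z y <= psi x y - ch * (x == y)%:R.

Lemma pweight_ge0 z q : 0 <= pweight z q.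
Proof. by elim: q z => [|x q IH] z //=; rewrite mulr_ge0. Qed.

(** The induction hypothesis is applied to the pair of first sites. Moving the two
    walks one after the other lowers [psi] by at least [ch] on the diagonal,
    which pays for the factor of a meeting: there [(1 + a) * (psi - ch) <= psi],
    since [a * psi <= a * B <= ch]. *)
Lemma second_moment_meetings M z z' : (1 + a * (z == z')%:R) *
  \sum_(q <- boxpaths M) \sum_(q' <- boxpaths M)
    pweight z q * pweight z' q' * (1 + a) ^+ meetings q q' <= (1 + a) * psi z z'.
Proof.
have f0 x y : 0 <= 1 + a * (x == y :> lat)%:R by rewrite addr_ge0// mulr_ge0.
elim: M z z' => [|M IH] z z'.
  rewrite /= !big_seq1 /= mul1r mulr1; apply: ler_pM => //.
  by rewrite lerD2l ler_piMr// lern1 leq_b1.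
pose S x x' := \sum_(q <- boxpaths M) \sum_(q' <- boxpaths M)
    pweight x q * pweight x' q' * (1 + a) ^+ meetings q q'.
have -> : \sum_(q <- boxpaths M.+1) \sum_(q' <- boxpaths M.+1)
    pweight z q * pweight z' q' * (1 + a) ^+ meetings q q' =
    \sum_(x <- Box) \sum_(x' <- Box) p z x * p z' x' * ((1 + a * (x == x')%:R) * S x x').
  rewrite /= big_allpairs_dep/=; apply: eq_bigr => x _.
  rewrite (eq_bigr (fun q => \sum_(x' <- Box) \sum_(q' <- boxpaths M)
    p z x * p z' x' * (1 + a * (x == x')%:R) * (pweight x q * pweight x' q' * (1 + a) ^+ meetings q q'))); last first.
    move=> q _; rewrite big_allpairs_dep/=; apply: eq_bigr => x' _; apply: eq_bigr => q' _.
    rewrite exprD; have -> : (1 + a) ^+ (x == x') = 1 + a * (x == x')%:R.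
      by case: (x == x'); rewrite ?expr1 ?mulr1// expr0 mulr0 addr0.
    by ring.
  rewrite exchange_big/=; apply: eq_bigr => x' _; rewrite /S mulrA mulr_sumr.
  by apply: eq_bigr => q _; rewrite mulr_sumr.
apply: (@le_trans _ _ ((1 + a * (z == z')%:R) *
   ((1 + a) * \sum_(x <- Box) p z x * (\sum_(x' <- Box) p z' x' * psi x' x)))).
  rewrite ler_wpM2l// mulr_sumr; apply: ler_sum => x _.
  rewrite mulrCA !mulr_sumr; apply: ler_sum => x' _.
  rewrite -mulrA ler_wpM2l// [leRHS]mulrCA ler_wpM2l// [psi x' x]psi_sym; exact: IH.
rewrite mulrCA ler_wpM2l ?addr_ge0//.
have h1 : \sum_(x <- Box) p z x * (\sum_(x' <- Box) p z' x' * psi x' x) <= psi z z' - ch * (z == z')%:R.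
  apply: le_trans (psi_super z z'); apply: ler_sum => x _; rewrite ler_wpM2l//.
  by apply: le_trans (psi_super z' x) _; rewrite psi_sym gerBl mulr_ge0.
apply: le_trans (ler_wpM2l (f0 z z') h1) _.
case: eqP => [->|_]; last by rewrite !mulr0 addr0 subr0 mul1r.
rewrite !mulr1; have := psiB z' z'; have := psi1 z' z'; move: (psi z' z') => P P1 PB.
have : a * P <= a * B by rewrite ler_wpM2l.
have : 0 <= a * ch by rewrite mulr_ge0.
rewrite mulrDl mul1r mulrBr; have := aB; lra.
Qed.

End box_paths.

(** * Jump counts of a trajectory *)

Section walk_paths.
Context (R : realType) (d : nat).
Local Notation lat := (lattice d).
Local Notation W := (walk_space d (0 : R)).
Implicit Types p : walk d (0 : R).

Definition njumps p (r : R) : nat := #|` fset_set [set k | jump p k <= r]|%fset.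

Lemma jump_lt p i j : (i < j)%N -> jump p i < jump p j.
Proof.
elim: j => // j IH; rewrite ltnS leq_eqVlt => /orP[/eqP ->|/IH H]; first exact: jump_increasing.
exact: lt_trans H (jump_increasing p j).
Qed.

Lemma jump_le p i j : (i <= j)%N -> jump p i <= jump p j.
Proof. by rewrite leq_eqVlt => /orP[/eqP ->//|/(jump_lt p)/ltW]. Qed.

Lemma jump_gt0 p i : 0 < jump p i.
Proof. by apply: lt_le_trans (jump_start p) (jump_le p (leq0n i)). Qed.

(** The jump times increase to infinity, so that the indices of the jumps
    before a given time form an initial segment. *)
Lemma prefix_card p (Pr : pred R) : (forall a b, a <= b -> Pr b -> Pr a) ->
  (exists r, forall b, r < b -> ~~ Pr b) ->
  exists n, [set k | Pr (jump p k)] = `I_n.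
Proof.
move=> dc [r hr].
have ex : exists k, ~~ Pr (jump p k).
  by have [k /hr H] := jump_unbounded p r; exists k.
have [n Hn min] := ex_minnP ex.
exists n; apply/seteqP; split => k /=.
  move=> Pk; rewrite ltnNge; apply/negP => nk; move: Hn; apply/negP; rewrite negbK.
  exact: dc (jump_le p nk) Pk.
by move=> kn; apply: contraT => /min; rewrite leqNgt kn.
Qed.

Lemma card_prefix (A : set nat) n : A = `I_n -> #|` fset_set A|%fset = n.
Proof. by move=> ->; apply: card_fset_set; exact: card_eqxx. Qed.

Lemma njumpsE p r : [set k | jump p k <= r] = `I_(njumps p r).
Proof.
have [|n nE] := prefix_card p (Pr := fun x => x <= r) (fun a b ab => le_trans ab).
  by exists r => b; rewrite ltNge.
by rewrite {1}nE /njumps (card_prefix nE).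
Qed.

Lemma njumpsP p r k : (jump p k <= r) = (k < njumps p r)%N.
Proof.
have /seteqP[h1 h2] := njumpsE p r.
by apply/idP/idP => [/h1|/h2].
Qed.

Lemma njumps_eqP p r n : njumps p r = n <-> (forall k, (k < n)%N -> jump p k <= r) /\ r < jump p n.
Proof.
split=> [<-|[h1 h2]].
  by split=> [k|]; rewrite ?ltNge njumpsP// ltnn.
apply/eqP; rewrite eqn_leq; apply/andP; split.
  by rewrite leqNgt -njumpsP -ltNge.
by case: n h1 {h2} => // n h1; rewrite -njumpsP h1.
Qed.

Lemma njumps_mono p r s : r <= s -> (njumps p r <= njumps p s)%N.
Proof.
move=> rs; rewrite leqNgt; apply/negP => h.
have := njumpsP p r (njumps p s); rewrite h => /(le_trans)/(_ rs).
by rewrite njumpsP ltnn.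
Qed.

Lemma njumps0 p : njumps p 0 = 0%N.
Proof. by apply/njumps_eqP; split => //; exact: jump_gt0. Qed.

Lemma etaE p r : eta p r = site p (njumps p r).
Proof. by []. Qed.

(** The jump chain is independent of these events, which determine the number
    of jumps up to any given time. *)
Definition clock : set (set W) := sigma_of (fun k (p : W) => jump p k).

Lemma clock_jump k (B : set R) : measurable B -> clock [set p | B (jump p k)].
Proof.
move=> mB; apply: sub_sigma_algebra; exists k => //; exists B => //.
by rewrite setTI.
Qed.

Lemma clockC A : clock A -> clock (~` A).
Proof. exact: sigma_algebraC. Qed.

Lemma clock_bigcup (F : nat -> set W) : (forall i, clock (F i)) -> clock (\bigcup_i F i).
Proof. exact: sigma_algebra_bigcup. Qed.

Lemma clock0 : clock set0. Proof. exact: sigma_algebra0. Qed.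
Lemma clockT : clock setT. Proof. by rewrite -setC0; apply: clockC; exact: clock0. Qed.

Lemma clock_bigcap (F : nat -> set W) : (forall i, clock (F i)) -> clock (\bigcap_i F i).
Proof.
by move=> FH; rewrite -[X in clock X]setCK setC_bigcap; apply: clockC; apply: clock_bigcup => i; apply: clockC.
Qed.

Lemma clockI A B : clock A -> clock B -> clock (A `&` B).
Proof.
move=> cA cB; rewrite -bigcap2E; apply: clock_bigcap => -[|[|i]] //=; exact: clockT.
Qed.

Lemma clock_measurable A : clock A -> measurable (A : set W).
Proof.
apply: smallest_sub; first exact: sigma_algebra_measurable.
move=> _ [k _ [B mB <-]]; apply: sub_sigma_algebra; exists k => //; left.
by exists B.
Qed.

Lemma measurable_site k (D : set lat) : measurable [set p : W | D (site p k)].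
Proof.
apply: sub_sigma_algebra; exists k => //; right; exists D => //.
by rewrite setTI.
Qed.

Lemma clock_njumps r n : clock [set p | njumps p r = n].
Proof.
rewrite (_ : [set p | _] = (\bigcap_k [set p : W | (k < n)%N -> jump p k <= r]) `&` [set p | r < jump p n]).
  apply: clockI.
    apply: clock_bigcap => k; case: (ltnP k n) => kn.
      rewrite (_ : [set p | _] = [set p | `]-oo, r]%classic (jump p k)]); first exact: clock_jump.
      by apply/seteqP; split => p /=; rewrite in_itv/=; [apply|].
    rewrite (_ : [set p | _] = setT); first exact: clockT.
    by apply/seteqP; split.
  rewrite (_ : [set p | _] = [set p | `]r, +oo[%classic (jump p n)]); first exact: clock_jump.
  by apply/seteqP; split => p /=; rewrite in_itv/= andbT.
apply/seteqP; split => p /=.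
  by move=> /njumps_eqP[h1 h2]; split=> // k _; exact: h1.
by move=> [h1 h2]; apply/njumps_eqP; split=> // k; exact: h1.
Qed.

Lemma measurable_njumps r n : measurable [set p : W | njumps p r = n].
Proof. exact: clock_measurable (clock_njumps r n). Qed.

Lemma measurable_eta r (D : set lat) : measurable [set p : W | D (eta p r)].
Proof.
rewrite (_ : [set p : W | _] = \bigcup_n ([set p : W | njumps p r = n] `&` [set p : W | D (site p n)])).
  by apply: bigcupT_measurable => n; apply: measurableI; [exact: measurable_njumps|exact: measurable_site].
apply/seteqP; split => p /=; first by move=> H; exists (njumps p r).
by move=> [n _ [/= <-]].
Qed.

(** Translates between the counting of points of the Poisson process in an
    interval and the increments of [njumps]. *)
Lemma count_itv p r s n : r <= s ->
  ([set i | `]r, s]%classic (jump p i)] #= `I_n)%card <-> njumps p s = (njumps p r + n)%N.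
Proof.
move=> rs; have rsn := njumps_mono p rs.
have E : [set i | `]r, s]%classic (jump p i)] = `I_(njumps p s) `\` `I_(njumps p r).
  apply/seteqP; split => i /=; rewrite in_itv/= njumpsP.
    by move=> /andP[h1 h2]; split=> //; rewrite -njumpsP; apply/negP; rewrite -ltNge.
  by move=> [h1 h2]; rewrite h1 andbT ltNge njumpsP; apply/negP.
rewrite E; split.
  by move=> h; have := card_eq_trans (card_esym card_IID) h => /card_eq_II; lia.
move=> h; apply: card_eq_trans card_IID _; apply/card_eq_II; lia.
Qed.

End walk_paths.

(** * The Markov property at equally spaced times *)

Section markov.
Context (R : realType) (d : nat).
Local Notation lat := (lattice d).
Local Notation W := (walk_space d (0 : R)).
Variables (x : lat) (P : probability W R).
Hypothesis hP : srw_law x P.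

Definition slot_jumps (h : R) (i n : nat) : set W :=
  [set p | njumps p (i.+1%:R * h) = (njumps p (i%:R * h) + n)%N].

Lemma clock_slot_jumps h i n : clock (slot_jumps h i n).
Proof.
rewrite (_ : slot_jumps h i n = \bigcup_m ([set p : W | njumps p (i%:R * h) = m] `&`
    [set p : W | njumps p (i.+1%:R * h) = (m + n)%N])).
  by apply: clock_bigcup => m; apply: clockI; exact: clock_njumps.
apply/seteqP; split => p; first by move=> H; exists (njumps p (i%:R * h)).
by move=> [m _ [/= <-]].
Qed.

(** The slots are disjoint intervals of length [h], so that the counts are
    independent Poisson variables. *)
Lemma poisson_slot_jumps (h : R) (a : nat -> nat) j : 0 < h ->
  P [set p | forall i, (i < j)%N -> slot_jumps h i (a i) p] = (\prod_(i < j) poisson_pmf h (a i))%:E.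
Proof.
move=> h0.
have hle i : i%:R * h <= i.+1%:R * h by rewrite ler_wpM2r ?(ltW h0)// ler_nat.
have hle2 i k : (i <= k)%N -> i%:R * h <= k%:R * h.
  by move=> ik; rewrite ler_wpM2r ?(ltW h0)// ler_nat.
pose B (i : nat) : set R := `]i%:R * h, i.+1%:R * h]%classic.
have mB i : measurable (B i) by exact: measurable_itv.
have B0 i : B i `<=` `]0, +oo[%classic.
  move=> r; rewrite /B/= !in_itv/= andbT => /andP[+ _]; apply: le_lt_trans.
  by rewrite mulr_ge0// ltW.
have tB : trivIset setT B.
  apply/trivIsetP => i k _ _ ik; apply/seteqP; split => // r [] /=.
  rewrite /B/= !in_itv/= => /andP[i1 i2] /andP[k1 k2]; apply/negP: ik; rewrite negbK.
  rewrite eqn_leq; apply/andP; split; rewrite leqNgt; apply/negP => lt.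
    by have := lt_le_trans i1 (le_trans k2 (hle2 _ _ lt)); rewrite ltxx.
  by have := lt_le_trans k1 (le_trans i2 (hle2 _ _ lt)); rewrite ltxx.
have lB i : lebesgue_measure (B i) = h%:E.
  rewrite lebesgue_measure_itv/= lte_fin ltr_pM2r// ltr_nat ltnSn -EFinB; congr EFin.
  by rewrite -natr1; ring.
case: hP => -[hpois hind] _.
have := hind B mB B0 tB (iota 0 j)
  (fun i => [set w : W | ([set k | B i (jump w k)] #= `I_(a i))%card]) (iota_uniq _ _).
move=> /(_ (fun i _ => ex_intro2 _ _ (a i) I erefl)).
have -> : \bigcap_(i in [set` iota 0 j]) [set w : W | ([set k | B i (jump w k)] #= `I_(a i))%card]
   = [set p | forall i, (i < j)%N -> slot_jumps h i (a i) p].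
  apply/seteqP; split => p /= H i.
    by move=> ij; apply/(count_itv p (a i) (hle i))/H => /=; rewrite mem_iota.
  by move=> /=; rewrite mem_iota/= => ij; apply/(count_itv p (a i) (hle i))/H.
move=> ->; rewrite -[RHS]prodEFin -(big_mkord xpredT (fun i => (poisson_pmf h (a i))%:E)).
rewrite /index_iota subn0; apply: eq_bigr => i _.
rewrite hpois//; last by rewrite lB ltry.
rewrite lB/=; congr EFin; rewrite /poisson_pmf h0; ring.
Qed.

Lemma nat_partition (N : W -> nat) (C : set W) :
  (forall k, measurable [set p | N p = k]) -> measurable C ->
  P C = (\sum_(k <oo) P (C `&` [set p | N p = k]))%E.
Proof.
move=> mN mC.
have mF k : measurable (C `&` [set p | N p = k]) by exact: measurableI.
rewrite -measure_semi_bigcup//.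
- congr (P _); apply/seteqP; split => p; first by move=> Cp; exists (N p).
  by move=> [k _ []].
- apply/trivIsetP => i j _ _ ij; apply/seteqP; split => // p [[_ /= Ni] [_ /= Nj]].
  by move: ij; rewrite -Ni -Nj eqxx.
- exact: bigcupT_measurable.
Qed.

Definition first_sites n (p : W) : {ffun 'I_n.+1 -> lat} := [ffun i => site p (val i)].

Lemma measurable_first_sites n g : measurable [set p : W | first_sites n p = g].
Proof.
rewrite (_ : [set p | _] = \bigcap_(i in [set i : nat | (i < n.+1)%N]) [set p : W | site p i = g (inord i)]).
  by apply: bigcap_measurable => [|i _]; [exists 0%N | exact: (measurable_site i [set g (inord i)])].
apply/seteqP; split => p /= H.
  by move=> i /= ni; rewrite -H ffunE/= inordK.
by apply/ffunP => i; rewrite ffunE (H i (ltn_ord i)) inord_val.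
Qed.

(** Encoding the first sites by an integer turns conditioning on them into a
    countable sum. *)
Definition first_sites_code n p : nat := choice.pickle (first_sites n p).

Lemma measurable_first_sites_code n k : measurable [set p | first_sites_code n p = k].
Proof.
have [[g gk]|H] := pselect (exists g : {ffun 'I_n.+1 -> lat}, choice.pickle g = k).
  rewrite (_ : [set p | _] = [set p | first_sites n p = g]); first exact: measurable_first_sites.
  apply/seteqP; split => p /=; last by rewrite /first_sites_code => ->.
  by rewrite /first_sites_code -gk => /(pcan_inj choice.pickleK).
rewrite (_ : [set p | _] = set0); first exact: measurable0.
by apply/seteqP; split => // p /= pk; apply: H; exists (first_sites n p).
Qed.

(** The past of the jump chain up to its [n]-th step, enlarged by the whole
    clock: the jump chain is still a Markov chain with respect to it. *)
Definition adapted n (C : set W) := exists A, clock A /\ exists D : set (nat -> lat),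
  (forall g g', (forall j, (j <= n)%N -> g j = g' j) -> D g -> D g') /\
  C = A `&` [set p | D (site p)].

Lemma adapted_measurable n C : adapted n C -> measurable C.
Proof.
move=> [A [cA [D [dep ->]]]]; apply: measurableI; first exact: clock_measurable.
rewrite (_ : [set p | _] = \bigcup_k ([set p | first_sites_code n p = k] `&`
   [set _ | exists2 p, first_sites_code n p = k & D (site p)])).
  apply: bigcupT_measurable => k; apply: measurableI; first exact: measurable_first_sites_code.
  have [[q q1 q2]|H] := pselect (exists2 p, first_sites_code n p = k & D (site p)).
    by rewrite (_ : [set _ | _] = setT)//; apply/seteqP; split => // p _; exists q.
  by rewrite (_ : [set _ | _] = set0)//; apply/seteqP; split.
apply/seteqP; split => p /=; first by move=> Dp; exists (first_sites_code n p) => //; split => //=; exists p.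
move=> [k _ [/= pk [q qk Dq]]]; apply: dep Dq => j jn.
have /ffunP/(_ (inord j)) : first_sites n q = first_sites n p.
  by apply: (pcan_inj choice.pickleK); rewrite -/(first_sites_code n q) qk -pk.
by rewrite !ffunE/= inordK.
Qed.

Lemma adaptedS n m C : (n <= m)%N -> adapted n C -> adapted m C.
Proof.
move=> nm [A [cA [D [dep ->]]]]; exists A; split => //; exists D; split => // g g' H.
by apply: dep => j jn; apply: H; exact: leq_trans nm.
Qed.

Lemma adapted_site n j u C : (j <= n)%N -> adapted n C -> adapted n (C `&` [set p | site p j = u]).
Proof.
move=> jn [A [cA [D [dep ->]]]]; exists A; split => //.
exists (D `&` [set g | g j = u]); split; last by rewrite setIA.
by move=> g g' H [Dg /= gu]; split; [exact: dep Dg|rewrite /= -H].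
Qed.

Definition jump_prob (u v : lat) : R := (neighbours u v)%:R / (2 * d)%:R.

Lemma jump_prob_ge0 u v : 0 <= jump_prob u v.
Proof. by rewrite divr_ge0. Qed.

(** An adapted event is split along the values of the first sites; on each piece
    the law of the walk gives the probability as an explicit product. *)
Lemma one_step n C u v : adapted n C ->
  P (C `&` [set p | site p n = u] `&` [set p | site p n.+1 = v]) =
  (P (C `&` [set p | site p n = u]) * (jump_prob u v)%:E)%E.
Proof.
move=> aC; have mC := adapted_measurable aC.
have ms k w := measurable_site k [set w] : measurable [set p : W | site p k = w].
have mCu : measurable (C `&` [set p | site p n = u]) by exact: measurableI.
rewrite (nat_partition (measurable_first_sites_code n)); last exact: measurableI.
rewrite [in RHS](nat_partition (measurable_first_sites_code n))//.
rewrite muleC -nneseriesZl; last by move=> k _; exact: measure_ge0.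
apply: eq_eseriesr => k _.
have [[g gk]|H] := pselect (exists g : {ffun 'I_n.+1 -> lat}, choice.pickle g = k); last first.
  have -> : [set p | first_sites_code n p = k] = set0.
    by apply/seteqP; split => // p /= pk; apply: H; exists (first_sites n p).
  by rewrite !setI0 measure0 mule0.
have hg p : first_sites_code n p = k <-> forall j, (j <= n)%N -> site p j = g (inord j).
  rewrite /first_sites_code -gk; split.
    move=> /(pcan_inj choice.pickleK) <- j jn; by rewrite ffunE/= inordK.
  by move=> H; congr (choice.pickle _); apply/ffunP => i; rewrite ffunE (H _ (leq_ord i)) inord_val.
case: aC => A [cA [D [dep CE]]].
(* The trajectory coded by k, followed by v. *)
pose e j := if (j <= n)%N then g (inord j) else v.
have [[De gu]|H] := pselect (D e /\ g (inord n) = u); last first.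
  rewrite (_ : _ `&` _ `&` [set p | first_sites_code n p = k] = set0); last first.
    apply/seteqP; split => // p [[[]]]; rewrite CE => -[_ /= Dp] pu _ /hg pg; apply: H; split.
      by apply: dep Dp => j jn; rewrite /e jn pg.
    by rewrite -pg.
  rewrite (_ : _ `&` [set p | first_sites_code n p = k] = set0) ?measure0 ?mule0//.
  apply/seteqP; split => // p [[]]; rewrite CE => -[_ /= Dp] pu /hg pg; apply: H; split.
    by apply: dep Dp => j jn; rewrite /e jn pg.
  by rewrite -pg.
have -> : C `&` [set p | site p n = u] `&` [set p | first_sites_code n p = k] =
    A `&` [set p | forall j, (j <= n)%N -> site p j = e j].
  apply/seteqP; split => p.
    move=> [[]]; rewrite CE => -[Ap _] _ /hg pg; split => //= j jn.
    by rewrite /e jn pg.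
  move=> [Ap /= pe]; have pg j : (j <= n)%N -> site p j = g (inord j).
    by move=> jn; rewrite pe// /e jn.
  split; last exact/hg.
  split; last by rewrite /= pg.
  by rewrite CE; split => //=; apply: dep De => j jn; rewrite pe.
have -> : C `&` [set p | site p n = u] `&` [set p | site p n.+1 = v] `&` [set p | first_sites_code n p = k] =
    A `&` [set p | forall j, (j <= n.+1)%N -> site p j = e j].
  apply/seteqP; split => p.
    move=> [[[]]]; rewrite CE => -[Ap _] _ /= pv /hg pg; split => //= j.
    rewrite leq_eqVlt => /orP[/eqP ->|]; first by rewrite /e ltnn.
    by rewrite ltnS => jn; rewrite /e jn pg.
  move=> [Ap /= pe]; have pg j : (j <= n)%N -> site p j = g (inord j).
    by move=> jn; rewrite pe ?(leqW jn)// /e jn.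
  split; last exact/hg.
  split; last by rewrite /= pe// /e ltnn.
  split; last by rewrite /= pg.
  by rewrite CE; split => //=; apply: dep De => j jn; rewrite pe// leqW.
case: hP => _ chain.
rewrite (chain _ cA) (chain _ cA) big_ord_recr/= mulrA [RHS]muleC -muleA -EFinM.
congr (_ * (_ * jump_prob _ _)%:E)%E; rewrite /e; first by rewrite leqnn.
by rewrite ltnn.
Qed.

Lemma jump_prob_sum u (f : lat -> R) : (forall w, 0 <= f w) ->
  (\sum_(k <oo) (if choice.pickle_inv k is Some v then jump_prob u v * f v else 0)%:E)%E =
  (nbr_average f u)%:E.
Proof.
move=> f0.
rewrite /nbr_average mulr_suml -sumEFin.
transitivity (\sum_(k <oo) \sum_(s : bool * 'I_d)
    ((choice.pickle (u + move s) == k)%:R * (f (u + move s) / (2 * d)%:R))%:E)%E.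
  apply: eq_eseriesr => k _; rewrite sumEFin; congr EFin.
  case E : (choice.pickle_inv k) => [v|]; last first.
    rewrite big1// => s _; case: eqP => [sk|_]; last by rewrite mul0r.
    by move: E; rewrite -sk choice.pickleK_inv.
  have kv : choice.pickle v = k by have := @choice.pickle_invK lat k; rewrite E.
  rewrite /jump_prob neighbours_sum mulrAC !mulr_suml; apply: eq_bigr => s _.
  rewrite -kv (inj_eq (pcan_inj choice.pickleK)).
  by case: eqP => [->|_]; rewrite ?mul1r// !mul0r.
rewrite nneseries_sum; last by move=> s k _; rewrite lee_fin mulr_ge0// divr_ge0.
apply: eq_bigr => s _.
rewrite (@nneseriesD1 _ _ (choice.pickle (u + move s)))//; last first.
  by move=> k _; rewrite lee_fin mulr_ge0// divr_ge0.
rewrite eqxx mul1r eseries0 ?adde0// => k _ /= /negbTE.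
by rewrite eq_sym => ->; rewrite mul0r.
Qed.

Lemma many_steps n m C u z : adapted n C ->
  P (C `&` [set p | site p n = u] `&` [set p | site p (n + m)%N = z]) =
  (P (C `&` [set p | site p n = u]) * (nstep R m u z)%:E)%E.
Proof.
elim: m n C u => [|m IH] n C u aC.
  rewrite addn0 /=; case: eqVneq => [->|uz].
    by rewrite mule1; congr (P _); apply/seteqP; split => p //= -[].
  rewrite mule0 (_ : _ `&` _ = set0) ?measure0//.
  by apply/seteqP; split => // p [[_ /= pu] /= pz]; move: uz; rewrite -pu -pz eqxx.
have mC := adapted_measurable aC.
have ms k w := measurable_site k [set w] : measurable [set p : W | site p k = w].
have mS k : measurable [set p : W | choice.pickle (site p n.+1) = k].
  exact: (measurable_site n.+1 [set w | choice.pickle w = k]).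
rewrite (nat_partition mS); last by apply: measurableI => //; exact: measurableI.
rewrite /= -jump_prob_sum; last by move=> w; exact: nstep_ge0.
have [r r0 Pr] : exists2 r, 0 <= r & P (C `&` [set p | site p n = u]) = r%:E.
  exists (fine (P (C `&` [set p | site p n = u]))); first exact: fine_ge0.
  by rewrite fineK// fin_num_measure//; exact: measurableI.
rewrite Pr -nneseriesZl; last first.
  by move=> k _; case: (choice.pickle_inv k) => // v; rewrite lee_fin mulr_ge0 ?jump_prob_ge0 ?nstep_ge0.
apply: eq_eseriesr => k _.
case E : (choice.pickle_inv k) => [v|]; last first.
  rewrite mule0 (_ : _ `&` _ = set0) ?measure0//.
  by apply/seteqP; split => // p [_ /= pk]; move: E; rewrite -pk choice.pickleK_inv.
have kv : choice.pickle v = k by have := @choice.pickle_invK lat k; rewrite E.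
rewrite EFinM muleA -Pr -one_step// -(IH n.+1 (C `&` [set p | site p n = u]) v); last first.
  by apply: (@adaptedS n) => //; exact: adapted_site.
congr (P _); rewrite addnS -addSn -kv.
apply/seteqP; split => p /=.
  by move=> [[H1 H2] /(pcan_inj choice.pickleK) H3].
by move=> [[H1 H2] H3]; rewrite H2.
Qed.

Definition partial_sum (a : nat -> nat) (i : nat) : nat := (\sum_(l < i) a l)%N.

Lemma partial_sumS a i : partial_sum a i.+1 = (partial_sum a i + a i)%N.
Proof. by rewrite /partial_sum big_ord_recr. Qed.

Lemma partial_sum_le a i k : (i <= k)%N -> (partial_sum a i <= partial_sum a k)%N.
Proof.
move=> /subnKC <-; elim: (k - i)%N => [|e IH]; first by rewrite addn0.
by rewrite addnS partial_sumS; apply: leq_trans IH (leq_addr _ _).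
Qed.

Lemma chain_prob (A : set W) (a : nat -> nat) (pi : nat -> lat) j : clock A ->
  P (A `&` [set p | forall i, (i <= j)%N -> site p (partial_sum a i) = pi i]) =
  (P A * ((pi 0%N == x)%:R * \prod_(i < j) nstep R (a i) (pi i) (pi i.+1))%:E)%E.
Proof.
move=> cA.
pose S j := A `&` [set p | forall i, (i <= j)%N -> site p (partial_sum a i) = pi i].
have aS k : adapted (partial_sum a k) (S k).
  exists A; split => //; exists [set g | forall i, (i <= k)%N -> g (partial_sum a i) = pi i]; split => //.
  move=> g g' H Dg i ik; rewrite -H ?Dg//.
  exact: partial_sum_le.
have SS k : S k `&` [set p | site p (partial_sum a k) = pi k] = S k.
  by apply/seteqP; split => p /= [H1 H2]//; split => //; apply: H2.
elim: j => [|j IH].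
  case: hP => _ chain; have := chain A cA 0%N pi; rewrite !big_ord0 => <-.
  congr (P (A `&` _)); apply/seteqP; split => p /= H i; rewrite leqn0 => /eqP ->.
    by have := H 0%N (leqnn _); rewrite /partial_sum big_ord0.
  by rewrite /partial_sum big_ord0 H.
rewrite big_ord_recr/= mulrA EFinM muleA -IH -/(S j) -{1}(SS j) -(@many_steps _ (a j)); last exact: aS.
congr (P _); apply/seteqP; split => p.
  move=> [Ap H]; have H' i : (i <= j)%N -> site p (partial_sum a i) = pi i by move=> ij; apply: H; exact: leqW.
  split; last by rewrite /= -H// partial_sumS.
  by split; [split|apply: H'].
move=> [[[Ap H] _] H2]; split => // i; rewrite leq_eqVlt => /orP[/eqP ->|]; last exact: H.
by rewrite partial_sumS.
Qed.

Lemma njumps_partial_sum h (a : nat -> nat) j p : (forall i, (i < j)%N -> slot_jumps h i (a i) p) ->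
  forall i, (i <= j)%N -> njumps p (i%:R * h) = partial_sum a i.
Proof.
move=> H; elim=> [_|i IH ij]; first by rewrite mul0r njumps0 /partial_sum big_ord0.
by rewrite (H i ij) IH ?partial_sumS// ltnW.
Qed.

Lemma partial_sum_ext a b i : (forall l, (l < i)%N -> a l = b l) -> partial_sum a i = partial_sum b i.
Proof. by move=> H; rewrite /partial_sum; apply: eq_bigr => l _; exact: H. Qed.

(** Interpolates between two descriptions of a trajectory: over the first [j]
    slots the numbers of jumps are prescribed, over the later ones only the
    sites at the ends of the slots. Summing over the number of jumps in slot [j]
    is one step of the downward induction on [j]. *)
Lemma markov_partial (h : R) (pi : nat -> lat) M e j (a : nat -> nat) : 0 < h -> (j + e = M)%N ->
  P [set p | (forall i, (i < j)%N -> slot_jumps h i (a i) p) /\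
     (forall i, (i <= j)%N -> site p (partial_sum a i) = pi i) /\
     (forall k, (j < k <= M)%N -> eta p (k%:R * h) = pi k)] =
  ((pi 0%N == x)%:R * \prod_(i < j) (poisson_pmf h (a i) * nstep R (a i) (pi i) (pi i.+1)) *
    \prod_(j <= i < M) heat_kernel h (pi i) (pi i.+1))%:E.
Proof.
move=> h0; elim: e j a => [|e IH] j a jM.
  rewrite addn0 in jM; rewrite -{}jM big_geq// mulr1.
  rewrite (_ : [set p | _] = [set p | forall i, (i < j)%N -> slot_jumps h i (a i) p] `&`
     [set p | forall i, (i <= j)%N -> site p (partial_sum a i) = pi i]); last first.
    apply/seteqP; split => p /=; first by case=> H1 [].
    by move=> [H1 H2]; split => //; split => // k; lia.
  rewrite chain_prob; last first.
    rewrite (_ : [set p | _] = \bigcap_i [set p : walk_space d (0 : R) | (i < j)%N -> slot_jumps h i (a i) p]); last first.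
      by apply/seteqP; split => p /= H i; [move=> _|]; apply: H.
    apply: clock_bigcap => i; case: (ltnP i j) => ij.
      rewrite (_ : [set p | _] = slot_jumps h i (a i)); first exact: clock_slot_jumps.
      by apply/seteqP; split => p /= H; [apply: H|].
    rewrite (_ : [set p | _] = setT); first exact: clockT.
    by apply/seteqP; split.
  by rewrite poisson_slot_jumps// -EFinM big_split/=; congr EFin; ring.
have jM' : (j < M)%N by lia.
rewrite big_ltn//.
pose N (p : W) := (njumps p (j.+1%:R * h) - njumps p (j%:R * h))%N.
have Ninc b : [set p | N p = b] = slot_jumps h j b.
  have cle (p : W) : (njumps p (j%:R * h) <= njumps p (j.+1%:R * h))%N.
    by apply: njumps_mono; rewrite ler_wpM2r ?(ltW h0)// ler_nat.
  by apply/seteqP; split => p /=; rewrite /N /slot_jumps/=; have := cle p; lia.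
rewrite (nat_partition (N := N)); last 2 first.
- by move=> b; rewrite Ninc; apply: clock_measurable; exact: clock_slot_jumps.
- rewrite (_ : [set p | _] = (\bigcap_i [set p : W | (i < j)%N -> slot_jumps h i (a i) p]) `&`
     ((\bigcap_i [set p : W | (i <= j)%N -> site p (partial_sum a i) = pi i]) `&`
      (\bigcap_k [set p : W | (j < k <= M)%N -> eta p (k%:R * h) = pi k]))); last first.
    apply/seteqP; split => p /=; first by case=> H1 [H2 H3]; split; [|split] => i _; [exact: H1|exact: H2|exact: H3].
    by case=> H1 [H2 H3]; split; [|split] => i; [exact: H1|exact: H2|exact: H3].
  have imp (Q : bool) (S : set W) : measurable S -> measurable [set p | Q -> S p].
    case: Q => mS; first by rewrite (_ : [set p | _] = S)//; apply/seteqP; split => p /=; [apply|].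
    by rewrite (_ : [set p | _] = setT)//; apply/seteqP; split.
  apply: measurableI; [|apply: measurableI]; apply: bigcapT_measurable => i; apply: imp.
  + by apply: clock_measurable; exact: clock_slot_jumps.
  + exact: (measurable_site _ [set w | w = pi i]).
  + exact: (measurable_eta _ [set w | w = pi i]).
set pre := _ * \prod_(i < j) _; set post := \prod_(_ <= _ < _) _.
(* Fixing the number b of jumps in slot j brings the event to the form of the
   induction hypothesis. *)
pose upd b l := if l == j then b else a l.
have updE b l : (l < j)%N -> upd b l = a l by move=> lj; rewrite /upd ltn_eqF.
transitivity (\sum_(b <oo) ((pre * post)%:E * (poisson_pmf h b * nstep R b (pi j) (pi j.+1))%:E))%E.
  apply: eq_eseriesr => b _; rewrite Ninc.
  have := IH j.+1 (upd b) _; rewrite addSnnS => /(_ jM) IHb.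
  transitivity (P [set p | (forall i, (i < j.+1)%N -> slot_jumps h i (upd b i) p) /\
     (forall i, (i <= j.+1)%N -> site p (partial_sum (upd b) i) = pi i) /\
     (forall k, (j.+1 < k <= M)%N -> eta p (k%:R * h) = pi k)]).
    congr (P _); apply/seteqP; split => p.
      move=> [[H1 [H2 H3]] H4].
      have H1' i : (i < j.+1)%N -> slot_jumps h i (upd b i) p.
        rewrite ltnS leq_eqVlt => /orP[/eqP ->|ij]; first by rewrite /upd eqxx.
        by rewrite updE//; exact: H1.
      split=> //; split.
        move=> i; rewrite leq_eqVlt => /orP[/eqP ->|ij].
          rewrite -(njumps_partial_sum H1')// -etaE; apply: H3; lia.
        rewrite (partial_sum_ext (b := a)); first exact: H2.
        by move=> l li; apply: updE; lia.
      by move=> k jk; apply: H3; lia.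
    move=> [H1 [H2 H3]].
    have H1' i : (i < j)%N -> slot_jumps h i (a i) p.
      by move=> ij; rewrite -(updE b)//; apply: H1; lia.
    split; last by have := H1 j (ltnSn j); rewrite /upd eqxx.
    split=> //; split.
      move=> i ij; rewrite (partial_sum_ext (b := upd b)); first by apply: H2; lia.
      by move=> l li; rewrite updE//; lia.
    move=> k /andP[]; rewrite leq_eqVlt => /orP[/eqP <- _|jk kM]; last by apply: H3; rewrite jk.
    by rewrite etaE (njumps_partial_sum H1)// H2.
  rewrite IHb -EFinM; congr EFin; rewrite big_ord_recr/= -/post; have -> : upd b j = b by rewrite /upd eqxx.
  rewrite (eq_bigr (fun i : 'I_j => poisson_pmf h (a i) * nstep R (a i) (pi i) (pi i.+1))).
    by rewrite /pre; ring.
  by move=> i _; rewrite updE.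
rewrite nneseriesZl; last by move=> b _; rewrite lee_fin mulr_ge0 ?poisson_pmf_ge0 ?nstep_ge0.
by rewrite -/(heat_series h _ _) -heat_kernelE// -EFinM; congr EFin; rewrite mulrAC mulrA.
Qed.

Lemma markov_samples (h : R) (pi : nat -> lat) M : 0 < h ->
  P [set p | forall k, (k <= M)%N -> eta p (k%:R * h) = pi k] =
  ((pi 0%N == x)%:R * \prod_(0 <= i < M) heat_kernel h (pi i) (pi i.+1))%:E.
Proof.
move=> h0; have := markov_partial pi (M := M) (e := M) (j := 0) (fun=> 0%N) h0 (add0n _).
rewrite big_ord0 mulr1 => <-; congr (P _); apply/seteqP; split => p /=.
  move=> H; split => //; split.
    move=> i; rewrite leqn0 => /eqP ->; rewrite /partial_sum big_ord0 -(H 0%N)//.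
    by rewrite mul0r etaE njumps0.
  by move=> k /andP[_]; exact: H.
move=> [_ [H1 H2]] [|k] kM; last exact: H2.
by rewrite mul0r etaE njumps0 -(H1 0%N)// /partial_sum big_ord0.
Qed.

End markov.

(** * Sampling the action *)

Section sampling.
Context (R : realType) (d : nat).
Local Notation lat := (lattice d).
Implicit Types p : walk d (0 : R).

Definition slot (t : R) (M : nat) : R := t / M.+1%:R.

Lemma slot_gt0 t M : 0 < t -> 0 < slot t M.
Proof. by move=> t0; rewrite divr_gt0// ltr0n. Qed.

Lemma slotM t M : M.+1%:R * slot t M = t.
Proof. by rewrite /slot mulrC divfK// pnatr_eq0. Qed.

Lemma slot_cvg t : slot t M @[M --> \oo] --> (0 : R).
Proof.
rewrite -[X in _ --> X](mulr0 t); apply: cvgM; first exact: cvg_cst.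
exact: cvg_harmonic.
Qed.

(** The contribution of a single site to the sampled action is a difference of
    two such sums, one for its arrival time and one for its departure time. *)
Definition late_sum (f : R -> R) (s t : R) (M : nat) : R :=
  \sum_(k < M.+1) (s <= k%:R * slot t M)%R%:R * (f (k.+1%:R * slot t M) - f (k%:R * slot t M)).

(** The sum telescopes, from the first multiple of the slot length that is not
    before [s]. *)
Lemma late_sumE f s t M : 0 < t -> 0 <= s -> exists r,
  [/\ late_sum f s t M = f t - f r, 0 <= r <= t & `|r - Num.min s t| <= slot t M].
Proof.
move=> t0 s0; have h0 := slot_gt0 M t0; set h := slot t M in h0 *.
have Mh : M.+1%:R * h = t := slotM t M.
have mono i j : (i <= j)%N -> i%:R * h <= j%:R * h by move=> ij; rewrite ler_wpM2r ?(ltW h0)// ler_nat.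
have ex : exists K, (K == M.+1) || (s <= K%:R * h) by exists M.+1; rewrite eqxx.
have [K HK min] := ex_minnP ex.
have KM : (K <= M.+1)%N by apply: min; rewrite eqxx.
exists (K%:R * h); split.
- rewrite /late_sum -/h -(big_mkord xpredT (fun k => (s <= k%:R * h)%R%:R * (f (k.+1%:R * h) - f (k%:R * h)))).
  rewrite (big_cat_nat _ (n := K))//= big_nat_cond big1 ?add0r; last first.
    move=> k; rewrite andbT => /andP[_ kK]; case: (boolP (s <= _)) => [sk|_]; last by rewrite mul0r.
    by have := min k; rewrite sk orbT leqNgt kK => /(_ isT).
  rewrite (eq_big_nat _ _ (F2 := fun k => f (k.+1%:R * h) - f (k%:R * h))); last first.
    move=> k /andP[Kk kM]; have -> : s <= k%:R * h; last by rewrite mul1r.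
    case/orP : HK => [/eqP KE|sK]; first by move: Kk; rewrite KE leqNgt kM.
    exact: le_trans sK (mono _ _ Kk).
  by rewrite (telescope_sumr (fun k => f (k%:R * h)))// Mh.
- by rewrite mulr_ge0 ?(ltW h0)//= -Mh mono.
- case: K HK min KM => [|K] HK min KM.
    case/orP : HK => [//|]; rewrite mul0r => s0'.
    have -> : s = 0 by apply/eqP; rewrite eq_le s0 s0'.
    by rewrite min_l ?(ltW t0)// subrr normr0 ltW.
  have sK : K%:R * h < s.
    by rewrite ltNge; apply/negP => sK; have := min K; rewrite sK orbT ltnn => /(_ isT).
  have e : K.+1%:R * h = K%:R * h + h by rewrite -natr1 mulrDl mul1r.
  have Kt : K.+1%:R * h <= t by rewrite -Mh mono.
  rewrite ler_distl; case/orP : HK => [/eqP KE|sK'].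
    have Ke : K.+1%:R * h = t by rewrite KE Mh.
    case: (leP s t) => st; apply/andP; split; lra.
  have st : s <= t by apply: le_trans sK' Kt.
  by rewrite min_l//; apply/andP; split; lra.
Qed.

Lemma late_sum_cvg f s t : continuous f -> 0 < t -> 0 <= s ->
  late_sum f s t M @[M --> \oo] --> f t - f (Num.min s t).
Proof.
move=> cf t0 s0.
have [r rP] := choice (fun M => late_sumE f M t0 s0).
rewrite [X in X @ _ --> _](_ : _ = fun M => f t - f (r M)); last first.
  by apply/funext => M; case: (rP M).
apply: cvgB; first exact: cvg_cst.
apply: (continuous_cvg _ (cf _)).
apply/cvgrPdist_le => e e0; have /cvgrPdist_le/(_ e e0) := slot_cvg t.
apply: filterS => M; rewrite sub0r normrN ger0_norm ?(ltW (slot_gt0 _ _))// => he.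
by rewrite distrC; apply: le_trans he; case: (rP M).
Qed.

(** During each slot the site is frozen at its initial value, so that only the
    increments of the environment over whole slots intervene. *)
Definition sampled (t : R) (M : nat) (p : walk d (0 : R)) (w : environment R d) : R :=
  \sum_(k < M.+1) (w (eta p (k%:R * slot t M)) (k.+1%:R * slot t M)
                 - w (eta p (k%:R * slot t M)) (k%:R * slot t M)).

Definition jtime p j : R := if j is j'.+1 then jump p j' else 0.

Lemma jtime_ge0 p j : 0 <= jtime p j.
Proof. by case: j => //= j; rewrite ltW// jump_gt0. Qed.

Definition njumps_before p (t : R) := #|` fset_set [set k | jump p k < t]|%fset.

Lemma njumps_beforeP p t k : (jump p k < t) = (k < njumps_before p t)%N.
Proof.
have [|n nE] := prefix_card p (Pr := fun x => x < t) (fun a b ab => le_lt_trans ab).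
  by exists t => b tb; rewrite -leNgt ltW.
have -> : njumps_before p t = n by rewrite /njumps_before (card_prefix nE).
by have /seteqP[h1 h2] := nE; apply/idP/idP => [/h1|/h2].
Qed.

Lemma njumps_before_le p t : (njumps_before p t <= njumps p t)%N.
Proof.
rewrite leqNgt; apply/negP; rewrite -njumps_beforeP => /ltW; by rewrite njumpsP ltnn.
Qed.

(** Summation by sites instead of slots: the [j]-th site is occupied at the
    beginning of a slot exactly when that instant lies between two successive
    jump times. *)
Lemma sampledE t M p (w : environment R d) : 0 < t -> sampled t M p w =
  \sum_(j < (njumps_before p t).+1) (late_sum (w (site p j)) (jtime p j) t M
     - late_sum (w (site p j)) (jtime p j.+1) t M).
Proof.
move=> t0; have h0 := slot_gt0 M t0.
under eq_bigr do rewrite /late_sum -sumrB.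
rewrite exchange_big/= /sampled; apply: eq_bigr => k _; rewrite etaE.
set r := k%:R * _; set D := fun j => w (site p j) (k.+1%:R * slot t M) - w (site p j) r.
have rt : r < t by rewrite /r -[ltRHS](slotM t M) ltr_pM2r// ltr_nat.
have cn : (njumps p r < (njumps_before p t).+1)%N.
  rewrite ltnS leqNgt; apply/negP => /=; rewrite -njumpsP.
  move=> /(le_lt_trans)/(_ rt); by rewrite njumps_beforeP ltnn.
have jt j : (jtime p j <= r) = (j <= njumps p r)%N.
  case: j => [|j] /=; last by rewrite njumpsP.
  by rewrite /r mulr_ge0// ltW.
rewrite (bigD1 (Ordinal cn))//= big1 ?addr0.
  by rewrite jt leqnn -/(jtime p (njumps p r).+1) jt ltnn mul1r mul0r subr0.
move=> j jc; rewrite jt -/(jtime p j.+1) jt ltn_neqAle.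
have -> : (val j != njumps p r) by apply: contra jc => /eqP jc; apply/eqP/val_inj.
by rewrite /= subrr.
Qed.

Lemma sampled_cvg t p (w : environment R d) : 0 < t -> sampled t M p w @[M --> \oo] --> action t p w.
Proof.
move=> t0.
rewrite [X in X @ _ --> _](_ : _ = fun M => \sum_(j < (njumps_before p t).+1)
   (late_sum (w (site p j)) (jtime p j) t M - late_sum (w (site p j)) (jtime p j.+1) t M)); last first.
  by apply/funext => M; rewrite sampledE.
have -> : action t p w = \sum_(j < (njumps_before p t).+1)
  ((w (site p j) t - w (site p j) (Num.min (jtime p j) t)) -
   (w (site p j) t - w (site p j) (Num.min (jtime p j.+1) t))).
  rewrite /action -/(njumps_before p t); apply: eq_bigr => j _.
  have E (i : nat) : (i <= (njumps_before p t).+1)%N ->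
     (match i with 0 => 0 | i'.+1 => if (i' < njumps_before p t)%N then jump p i' else t end) = Num.min (jtime p i) t.
    case: i => [_|i _] /=; first by rewrite min_l// ltW.
    by rewrite -njumps_beforeP; case: ltP.
  rewrite (E j (ltnW (ltn_ord j))) (E j.+1 (ltn_ord j)); ring.
apply: cvg_sumr => j; apply: cvgB; apply: late_sum_cvg => //; try exact: jtime_ge0;
exact: env_continuous.
Qed.

(** This uniform bound is what dominated convergence requires. *)
Lemma sampled_bound t M p (w : environment R d) (Bd : R) (N : nat) : 0 < t -> (njumps p t <= N)%N -> 0 <= Bd ->
  (forall j, (j <= njumps p t)%N -> forall r, 0 <= r <= t -> `|w (site p j) r| <= Bd) ->
  `|sampled t M p w| <= N.+1%:R * (4 * Bd).
Proof.
move=> t0 cN B0 wB; rewrite sampledE//.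
have L j s : (j <= njumps p t)%N -> 0 <= s -> `|late_sum (w (site p j)) s t M| <= 2 * Bd.
  move=> jc s0; have [r [-> rt _]] := late_sumE (w (site p j)) M t0 s0.
  apply: le_trans (ler_normB _ _) _; rewrite mulr_natl mulr2n.
  by apply: lerD; apply: wB => //; rewrite lexx andbT ltW.
apply: le_trans (ler_norm_sum _ _ _) _.
apply: (@le_trans _ _ (\sum_(j < (njumps_before p t).+1) 4 * Bd)).
  apply: ler_sum => j _.
  have jc : (j <= njumps p t)%N by apply: leq_trans (njumps_before_le p t); rewrite -ltnS.
  apply: le_trans (ler_normB _ _) _.
  have := L j (jtime p j) jc (jtime_ge0 p j).
  have := L j (jtime p j.+1) jc (jtime_ge0 p j.+1).
  lra.
rewrite sumr_const card_ord -[_ *+ _]mulr_natl ler_wpM2r ?mulr_ge0// ler_nat ltnS.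
exact: leq_trans (njumps_before_le p t) cN.
Qed.

End sampling.

(** * Increments of the environment *)

Section environment_law.
Context (R : realType) (d : nat).
Local Notation lat := (lattice d).
Variable Q : probability (env_space R d) R.
Hypothesis hQ : wiener_environment Q.
Variables (Box : seq lat) (h : R) (M : nat).
Hypothesis uBox : uniq Box.
Hypothesis h0 : 0 < h.

Definition coords : seq (nat * lat) := [seq (k, z) | k <- iota 0 M, z <- Box].
Definition coord i : nat * lat := nth (0%N, 0) coords i.
Local Notation n := (size coords).

Definition increment (kz : nat * lat) (w : env_space R d) : R :=
  env_fun w kz.2 (kz.1.+1%:R * h) - env_fun w kz.2 (kz.1%:R * h).

Definition increments (w : env_space R d) : n.-tuple R :=
  [tuple increment (coord i) w | i < n].

Lemma uniq_coords : uniq coords.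
Proof. by apply: allpairs_uniq => //; [exact: iota_uniq|move=> [a b] [c e] _ _ [-> ->]]. Qed.

Lemma measurable_increment kz : measurable_fun setT (increment kz).
Proof. by case: hQ => hW _; have [mW _ _ _] := hW kz.2; apply: measurable_funB; exact: mW. Qed.

Lemma measurable_increments : measurable_fun setT increments.
Proof.
apply/measurable_fun_tnthP => i.
rewrite (_ : _ \o _ = increment (coord i)); first exact: measurable_increment.
by apply/funext => w /=; rewrite tnth_mktuple.
Qed.

HB.instance Definition _ := isMeasurableFun.Build _ _ _ _ _ measurable_increments.

Lemma sigma_increment (z : lat) k (B : set R) : measurable B ->
  sigma_of (fun t (w : env_space R d) => env_fun w z t) [set w | B (increment (k, z) w)].
Proof.
move=> mB.
pose G := \bigcup_(t in [set: R]) preimage_set_system setT (fun w : env_space R d => env_fun w z t) measurable.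
pose T := g_sigma_algebraType G.
have mt t : measurable_fun setT (fun w : T => env_fun w z t).
  move=> _ C mC; apply: sub_sigma_algebra; exists t => //; exists C => //.
have mi : measurable_fun setT (fun w : T => increment (k, z) w).
  by apply: measurable_funB; exact: mt.
by have := mi measurableT B mB; rewrite setTI.
Qed.

(** Increments at one site over disjoint slots are independent, and different
    sites are independent; by [iid_unique] this determines the joint law. *)
Lemma increments_law (A : set (n.-tuple R)) : measurable A ->
  Q (increments @^-1` A) = iid (gauss (Num.sqrt h)) n A.
Proof.
case: hQ => hW hind mA.
apply: (iid_unique (m := distribution Q increments)) => // B mB.
pose Bn j : set R := if insub j is Some i then B i else setT.
have mBn j : measurable (Bn j) by rewrite /Bn; case: insubP.
pose BB kz := Bn (index kz coords).
have BBi (i : 'I_n) : BB (coord i) = B i.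
  rewrite /BB /coord index_uniq ?ltn_ord ?uniq_coords// /Bn.
  by rewrite insubT//= => ?; congr B; exact: val_inj.
pose Az z := \bigcap_(k in [set` iota 0 M]) [set w | BB (k, z) (increment (k, z) w)].
have saz z : sigma_algebra setT (sigma_of (fun t (w : env_space R d) => env_fun w z t)).
  exact: smallest_sigma_algebra.
have sAz z : sigma_of (fun t (w : env_space R d) => env_fun w z t) (Az z).
  pose G := \bigcup_(t in [set: R]) preimage_set_system setT (fun w : env_space R d => env_fun w z t) measurable.
  pose T := g_sigma_algebraType G.
  have : @measurable _ T (Az z).
    rewrite /Az bigcap_seq; apply: bigsetI_measurable => k _.
    by apply: sigma_increment; exact: mBn.
  by [].
transitivity (Q (\bigcap_(z in [set` Box]) Az z)).
  congr (Q _); apply/seteqP; split => w /= H.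
    move=> z /= zB k /= kM.
    have iL : (index (k, z) coords < n)%N.
      by rewrite index_mem; apply/allpairsP; exists (k, z).
    have := H (Ordinal iL); rewrite tnth_mktuple -BBi /coord/= nth_index//.
    by rewrite -index_mem.
  move=> i; rewrite tnth_mktuple -BBi.
  have : coord i \in coords by exact: mem_nth.
  by move=> /allpairsP[[k z] /= [kM zB ->]]; exact: H.
rewrite (hind Box Az uBox (fun z _ => sAz z)).
have QA z : Q (Az z) = (\prod_(k <- iota 0 M) gauss (Num.sqrt h) (BB (k, z)))%E.
  have [_ _ hnorm hincr] := hW z.
  have inc_h : {homo (fun i : nat => i%:R * h) : i j / (i < j)%N >-> i < j}.
    by move=> i j ij; rewrite ltr_pM2r// ltr_nat.
  rewrite /Az (hincr (fun i => i%:R * h) inc_h (iota 0 M)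
    (fun k => [set w | BB (k, z) (increment (k, z) w)]) (iota_uniq _ _)); last first.
    by move=> k _; exists (BB (k, z)); [exact: mBn|rewrite setTI].
  apply: eq_bigr => k _; rewrite gaussE.
  have e : k.+1%:R * h - k%:R * h = h by rewrite -natr1; ring.
  by have := hnorm _ _ (inc_h k k.+1 (ltnSn k)) _ (mBn (index (k, z) coords)); rewrite e.
under eq_bigr do rewrite QA.
rewrite exchange_big/=.
transitivity (\prod_(kz <- coords) gauss (Num.sqrt h) (BB kz))%E.
  by rewrite /coords big_allpairs_dep.
rewrite (big_nth (0%N, 0)) big_mkord; apply: eq_bigr => i _.
by rewrite -/(coord i) BBi.
Qed.

End environment_law.

(** * One-time marginals and measurability *)

Section walk_law.
Context (R : realType) (d : nat).
Local Notation lat := (lattice d).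
Local Notation W := (walk_space d (0 : R)).
Variables (x : lat) (P : probability W R).
Hypothesis hP : srw_law x P.

Lemma starts_at : P [set p | eta p 0 = x] = 1%E.
Proof.
have := markov_samples hP (fun=> x) 0 ltr01.
rewrite eqxx big_geq// mulr1 => <-; congr (P _); apply/seteqP; split => p /=.
  by move=> H k; rewrite leqn0 => /eqP ->; rewrite mul0r.
by move=> /(_ 0%N (leqnn _)); rewrite mul0r.
Qed.

Lemma meet_start A : measurable A -> P (A `&` [set p : W | eta p 0 = x]) = P A.
Proof.
move=> mA; set S := [set p : W | eta p 0 = x].
have mS : measurable S by exact: (measurable_eta 0 [set x]).
have D0 : P (A `\` S) = 0%E.
  apply/eqP; rewrite eq_le measure_ge0 andbT.
  apply: (@le_trans _ _ (P (~` S))).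
    by apply: le_measure; rewrite ?inE//; [exact: measurableD|exact: measurableC].
  by rewrite probability_setC// starts_at subee.
have e : P A = (P (A `\` S) + P (A `&` S))%E by exact: measureDI.
by rewrite e D0 add0e.
Qed.

Lemma eta_prob t y : 0 < t -> P [set p | eta p t = y] = (heat_kernel t x y)%:E.
Proof.
move=> t0; rewrite -meet_start; last exact: (measurable_eta t [set y]).
have := markov_samples hP (fun k => if k is 0%N then x else y) 1 t0.
rewrite eqxx big_nat1 mul1r => <-; congr (P _); apply/seteqP; split => p /=.
  by move=> [py px] [|[|//]] _; rewrite ?mul0r ?mul1r.
by move=> H; split; [have := H 1%N (leqnn _)|have := H 0%N isT]; rewrite ?mul0r ?mul1r.
Qed.

Lemma measurable_sampled t M (w : environment R d) :
  measurable_fun setT (fun p : W => sampled t M p w).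
Proof.
apply: measurable_sum => k; move: (k%:R * slot t M) (k.+1%:R * slot t M) => r r'.
move=> _ B mB; rewrite setTI; exact: (measurable_eta r [set z | B (w z r' - w z r)]).
Qed.

Lemma measurable_action t (w : environment R d) : 0 < t ->
  measurable_fun setT (fun p : W => action t p w).
Proof.
move=> t0; apply: (@measurable_fun_cvg _ W R setT (fun M (p : W) => sampled t M p w)).
  by move=> M; exact: measurable_sampled.
by move=> p _; exact: sampled_cvg.
Qed.

End walk_law.

Lemma eta_code_total (R : realType) d (x : lattice d) (P : probability (walk_space d (0 : R)) R) t :
  srw_law x P -> 0 < t -> (\sum_(k <oo) P [set p | choice.pickle (eta p t) = k] = 1)%E.
Proof.
move=> hP t0; rewrite -(probability_setT P).
rewrite (nat_partition P (N := fun p => choice.pickle (eta p t)) (C := setT))//.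
  by apply: eq_eseriesr => k _; rewrite setTI.
by move=> k; exact: (measurable_eta t [set z | choice.pickle z = k]).
Qed.

(** * Restriction to tame trajectories *)

Section truncation.
Context (R : realType) (d : nat).
Local Notation lat := (lattice d).
Local Notation W := (walk_space d (0 : R)).
Variable P : lat -> probability W R.
Hypothesis hP : forall x, srw_law x (P x).
Variables (t : R) (y : lat).
Hypothesis t0 : 0 < t.

(** The sites of code less than [N]: an exhaustion of the lattice by finite
    sets. *)
Definition codebox (N : nat) : seq lat := pmap (@choice.pickle_inv lat) (iota 0 N).

Lemma codebox_uniq N : uniq (codebox N).
Proof.
apply: (pmap_uniq (g := choice.pickle)); last exact: iota_uniq.
by move=> k; exact: choice.pickle_invK.
Qed.

Lemma mem_codebox N z : (z \in codebox N) = (choice.pickle z < N)%N.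
Proof.
rewrite mem_pmap; apply/mapP/idP => [[k kN /esym zk]|zN].
  have := @choice.pickle_invK lat k; rewrite zk /= => ->.
  by move: kN; rewrite mem_iota.
by exists (choice.pickle z); rewrite ?mem_iota// choice.pickleK_inv.
Qed.

Definition tame N : set W := [set p | (njumps p t <= N)%N /\
  forall j, (j <= njumps p t)%N -> (choice.pickle (site p j) < N)%N].

Definition tame_hit N : set W := [set p | eta p t = y] `&` tame N.

Lemma measurable_tame N : measurable (tame N).
Proof.
rewrite (_ : tame N = \bigcup_n ([set p : W | njumps p t = n] `&`
    \bigcap_(j in [set j | (j <= n)%N]) [set p : W | (n <= N)%N /\ (choice.pickle (site p j) < N)%N])).
  apply: bigcupT_measurable => n; apply: measurableI; first exact: measurable_njumps.
  apply: bigcap_measurable => [|j _]; first by exists 0%N.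
  exact: (measurable_site j [set z | (n <= N)%N /\ (choice.pickle z < N)%N]).
apply/seteqP; split => p /=.
  by move=> [h1 h2]; exists (njumps p t) => //; split => // j /= /h2.
by move=> [n _ [/= <- H]]; split=> [|j jn]; [have [] := H 0%N isT|have [] := H j jn].
Qed.

Lemma measurable_tame_hit N : measurable (tame_hit N).
Proof. by apply: measurableI; [exact: (measurable_eta t [set y])|exact: measurable_tame]. Qed.

Lemma tame_hit_mono : {homo tame_hit : n m / (n <= m)%N >-> (n <= m)%O}.
Proof.
move=> n m nm; apply/subsetPset => p [/= py [cn sn]]; split => //; split.
  exact: leq_trans cn nm.
by move=> j /sn /leq_trans; exact.
Qed.

Lemma tame_hit_cover : \bigcup_N tame_hit N = [set p | eta p t = y].
Proof.
apply/seteqP; split => p; first by move=> [N _ []].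
move=> /= py; pose N := (\max_(j < (njumps p t).+1) (choice.pickle (site p j)).+1)%N.
exists (maxn (njumps p t) N) => //; split => //; split; first exact: leq_maxl.
move=> j jc; apply: leq_trans (leq_maxr _ _).
by have := @leq_bigmax 'I_(njumps p t).+1 (fun j => (choice.pickle (site p j)).+1) (Ordinal (jc : (j < (njumps p t).+1)%N)).
Qed.

Lemma tame_hit_cvg x : fine (P x (tame_hit N)) @[N --> \oo] --> heat_kernel t x y.
Proof.
apply: fine_cvg.
rewrite -(eta_prob (hP x) y t0) -tame_hit_cover.
apply: (nondecreasing_cvg_mu (mu := P x)); first exact: measurable_tame_hit.
  by apply: bigcupT_measurable; exact: measurable_tame_hit.
exact: tame_hit_mono.
Qed.

Lemma codebox_mass : exists N, 3 / 4 <= \sum_(x <- codebox N) heat_kernel t x y.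
Proof.
pose u k : \bar R := P y [set p | choice.pickle (eta p t) = k].
have E N : (\sum_(0 <= k < N) u k = (\sum_(x <- codebox N) heat_kernel t x y)%:E)%E.
  rewrite /index_iota subn0 /codebox; elim: (iota 0 N) => [|k s IH]; first by rewrite !big_nil.
  rewrite big_cons IH /= /oapp; case zk : (choice.pickle_inv k) => [z|] /=.
    rewrite big_cons EFinD heat_kernel_sym -(eta_prob (hP y) z t0); congr (P y _ + _)%E.
    have := @choice.pickle_invK lat k; rewrite zk /= => <-.
    by apply/seteqP; split => p /= => [/(pcan_inj choice.pickleK)|->].
  rewrite /u (_ : [set p | _] = set0) ?measure0 ?add0e//.
  apply/seteqP; split => // p /= pk; have := choice.pickleK_inv (eta p t).
  by rewrite pk zk.
have := eta_code_total (hP y) t0; rewrite -/u => Hu.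
have : (\sum_(0 <= k < N) u k)%E @[N --> \oo] --> (1 : \bar R)%E.
  by rewrite -Hu; apply: is_cvg_nneseries => k _ _; exact: measure_ge0.
rewrite (_ : (fun N => _) = fun N => (\sum_(x <- codebox N) heat_kernel t x y)%:E); last exact/funext.
move=> /fine_cvgP[_] /= /cvgrPdist_le/(_ (1/4)) [|N _ H]; first by rewrite divr_gt0.
exists N; have := H N (leqnn N); rewrite /= ler_distl; lra.
Qed.

(** By symmetry of the heat kernel, the probabilities of reaching [y] at time [t]
    add up to 1 over all starting points. Finitely many starting points carry
    3/4 of this mass, and on these the truncation is removed in the limit. *)
Lemma tame_mass : exists N0 N, 1 / 2 <= \sum_(x <- codebox N0) fine (P x (tame_hit N)).
Proof.
have [N0 HN0] := codebox_mass; exists N0.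
have : (\sum_(x <- codebox N0) fine (P x (tame_hit N))) @[N --> \oo] -->
       \sum_(x <- codebox N0) heat_kernel t x y.
  elim: (codebox N0) => [|x s IH].
    under eq_fun do rewrite big_nil; rewrite big_nil; exact: cvg_cst.
  under eq_fun do rewrite big_cons; rewrite big_cons.
  by apply: cvgD IH; exact: tame_hit_cvg.
move=> /cvgrPdist_le/(_ (1/4)) [|N _ H]; first by rewrite divr_gt0.
exists N; have := H N (leqnn N); rewrite /= ler_distl; lra.
Qed.

End truncation.

(** * Sampled trajectories *)

Section sample_paths.
Context (R : realType) (d : nat).
Local Notation lat := (lattice d).
Local Notation W := (walk_space d (0 : R)).

Lemma mem_boxpaths (Box : seq lat) n q :
  (q \in boxpaths Box n) = (size q == n) && all (mem Box) q.
Proof.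
elim: n q => [|n IH] q /=; first by rewrite inE; case: q.
apply/allpairsP/idP => [[[z s] /= [zB + ->]]|].
  by rewrite IH /= eqSS zB.
case: q => [//|z s] /=; rewrite eqSS => /andP[sn /andP[zB sB]].
by exists (z, s); split => //; rewrite IH sn.
Qed.

Lemma uniq_boxpaths (Box : seq lat) n : uniq Box -> uniq (boxpaths Box n).
Proof.
move=> uB; elim: n => //= n IH; apply: allpairs_uniq => //.
by move=> [z s] [z' s'] _ _ [-> ->].
Qed.

Variables (t : R) (M : nat).
Hypothesis t0 : 0 < t.
Local Notation h := (slot t M).

(** The site at the beginning of the latest slot comes first, as in
    [boxpaths]. *)
Definition samples (p : W) : seq lat := [seq eta p (i%:R * h) | i <- rev (iota 0 M.+1)].

Lemma size_samples p : size (samples p) = M.+1.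
Proof. by rewrite size_map size_rev size_iota. Qed.

Lemma nth_samples p i : (i <= M)%N -> nth 0 (samples p) (M - i) = eta p (i%:R * h).
Proof.
move=> iM; rewrite (nth_map 0%N) ?size_rev ?size_iota ?ltnS ?leq_subr//.
rewrite nth_rev ?size_iota ?ltnS ?leq_subr// nth_iota; last by rewrite subSS ltnS leq_subr.
by rewrite add0n subSS subKn.
Qed.

Lemma samplesP p q : size q = M.+1 ->
  samples p = q <-> forall i, (i <= M)%N -> eta p (i%:R * h) = nth 0 q (M - i).
Proof.
move=> sq; split=> [<- i iM|H]; first by rewrite nth_samples.
apply: (@eq_from_nth _ 0); first by rewrite size_samples sq.
move=> i; rewrite size_samples ltnS => iM.
by rewrite -(subKn iM) nth_samples ?leq_subr// H ?leq_subr.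
Qed.

Lemma measurable_samples q : measurable [set p : W | samples p = q].
Proof.
have [sq|sq] := eqVneq (size q) M.+1; last first.
  rewrite (_ : [set p | _] = set0)//; apply/seteqP; split => // p /= e.
  by move: sq; rewrite -e size_samples eqxx.
rewrite (_ : [set p | _] = \bigcap_(i in [set i | (i <= M)%N]) [set p : W | eta p (i%:R * h) = nth 0 q (M - i)]).
  apply: bigcap_measurable => [|i _]; first by exists 0%N.
  exact: (measurable_eta _ [set nth 0 q (M - i)]).
by apply/seteqP; split => p /= /(samplesP p sq).
Qed.

Definition path_action (q : seq lat) (w : environment R d) : R :=
  \sum_(k < M.+1) (w (nth 0 q (M - k)) (k.+1%:R * h) - w (nth 0 q (M - k)) (k%:R * h)).

Lemma sampledP p w : sampled t M p w = path_action (samples p) w.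
Proof.
apply: eq_bigr => k _; rewrite nth_samples//; by rewrite -ltnS.
Qed.

Lemma pweightE (p : lat -> lat -> R) z q :
  pweight p z q = \prod_(0 <= i < size q) p (nth 0 (z :: q) i) (nth 0 q i).
Proof.
elim: q z => [|v s IH] z /=; first by rewrite big_geq.
by rewrite big_nat_recl// IH.
Qed.

(** By symmetry of the heat kernel, the product along the path is that of the
    walk that leaves [y] and runs backwards in time; the indicator selects the
    starting point. *)
Lemma samples_prob (x y : lat) (P : probability W R) q : srw_law x P -> size q = M.+1 ->
  (P ([set p : W | eta p t = y] `&` [set p | samples p = q]) =
   ((nth 0 q M == x)%:R * pweight (@heat_kernel R d h) y q)%:E)%E.
Proof.
move=> hP sq.
have := markov_samples hP (fun i => nth 0 (y :: q) (M.+1 - i)) M.+1 (slot_gt0 M t0).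
rewrite subn0 /= => H.
transitivity (P [set p | forall k, (k <= M.+1)%N -> eta p (k%:R * h) = nth 0 (y :: q) (M.+1 - k)]).
  congr (P _); apply/seteqP; split => p /=.
    move=> [py /(samplesP p sq) H1] k; rewrite leq_eqVlt => /orP[/eqP ->|].
      by rewrite slotM subnn.
    by rewrite ltnS => kM; rewrite subSn//= H1.
  move=> H1; split; first by have := H1 M.+1 (leqnn _); rewrite slotM subnn.
  by apply/(samplesP p sq) => i iM; rewrite H1 ?subSn// leqW.
rewrite H; congr ((_ * _)%:E); rewrite pweightE sq big_nat_rev/=.
apply: eq_big_nat => i /andP[_ iM]; rewrite add0n subSS.
have -> : (M.+1 - (M - i) = i.+1)%N by lia.
have -> : (M.+1 - (M - i).+1 = i)%N by lia.
by rewrite /= heat_kernel_sym.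
Qed.

End sample_paths.

(** * The partition function of the sampled walk *)

Section discrete_partition_function.
Context (R : realType) (d : nat).
Local Notation lat := (lattice d).
Local Notation W := (walk_space d (0 : R)).
Variable P : lat -> probability W R.
Hypothesis hP : forall x, srw_law x (P x).
Variables (t : R) (y : lat) (N0 N : nat).
Hypothesis t0 : 0 < t.
Local Notation Start := (codebox d N0).
Local Notation Box := (codebox d N).
Local Notation E := (tame_hit t y N).

Lemma measurable_tame_samples M q : measurable (E `&` [set p : W | samples t M p = q]).
Proof. by apply: measurableI; [exact: measurable_tame_hit|exact: measurable_samples]. Qed.

Definition mass M (q : seq lat) : R :=
  \sum_(x <- Start) fine (P x (E `&` [set p : W | samples t M p = q])).

Lemma mass_ge0 M q : 0 <= mass M q.
Proof. by apply: sumr_ge0 => x _; apply: fine_ge0; exact: measure_ge0. Qed.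

(** A path determines its starting point, so that only one term of the sum is
    nonzero. *)
Lemma mass_le M q : size q = M.+1 -> mass M q <= pweight (@heat_kernel R d (slot t M)) y q.
Proof.
move=> sq; have w0 : 0 <= pweight (@heat_kernel R d (slot t M)) y q.
  by apply: pweight_ge0 => u v; exact: heat_kernel_ge0.
apply: (@le_trans _ _ (\sum_(x <- Start) (nth 0 q M == x)%:R * pweight (@heat_kernel R d (slot t M)) y q)).
  apply: ler_sum => x _.
  rewrite -lee_fin fineK ?fin_num_measure//; last exact: measurable_tame_samples.
  rewrite -(samples_prob t0 y (hP x) sq); apply: le_measure; rewrite ?inE.
  - exact: measurable_tame_samples.
  - by apply: measurableI; [exact: (measurable_eta t [set y])|exact: measurable_samples].
  - by move=> p [[]].
rewrite -mulr_suml ler_piMl//.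
case: (boolP (nth 0 q M \in Start)) => qS.
  rewrite (bigD1_seq (nth 0 q M)) ?codebox_uniq//= eqxx big1 ?addr0// => x /negbTE.
  by rewrite eq_sym => ->.
rewrite big_seq big1// => x xS; case: eqP => // e; by move: qS; rewrite e xS.
Qed.

Lemma samples_in_box M p : E p -> samples t M p \in boxpaths Box M.+1.
Proof.
move=> [/= _ [_ sN]]; rewrite (mem_boxpaths Box M.+1 (samples t M p)) size_samples eqxx /=.
apply/allP => z /mapP[i]; rewrite mem_rev mem_iota/= add0n ltnS => iM ->.
rewrite /= mem_codebox etaE; apply: sN; apply: njumps_mono.
rewrite -[leRHS](slotM t M) ler_wpM2r ?(ltW (slot_gt0 M t0))// ler_nat.
exact: leqW.
Qed.

(** On tame trajectories the samples take finitely many values. *)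
Lemma integral_samples x M (f : seq lat -> R) : (forall q, 0 <= f q) ->
  (\int[P x]_(p in E) (f (samples t M p))%:E =
   \sum_(q <- boxpaths Box M.+1) (f q)%:E * P x (E `&` [set p : W | samples t M p = q]))%E.
Proof.
move=> f0; pose F q : set W := E `&` [set p : W | samples t M p = q].
have mF q : measurable (F q) by exact: measurable_tame_samples.
have uF : uniq (boxpaths Box M.+1) by apply: uniq_boxpaths; exact: codebox_uniq.
have EF : E = \big[setU/set0]_(q <- boxpaths Box M.+1) F q.
  rewrite -bigcup_seq; apply/seteqP; split => p.
    by move=> Ep; exists (samples t M p) => //=; exact: samples_in_box.
  by move=> [q _ []].
have cF q p : F q p -> f (samples t M p) = f q by move=> [_ /= ->].
rewrite {1}EF ge0_integral_bigsetU//.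
- apply: eq_bigr => q _; transitivity (\int[P x]_(p in F q) (cst (f q)%:E) p)%E.
    by apply: eq_integral => p /set_mem /cF ->.
  by rewrite integral_cst.
- by apply/trivIsetP => q q' _ _ qq'; apply/seteqP; split => // p [[_ /= e] [_ /= e']];
    move: qq'; rewrite -e e' eqxx.
- rewrite -EF => _ B mB.
  rewrite (_ : _ `&` _ = \big[setU/set0]_(q <- boxpaths Box M.+1) (if `[< B (f q)%:E >] then F q else set0)).
    by apply: bigsetU_measurable => q _; case: ifP.
  rewrite -bigcup_seq; apply/seteqP; split => p.
    move=> [Ep /= Bp]; exists (samples t M p) => /=; first exact: samples_in_box.
    by rewrite ifT//; apply/asboolP.
  move=> [q _ /=]; case: asboolP => // Bq Fp; split; first by case: Fp.
  by rewrite /= (cF _ _ Fp).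
- by move=> p _; rewrite lee_fin.
Qed.

Lemma mass_total M : \sum_(q <- boxpaths Box M.+1) mass M q = \sum_(x <- Start) fine (P x E).
Proof.
rewrite exchange_big/=; apply: eq_bigr => x _.
apply: EFin_inj; rewrite fineK ?fin_num_measure//; last exact: measurable_tame_hit.
have := integral_samples x M (f := fun=> 1) (fun _ => ler01).
rewrite integral_cst ?mul1e => [->|]; last exact: measurable_tame_hit.
rewrite -sumEFin; apply: eq_bigr => q _.
by rewrite mul1e fineK// fin_num_measure//; exact: measurable_tame_samples.
Qed.

Lemma integral_sampled x (b : R) (w : environment R d) M :
  (\int[P x]_(p in E) (expR (b * sampled t M p w))%:E =
   (\sum_(q <- boxpaths Box M.+1)
     fine (P x (E `&` [set p : W | samples t M p = q])) * expR (b * path_action t M q w))%:E)%E.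
Proof.
rewrite -sumEFin.
transitivity (\sum_(q <- boxpaths Box M.+1)
    (expR (b * path_action t M q w))%:E * P x (E `&` [set p : W | samples t M p = q]))%E.
  rewrite -integral_samples; last by move=> q; exact: expR_ge0.
  by apply: eq_integral => p _; rewrite sampledP.
apply: eq_bigr => q _; rewrite muleC EFinM fineK// fin_num_measure//.
exact: measurable_tame_samples.
Qed.

Lemma env_bounded (w : environment R d) (s : seq lat) : exists2 B, 0 <= B &
  forall z, z \in s -> forall r, 0 <= r <= t -> `|w z r| <= B.
Proof.
elim: s => [|z s [B B0 HB]]; first by exists 0.
have cw : continuous (fun r => `|w z r|).
  by move=> r; apply: continuous_comp; [exact: env_continuous|exact: norm_continuous].
have [c ct cM] := EVT_max (ltW t0) (continuous_subspaceT cw).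
exists (Num.max B `|w z c|); first by rewrite le_max B0.
move=> z'; rewrite inE => /orP[/eqP -> r rt|/HB H r rt]; rewrite le_max; last by rewrite H.
by rewrite cM ?orbT// in_itv.
Qed.

(** On tame trajectories the sampled actions are bounded uniformly in [M], for a
    given environment. *)
Lemma sampled_integral_cvg (b : R) (w : environment R d) x :
  [/\ (\int[P x]_(p in E) (expR (b * action t p w))%:E \is a fin_num)%E &
  (\int[P x]_(p in E) (expR (b * sampled t M p w))%:E)%E @[M --> \oo] -->
  (\int[P x]_(p in E) (expR (b * action t p w))%:E)%E].
Proof.
have [B B0 HB] := env_bounded w Box.
pose C := expR (`|b| * (N.+1%:R * (4 * B))).
have mE := measurable_tame_hit t y N.
have [|||||int _ cv] := @dominated_convergence _ W R (P x) E mE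
  (fun M p => (expR (b * sampled t M p w))%:E) (fun p => (expR (b * action t p w))%:E) (cst C%:E).
- move=> M; apply: measurable_funTS; apply/measurable_EFinP; apply: measurableT_comp => //.
  by apply: measurable_funM => //; exact: measurable_sampled.
- apply: measurable_funTS; apply/measurable_EFinP; apply: measurableT_comp => //.
  by apply: measurable_funM => //; exact: measurable_action.
- apply: aeW => p _; apply: cvg_EFin; first exact: nearW.
  apply: (continuous_cvg _ (@continuous_expR R _)); apply: cvgM; first exact: cvg_cst.
  exact: sampled_cvg.
- exact: finite_measure_integrable_cst.
- apply: aeW => p M [_ [cN sN]]; rewrite lee_fin ger0_norm ?expR_ge0// ler_expR.
  apply: le_trans (ler_norm _) _; rewrite normrM ler_wpM2l//.
  apply: sampled_bound => // j jc r rt; apply: HB => //.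
  by rewrite mem_codebox; exact: sN.
by split; first exact: integrable_fin_num.
Qed.
End discrete_partition_function.

(** * The restricted, sampled partition function is a lower bound *)

Section lower_bound.
Context (R : realType) (d : nat).
Local Notation lat := (lattice d).
Local Notation W := (walk_space d (0 : R)).
Variable P : forall s : R, lat -> probability (walk_space d s) R.
Hypothesis hP : forall (s : R) (x : lat), srw_law x (P s x).
Variables (beta t : R) (y : lat).
Hypothesis t0 : 0 < t.

(** Translation invariance replaces the walk from the origin by the walk from
    [x]. *)
Lemma transitionE x : transition P t (y - x) = heat_kernel t x y.
Proof.
rewrite /transition (eta_prob (hP 0 0) (y - x) t0) /=.
by rewrite -(heat_kernel_trans t 0 (y - x) x) add0r subrK.
Qed.

Lemma measurable_weight (w : environment R d) (D : set W) :
  measurable_fun D (fun p : W => (expR (beta * action t p w))%:E).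
Proof.
apply: measurable_funTS; apply/measurable_EFinP; apply: measurableT_comp => //.
by apply: measurable_funM => //; exact: measurable_action.
Qed.

(** The transition probability cancels the normalisation of the bridge. If the
    bridge is conditioned on a null event, both sides vanish. *)
Lemma ZppE x (w : environment R d) : Zpp P beta 0 x t y w =
  ((expR (- (beta ^+ 2 / 2 * t)))%:E *
   \int[P 0 x]_(p in [set p | eta p t = y]) (expR (beta * action t p w))%:E)%E.
Proof.
rewrite /Zpp /bridge_expectation subr0 transitionE (eta_prob (hP 0 x) y t0)/=.
rewrite -muleA; congr (_ * _)%E.
have [r0|r0] := eqVneq (heat_kernel t x y) 0; last by rewrite muleA -EFinM divff// mul1e.
rewrite r0 mul0e null_set_integral//.
- exact: (measurable_eta t [set y]).
- exact: measurable_weight.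
- by have := eta_prob (hP 0 x) y t0; rewrite r0.
Qed.

Lemma Zlp_ge (w : environment R d) (Start : seq lat) N : uniq Start ->
  ((expR (- (beta ^+ 2 / 2 * t)))%:E * (\sum_(x <- Start)
    \int[P 0 x]_(p in tame_hit t y N) (expR (beta * action t p w))%:E) <= Zlp P beta 0 t y w)%E.
Proof.
move=> uS; apply: esum_ge; exists [set` Start]; first by split => //; exact: finite_seq.
rewrite -fsbig_seq//= ge0_sume_distrr; last first.
  by move=> x _; apply: integral_ge0 => p _; rewrite lee_fin expR_ge0.
apply: lee_sum => x _; rewrite ZppE; apply: lee_wpmul2l; first by rewrite lee_fin expR_ge0.
apply: ge0_subset_integral; [exact: measurable_tame_hit|exact: (measurable_eta t [set y])|
 exact: measurable_weight| by move=> p _; rewrite lee_fin expR_ge0|by move=> p []].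
Qed.

Lemma discrete_eventually_small (w : environment R d) N0 N u :
  (Zlp P beta 0 t y w < (expR (- u))%:E)%E ->
  \forall M \near \oo, \sum_(q <- boxpaths (codebox d N) M.+1)
    mass (P 0) t y N0 N M q * expR (beta * path_action t M q w - beta ^+ 2 * t / 2) < expR (- u).
Proof.
move=> Zu; pose I x := (\int[P 0 x]_(p in tame_hit t y N) (expR (beta * action t p w))%:E)%E.
have Ifin x : I x \is a fin_num.
  by have [] := sampled_integral_cvg (P 0) y N t0 beta w x.
have cv : (\sum_(q <- boxpaths (codebox d N) M.+1)
    mass (P 0) t y N0 N M q * expR (beta * path_action t M q w)) @[M --> \oo] -->
    \sum_(x <- codebox d N0) fine (I x).
  rewrite (_ : (fun M => _) = fun M => \sum_(x <- codebox d N0)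
    fine (\int[P 0 x]_(p in tame_hit t y N) (expR (beta * sampled t M p w))%:E)%E); last first.
    apply/funext => M; under [RHS]eq_bigr do rewrite integral_sampled//=.
    rewrite exchange_big/=; apply: eq_bigr => q _; by rewrite /mass mulr_suml.
  elim: (codebox d N0) => [|x s IH].
    under eq_fun do rewrite big_nil; rewrite big_nil; exact: cvg_cst.
  under eq_fun do rewrite big_cons; rewrite big_cons.
  apply: cvgD IH; apply: fine_cvg; rewrite fineK//.
  by have [] := sampled_integral_cvg (P 0) y N t0 beta w x.
have Zlow := le_lt_trans (Zlp_ge w N (codebox_uniq d N0)) Zu.
have {Zlow} : expR (- (beta ^+ 2 / 2 * t)) * (\sum_(x <- codebox d N0) fine (I x)) < expR (- u).
  rewrite -lte_fin EFinM -sumEFin; under eq_bigr do rewrite fineK//; exact: Zlow.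
have cv2 : (expR (- (beta ^+ 2 / 2 * t)) * \sum_(q <- boxpaths (codebox d N) M.+1)
    mass (P 0) t y N0 N M q * expR (beta * path_action t M q w)) @[M --> \oo] -->
    expR (- (beta ^+ 2 / 2 * t)) * \sum_(x <- codebox d N0) fine (I x).
  by apply: cvgM cv; exact: cvg_cst.
move=> /(cvgr_lt _ cv2); apply: filterS => M /=; apply: le_lt_trans.
rewrite le_eqVlt; apply/orP; left; apply/eqP; rewrite mulr_sumr; apply: eq_bigr => q _.
rewrite mulrCA -expRD; congr (_ * expR _); ring.
Qed.

End lower_bound.

(** * The second moment *)

Section small_coupling.
Context (R : realType).

Lemma expR_le2x (x : R) : 0 <= x -> x <= 1 / 2 -> expR x - 1 <= 2 * x.
Proof.
move=> x0 x1; have := expR_ge1Dx (- x); have e0 := expR_gt0 x; rewrite expRN => H.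
have {}H : (1 - x) * expR x <= 1 by rewrite -ler_pdivlMr// div1r.
nra.
Qed.

Lemma expR_ge_half (h : R) : 0 <= h -> h <= 1 -> h / 2 <= 1 - expR (- h).
Proof.
move=> h0 h1; have := expR_ge1Dx h; have e0 := expR_gt0 (- h).
rewrite -[expR h]invrK -expRN => H.
have {}H : (1 + h) * expR (- h) <= 1 by rewrite -ler_pdivlMr// div1r.
nra.
Qed.

(** The reward for one step of the heat kernel is of order [c * h], the price of
    a meeting of order [beta ^+ 2 * h]; [h <= 1] keeps both linear. *)
Lemma coupling_small (c beta h : R) : 0 < beta -> beta <= 1 / 2 -> beta <= c / 16 ->
  0 < h -> h <= 1 -> (expR (2 * (beta ^+ 2 * h)) - 1) * 2 <= c * (1 - expR (- h)).
Proof.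
move=> b0 b1 bc h0 h1.
have bb : beta ^+ 2 * h <= beta / 2 * h.
  by rewrite ler_wpM2r ?(ltW h0)// expr2 ler_wpM2l ?(ltW b0)// -div1r.
have b2 : 0 <= beta ^+ 2 * h by rewrite mulr_ge0 ?sqr_ge0 ?ltW.
have bh : beta * h <= 1 / 2 by nra.
have H1 : expR (2 * (beta ^+ 2 * h)) - 1 <= 2 * (2 * (beta ^+ 2 * h)).
  by apply: expR_le2x; lra.
have H2 := expR_ge_half (ltW h0) h1.
have c0 : 0 < c by lra.
have H3 : c * (h / 2) <= c * (1 - expR (- h)) by rewrite ler_wpM2l ?(ltW c0).
have H4 : beta * h <= c / 16 * h by rewrite ler_wpM2r ?(ltW h0).
lra.
Qed.

End small_coupling.

Section second_moment.
Context (R : realType) (d : nat).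
Local Notation lat := (lattice d).
Hypothesis hd : (3 <= d)%N.
Variables A c : R.
Hypothesis A5 : 5000 <= A.
Hypothesis c0 : 0 < c.
Hypothesis pole : forall x : lat, nbr_average (green A) x <= green A x - c * (x == 0)%:R.

Definition pair_weight (x y : lat) : R := 1 + green A (x - y).

Lemma pair_weight_super h (Box : seq lat) x y : 0 < h -> uniq Box ->
  \sum_(z <- Box) heat_kernel h x z * pair_weight z y <=
  pair_weight x y - c * (1 - expR (- h)) * (x == y)%:R.
Proof.
move=> h0 uB; rewrite -lee_fin -sumEFin.
under eq_bigr do rewrite EFinM heat_kernelE//.
apply: (heat_series_superharmonic (psi := fun z => pair_weight z y)) => //.
- by move=> z; rewrite addr_ge0// ltW// green_gt0.
- exact: ltW.
move=> z; have := pole (z - y); rewrite subr_eq0.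
have -> : nbr_average (fun z => pair_weight z y) z = 1 + nbr_average (green A) (z - y).
  rewrite /nbr_average /pair_weight big_split/= mulrDl sumr_const; congr (_ + _).
    rewrite card_prod card_bool card_ord -[1 *+ _]mulr_natr mul1r divff//.
    by rewrite pnatr_eq0 muln_eq0/= -lt0n (leq_trans _ hd).
  by congr (_ / _); apply: eq_bigr => s _; rewrite addrAC.
rewrite /pair_weight; lra.
Qed.

Lemma second_moment h beta (Box : seq lat) M y : 0 < h -> h <= 1 -> uniq Box ->
  0 < beta -> beta <= 1 / 2 -> beta <= c / 16 ->
  \sum_(q <- boxpaths Box M) \sum_(q' <- boxpaths Box M)
    pweight (@heat_kernel R d h) y q * pweight (@heat_kernel R d h) y q' *
    expR (2 * (beta ^+ 2 * h)) ^+ meetings q q' <= 2.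
Proof.
move=> h0 h1 uB b0 b1 bc.
set e := expR _; have e1 : 0 <= e - 1.
  by rewrite subr_ge0 -[leLHS]expR0 ler_expR mulr_ge0// mulr_ge0 ?sqr_ge0 ?ltW.
have := @second_moment_meetings R d Box (@heat_kernel R d h) pair_weight
  (c * (1 - expR (- h))) (e - 1) 2.
rewrite subrKC => /(_ _ _ _ _ e1 _ _ _ M y y) H.
have {}H : e * (\sum_(q <- boxpaths Box M) \sum_(q' <- boxpaths Box M)
    pweight (@heat_kernel R d h) y q * pweight (@heat_kernel R d h) y q' * e ^+ meetings q q') <= e * pair_weight y y.
  have := H; rewrite eqxx mulr1 subrKC; apply.
  - by move=> *; exact: heat_kernel_ge0.
  - by move=> x z; rewrite /pair_weight -opprB greenN.
  - by move=> x z; rewrite lerDl ltW// green_gt0.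
  - by move=> x z; rewrite /pair_weight -[leRHS]/(1 + 1) lerD2l green_le1.
  - by rewrite mulr_ge0 ?(ltW c0)// subr_ge0 -[leRHS]expR0 ler_expR oppr_le0 ltW.
  - exact: coupling_small.
  - by move=> x z; exact: pair_weight_super.
move: H; rewrite ler_pM2l ?expR_gt0// => /le_trans; apply.
by rewrite /pair_weight -[leRHS]/(1 + 1) lerD2l green_le1.
Qed.

End second_moment.

(** * Lower tail for the sampled walk *)

Section occupation.
Context (R : realType) (d : nat).
Local Notation lat := (lattice d).
Variables (Box : seq lat) (M : nat).
Hypothesis uBox : uniq Box.
Local Notation cs := (coords Box M.+1).

Definition occupies (q : seq lat) (i : 'I_(size cs)) : bool :=
  nth 0 q (M - (coord Box M.+1 i).1) == (coord Box M.+1 i).2.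

(** During each slot a path in the box sits at exactly one site. *)
Lemma occupation_sum (q : seq lat) (f : nat * lat -> R) : q \in boxpaths Box M.+1 ->
  \sum_(i < size cs) (occupies q i)%:R * f (coord Box M.+1 i) = \sum_(k < M.+1) f (val k, nth 0 q (M - k)).
Proof.
rewrite mem_boxpaths => /andP[/eqP sq /allP qB].
transitivity (\sum_(kz <- cs) (nth 0 q (M - kz.1) == kz.2)%:R * f kz).
  by rewrite (big_nth (0%N, 0)) big_mkord.
rewrite big_allpairs_dep -(big_mkord xpredT (fun k => f (k, nth 0 q (M - k)))).
rewrite /index_iota subn0 [LHS]big_seq [RHS]big_seq; apply: eq_bigr => k.
rewrite mem_iota add0n => /andP[_ kM].
have zB : nth 0 q (M - k) \in Box by apply/qB/mem_nth; rewrite sq ltnS leq_subr.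
rewrite (bigD1_seq _ zB uBox)/= eqxx mul1r big1 ?addr0// => z.
by rewrite eq_sym => /negbTE ->; rewrite mul0r.
Qed.

Lemma meetingsE (q q' : seq lat) : size q = size q' ->
  meetings q q' = (\sum_(0 <= i < size q) (nth 0%R q i == nth 0%R q' i))%N.
Proof.
elim: q q' => [|x s IH] [|x' s'] //= => [_|[/IH ->]]; first by rewrite big_geq.
by rewrite big_nat_recl.
Qed.

End occupation.

Section gaussian_side.
Context (R : realType) (d : nat).
Local Notation lat := (lattice d).
Local Notation W := (walk_space d (0 : R)).
Hypothesis hd : (3 <= d)%N.
Variables (A c : R).
Hypothesis A5 : 5000 <= A.
Hypothesis c0 : 0 < c.
Hypothesis pole : forall x : lat, nbr_average (green A) x <= green A x - c * (x == 0)%:R.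
Variable Q : probability (env_space R d) R.
Hypothesis hQ : wiener_environment Q.
Variable P : lat -> probability W R.
Hypothesis hP : forall x, srw_law x (P x).
Variables (beta t : R) (y : lat) (N0 N M : nat).
Hypothesis b0 : 0 < beta.
Hypothesis b1 : beta <= 1 / 2.
Hypothesis bc : beta <= c / 16.
Hypothesis t0 : 0 < t.
Hypothesis h1 : slot t M <= 1.
Hypothesis half : 1 / 2 <= \sum_(x <- codebox d N0) fine (P x (tame_hit t y N)).
Local Notation Box := (codebox d N).
Local Notation h := (slot t M).
Local Notation paths := (boxpaths Box M.+1).
Local Notation n := (size (coords Box M.+1)).
Local Notation J := 'I_(size paths).

Definition path_at (j : J) : seq lat := nth [::] paths j.
Definition path_mass (j : J) : R := mass P t y N0 N M (path_at j).
Definition path_coef (j : J) (i : 'I_n) : R := beta * (occupies (path_at j) i)%:R.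

Let h0 : 0 < h. Proof. exact: slot_gt0. Qed.
Let uB : uniq Box. Proof. exact: codebox_uniq. Qed.

Lemma path_atP j : path_at j \in paths.
Proof. exact: mem_nth. Qed.

Lemma sum_paths (F : seq lat -> R) : \sum_(q <- paths) F q = \sum_j F (path_at j).
Proof. by rewrite (big_nth [::]) big_mkord. Qed.

Lemma size_path_at j : size (path_at j) = M.+1.
Proof. by have := path_atP j; rewrite mem_boxpaths => /andP[/eqP]. Qed.

Lemma dot_increments j w : dot (path_coef j) (increments Box h M.+1 w) =
  beta * path_action t M (path_at j) w.
Proof.
rewrite /dot /path_action -(occupation_sum uB (fun kz => increment h kz w) (path_atP j)) mulr_sumr.
by apply: eq_bigr => i _; rewrite tnth_mktuple /path_coef mulrA.
Qed.

(** Each common slot and site contributes [beta ^+ 2] times the variance [h] of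
    the corresponding increment. *)
Lemma overlap_meetings j l : overlap (Num.sqrt h) path_coef j l =
  beta ^+ 2 * h * (meetings (path_at j) (path_at l))%:R.
Proof.
rewrite meetingsE ?size_path_at// natr_sum.
rewrite big_nat_rev/= big_mkord /=.
under [in RHS]eq_bigr do rewrite add0n subSS.
rewrite -(occupation_sum uB (fun kz => (kz.2 == nth 0 (path_at l) (M - kz.1))%:R) (path_atP j)).
rewrite mulr_sumr; apply: eq_bigr => i _.
rewrite sqr_sqrtr ?(ltW h0)// /path_coef /occupies [_ == nth _ (path_at l) _]eq_sym; ring.
Qed.

Lemma overlap_self j : overlap (Num.sqrt h) path_coef j j = beta ^+ 2 * t.
Proof.
rewrite overlap_meetings meetingsE// size_path_at.
under eq_bigr do rewrite eqxx.
by rewrite sum_nat_const_nat muln1 subn0 -mulrA [h * _]mulrC slotM.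
Qed.

Lemma gibbs_sum_increments w : gibbs_sum (Num.sqrt h) path_mass path_coef (increments Box h M.+1 w) =
  \sum_(q <- paths) mass P t y N0 N M q * expR (beta * path_action t M q w - beta ^+ 2 * t / 2).
Proof.
by rewrite sum_paths; apply: eq_bigr => j _; rewrite /wick dot_increments overlap_self.
Qed.

(** Replacing the masses by products of heat kernels only increases the sum,
    which [second_moment] bounds. *)
Lemma overlap_moment : \sum_j \sum_l path_mass j * path_mass l *
   expR (2 * overlap (Num.sqrt h) path_coef j l) <= 2.
Proof.
apply: le_trans (second_moment hd A5 c0 pole M.+1 y h0 h1 uB b0 b1 bc).
rewrite sum_paths; apply: ler_sum => j _; rewrite sum_paths; apply: ler_sum => l _.
rewrite overlap_meetings mulrA [_ * _%:R]mulrC expRM_natl.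
rewrite ler_wpM2r ?exprn_ge0 ?expR_ge0//.
by apply: ler_pM; rewrite ?mass_ge0// mass_le// size_path_at.
Qed.

Let small_gibbs_sum u : set (n.-tuple R) := [set v | gibbs_sum (Num.sqrt h) path_mass path_coef v < expR (- u)].

Let measurable_small_gibbs_sum u : measurable (small_gibbs_sum u).
Proof.
rewrite (_ : small_gibbs_sum u = setT `&` gibbs_sum (Num.sqrt h) path_mass path_coef @^-1` `]-oo, (expR (- u))[%classic).
  by apply: measurable_gibbs_sum => //; exact: measurable_itv.
by apply/seteqP; split => v; rewrite /small_gibbs_sum/= in_itv/=; [split|case].
Qed.

Definition small_discrete u : set (env_space R d) := [set w | \sum_(q <- paths)
  mass P t y N0 N M q * expR (beta * path_action t M q w - beta ^+ 2 * t / 2) < expR (- u)].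

Let small_discreteE u : small_discrete u = increments Box h M.+1 @^-1` small_gibbs_sum u.
Proof. by apply/seteqP; split => w; rewrite /small_gibbs_sum/= gibbs_sum_increments. Qed.

Lemma measurable_small_discrete u : measurable (small_discrete u).
Proof.
by have := measurable_increments hQ h measurableT (measurable_small_gibbs_sum u); rewrite setTI -small_discreteE.
Qed.

Lemma discrete_lower_tail u : 0 < u ->
  (Q (small_discrete u) <= (512 * expR (64^-1) * expR (- (u ^+ 2 / 1024)))%:E)%E.
Proof.
move=> u0; have sg0 : Num.sqrt h != 0 by rewrite gt_eqF// sqrtr_gt0.
rewrite small_discreteE increments_law//.
have := @polymer_lower_tail R (Num.sqrt h) sg0 n J path_mass path_coef 2 _ _ _ overlap_moment u u0.
have -> : (256 * 2 = 512 :> R) by ring.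
have -> : (32 * 2 = 64 :> R) by ring.
have -> : (16 * 64 = 1024 :> R) by ring.
apply.
- by move=> j; exact: mass_ge0.
- by rewrite -sum_paths mass_total.
- by move=> j i; rewrite mulr_ge0// ltW.
Qed.

End gaussian_side.

(** * The lower tail of the partition function *)

(** The set [A] is arbitrary, whence the outer measure; it is covered by an
    increasing union of the measurable sets where [S M] holds from some rank
    on. *)
Lemma eventually_prob_le d (T : measurableType d) (R : realType) (Q : probability T R)
    (S : nat -> set T) (b : \bar R) (A : set T) :
  (forall M, measurable (S M)) -> (\forall M \near \oo, (Q (S M) <= b)%E) ->
  (forall w, A w -> \forall M \near \oo, S M w) ->
  (completed_measure_extension (mu := Q) A <= b)%E.
Proof.
move=> mS [M1 _ Sb] AS.
pose L k := \bigcap_(M in [set M | (M1 + k <= M)%N]) S M.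
have mL k : measurable (L k) by apply: bigcap_measurable => //; exists (M1 + k)%N => /=.
have mU : measurable (\bigcup_k L k) by exact: bigcupT_measurable.
have AL : A `<=` \bigcup_k L k.
  move=> w /AS[k _ H]; exists k => // M /= kM; apply: H => /=.
  exact: leq_trans (leq_addl _ _) kM.
apply: (le_trans (le_mu_ext Q AL)); rewrite measurable_mu_extE//.
have cv : (Q \o L) k @[k --> \oo] --> Q (\bigcup_k L k).
  apply: nondecreasing_cvg_mu => // i j ij; apply/subsetPset => w H M /= jM; apply: H => /=.
  by apply: leq_trans jM; rewrite leq_add2l.
apply: (cvge_to_le cv); apply: nearW => k /=; apply: le_trans (Sb (M1 + k)%N (leq_addr _ _)).
by apply: le_measure; rewrite ?inE// => w; apply => /=.
Qed.

Theorem theorem2p5 (R : realType) (d : nat) (hd : (3 <= d)%N)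
    (P : forall s : R, lattice d -> probability (walk_space d s) R)
    (hP : forall (s : R) (x : lattice d), srw_law x (P s x))
    (Q : probability (env_space R d) R) (hQ : wiener_environment Q) :
  exists2 beta0 : R, 0 < beta0 &
    forall beta : R, 0 < beta -> beta < beta0 ->
      exists2 c : R, 0 < c &
        forall y : lattice d, forall t u : R, 0 < t -> 0 < u ->
          (completed_measure_extension (mu := Q)
             [set w | Zlp P beta 0 t y w < (expR (- u))%:E]
           < (c * expR (- (u ^+ 2 / c)))%:E)%E.
Proof.
have [A A5] : exists A : R, 5000 <= A by exists 5000.
have [c c0 pole] := green_pole A5 hd.
exists (Num.min (1 / 2) (c / 16)); first by rewrite lt_min !divr_gt0.
move=> beta b0; rewrite lt_min => /andP[/ltW b1 /ltW bc].
have e1 : 1 <= expR (64^-1 : R) by rewrite -[leLHS]expR0 ler_expR invr_ge0.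
have c1 : 1024 <= 1024 * expR (64^-1) :> R by lra.
(* The bound has prefactor 512 exp(1/64) and rate 1/1024. Doubling the
   prefactor makes the inequality strict, and its being at least 1024 allows
   it to serve as the rate. *)
exists (1024 * expR (64^-1)) => [|y t u t0 u0]; first lra.
have [N0 [N half]] := tame_mass (hP 0) y t0.
apply: (@le_lt_trans _ _ (512 * expR (64^-1) * expR (- (u ^+ 2 / 1024)))%:E).
  apply: (eventually_prob_le (S := fun M => small_discrete (P 0) beta t y N0 N M u)).
  - by move=> M; exact: (measurable_small_discrete hQ (P 0) beta y N0 N M t0 u).
  - have /cvgr_le : slot t M @[M --> \oo] --> (0 : R) := slot_cvg t.
    move=> /(_ 1 ltr01); apply: filterS => M h1.
    exact: (discrete_lower_tail hd A5 c0 pole).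
  - by move=> w Zw; exact: discrete_eventually_small.
move: c1; set C := 1024 * expR _ => c1.
have H1 : u ^+ 2 / C <= u ^+ 2 / 1024.
  by apply: ler_wpM2l; [exact: sqr_ge0|rewrite lef_pV2 ?posrE; lra].
have H2 : expR (- (u ^+ 2 / 1024)) <= expR (- (u ^+ 2 / C)) by rewrite ler_expR lerN2.
have H3 := expR_gt0 (- (u ^+ 2 / 1024)).
rewrite lte_fin; apply: (@lt_le_trans _ _ (C * expR (- (u ^+ 2 / 1024)))).
  by rewrite ltr_pM2r // /C; lra.
by rewrite ler_wpM2l//; lra.
Qed.
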